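(* Fix $T>0$, $N\in\mathbb N$. Assume (for each dimension $D$) that $X$ satisfies Condition (C3)$_p$ for some $p>2$ including all properties in its item 2(c), and that $g$ satisfies Condition (C5). Then for every $n=0,\dots,N-1$ there exist constants $c_{n+1},q_{n+1},\tau_{n+1}\in[1,\infty)$, independent of $D$, such that for every $D$, every $\varepsilon>0$ and every $N_0\in\mathbb N$ there exists a ReLU neural network $\hat V_{n+1}:\mathbb R^D\to\mathbb R$ with $$\Big(\int_{\mathbb R^D}(V_{n+1}(z)-\hat V_{n+1}(z))^2\,d\tilde\rho^{N_0}_{n+1}(z)\Big)^{1/2}\le\varepsilon,$$ $$\mathrm{size}(\hat V_{n+1})\le c_{n+1}D^{q_{n+1}}\varepsilon^{-\tau_{n+1}},\qquad \mathrm{Growth}(\hat V_{n+1})\le c_{n+1}D^{q_{n+1}}\varepsilon^{-\tau_{n+1}}.$$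
   Context: Dimension convention: $D$ varies; ''independent of $D$'' means uniform over all $D$. Setting: $(\Omega,\mathcal F,\mathbb F=(\mathcal F_t)_{t\in[0,T]},\mathbb P)$ carries a $D$-dimensional $\mathbb F$-Brownian motion $W$ and an $\mathbb F$-adapted $\mathbb R^D$-valued process $X$ with $X_0=x_0$. $t_n=nT/N$, $\mathbb F^{dis}=(\mathcal F_{t_n})_n$. For $N_0\in\mathbb N$: $\Delta t=T/(NN_0)$, $t^n_k=t_n+k\Delta t$, $\Delta W_{t^n_k}=W_{t^n_{k+1}}-W_{t^n_k}$, and $\tilde\rho^{N_0}_{n+1}(A)=\mathbb E\big[\sum_{k=0}^{N_0-1}\|\Delta W_{t^n_k}\|^2 1_A(X_{t_{n+1}})\big]$ for Borel $A\subset\mathbb R^D$. Value functions: $V_N(x)=g(t_N,x)$ and $V_n(x)=\max\big(g(t_n,x),\mathbb E[V_{n+1}(f_n(x,\cdot))]\big)$, so that $V_n(X_{t_n})$ is the Snell envelope $\operatorname{ess\,sup}_\tau\mathbb E[g(\tau,X_\tau)\mid\mathcal F_{t_n}]$. Neural networks: finite feed-forward ReLU networks; size = number of nonzero weights and biases; $\mathrm{Growth}(f)=\sup_x\|f(x)\|/(1+\|x\|)$; $\mathrm{Lip}$ = minimal Lipschitz constant. Random neural networks (RanNN): with $\sigma$ the componentwise ReLU, an infinite-width network of depth $I$ from $\mathbb R^{d_1}$ to $\mathbb R^{d_3}$ is $f=f_{I+1}\circ\cdots\circ f_1$ with hidden spaces $\ell^2(\mathbb N)$, $f_1(x)=W^1x+b^1$,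 $f_{i+1}(y)=W^{i+1}\sigma(y)+b^{i+1}$, where the layer parameters are $\mu_i=\sum_{m\ge0}w^{i+1}_m\delta_m$ ($b^{i+1}=w^{i+1}_0$, $W^{i+1}x=\sum_{m\ge1}w^{i+1}_mx_{m-1}$) with finite total variation norm $\sum_m\|w^{i+1}_m\|$; a RanNN is $\tilde f(x,\omega)=f(x,\mu(\omega))$ for a random parameter $\mu$; $\mathrm{size}(\tilde f)(\omega)$ counts nonzero scalar entries of all $w^{i+1}_m(\omega)$; $\mathrm{Growth}(\tilde f)(\omega)=\sup_x\|\tilde f(x,\omega)\|/(1+\|x\|)$. Condition (C3)$_p$ (constants $c,q>0$ independent of $D$): (1) $X$ is $\mathbb F^{dis}$-Markov and there are $\mathcal B(\mathbb R^D)\otimes\mathcal F_{t_{n+1}}$-measurable $f_n:\mathbb R^D\times\Omega\to\mathbb R^D$ with (a) $X_{t_{n+1}}=f_n(X_{t_n},\cdot)$ a.s.; (b) $f_n(x,\cdot)$ independent of $\mathcal F_{t_n}$ for each $x$; (c) $\mathbb E[X_{t_{n+1}}\mid\mathcal F_{t_n}]=\mathbb E[X_{t_{n+1}}\mid X_{t_n}]=\mathbb E[f_n(x,\cdot)]|_{x=X_{t_n}}$. (2)(a) $(\mathbb E|\mathrm{Growth}(f_n(\cdot,\omega))|^p)^{1/p}\le cD^q$; (b) there is a RanNN $\hat f_n$ of depth $\le cD^q$ with $f_n(x,\omega)=\hat f_n(x,\omega)$ for all $x$, a.s.; (c) $\mathbb E[\mathrm{size}(\hat f_n)]\le cD^q$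 and $\|x_0\|\le cD^q$. Condition (C5) (constants $c,q,r>0$ independent of $D$): for every $\varepsilon>0$, $n=0,\dots,N$ there is a ReLU network $\hat g_n$ with $|\hat g_n(x)-g(t_n,x)|\le\varepsilon cD^q(1+\|x\|)$, $\mathrm{size}(\hat g_n)\le cD^q\varepsilon^{-r}$, $\mathrm{Lip}(\hat g_n)\le cD^q$, $|g(t_n,0)|\le cD^q$. *)

(* Defs.v *)
From mathcomp Require Import all_boot all_order all_algebra.
From mathcomp Require Import all_classical all_reals all_analysis.
Set Implicit Arguments.
Unset Strict Implicit.
Unset Printing Implicit Defensive.
Import Order.TTheory GRing.Theory Num.Theory numFieldNormedType.Exports.
Local Open Scope classical_set_scope.
Local Open Scope ring_scope.

Section Defs.
Context {R : realType}.

Definition enorm {D : nat} (x : 'cV[R]_D) : R :=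
  Num.sqrt (\sum_(i < D) x i 0 ^+ 2).

(* Borel sigma-algebra of R^D: generated by the open sets (the topology of
   'cV[R]_D is the product topology, i.e. the Euclidean one). *)
Definition BorelD (D : nat) : set (set 'cV[R]_D) :=
  <<s [set A | open A] >>.
Arguments BorelD D : clear implicits.

Definition BorelR : set (set R) := <<s [set A | open A] >>.

Variables (d : measure_display) (Omega : measurableType d).

Definition vmeasurable_wrt (G : set (set Omega)) {D : nat}
  (Y : Omega -> 'cV[R]_D) : Prop :=
  forall B, BorelD D B -> G (Y @^-1` B).

Definition rmeasurable_wrt (G : set (set Omega)) (Y : Omega -> R) : Prop :=
  forall B, BorelR B -> G (Y @^-1` B).

Definition sigma_of {D : nat} (Y : Omega -> 'cV[R]_D) : set (set Omega) :=
  [set Y @^-1` B | B in BorelD D].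

Definition indep_of (P : probability Omega R) (G : set (set Omega)) {D : nat}
  (Y : Omega -> 'cV[R]_D) : Prop :=
  forall A B, G A -> BorelD D B ->
    P (A `&` (Y @^-1` B)) = (P A * P (Y @^-1` B))%E.

Definition cond_exp_version (P : probability Omega R) (G : set (set Omega))
  (Z Y : Omega -> R) : Prop :=
  P.-integrable setT (EFin \o Z) /\
  rmeasurable_wrt G Y /\ P.-integrable setT (EFin \o Y) /\
  forall A, G A ->
    (\int[P]_(w in A) (Y w)%:E = \int[P]_(w in A) (Z w)%:E)%E.

Definition is_filtration (T : R) (F : R -> set (set Omega)) : Prop :=
  (forall t, 0 <= t <= T -> sigma_algebra setT (F t)) /\
  (forall t, 0 <= t <= T -> F t `<=` measurable) /\
  (forall s t, 0 <= s -> s <= t -> t <= T -> F s `<=` F t).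

Definition is_F_BM (P : probability Omega R) (T : R)
  (F : R -> set (set Omega)) {D : nat} (W : R -> Omega -> 'cV[R]_D) : Prop :=
  (forall w, W 0 w = 0) /\
  (forall w, {within `[0, T], continuous (fun t => W t w)}) /\
  (forall t, 0 <= t <= T -> vmeasurable_wrt (F t) (W t)) /\
  (forall s t, 0 <= s -> s <= t -> t <= T ->
     indep_of P (F s) (fun w => W t w - W s w)) /\
  (forall s t, 0 <= s -> s < t -> t <= T -> forall a b : 'cV[R]_D,
     P [set w | forall i, a i 0 < W t w i 0 - W s w i 0 <= b i 0] =
     (\prod_(i < D) normal_prob 0%R (Num.sqrt (t - s)) `]a i ord0, b i ord0])%E).

Definition relu_vec {m : nat} (y : 'cV[R]_m) : 'cV[R]_m :=
  \col_i Num.max (y i 0) 0.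

Inductive relu_net : nat -> nat -> Type :=
| NLast d1 d2 (A : 'M[R]_(d2, d1)) (b : 'cV[R]_d2) : relu_net d1 d2
| NCons d1 d2 d3 (A : 'M[R]_(d2, d1)) (b : 'cV[R]_d2)
    (rest : relu_net d2 d3) : relu_net d1 d3.

Fixpoint net_eval {d1 d3} (phi : relu_net d1 d3) : 'cV[R]_d1 -> 'cV[R]_d3 :=
  match phi in relu_net d1 d3 return 'cV[R]_d1 -> 'cV[R]_d3 with
  | NLast _ _ A b => fun x => A *m x + b
  | NCons _ _ _ A b rest => fun x => net_eval rest (relu_vec (A *m x + b))
  end.

Definition nnz_mx {m n} (A : 'M[R]_(m, n)) : nat :=
  (\sum_(i < m) \sum_(j < n) (A i j != 0%R))%N.

Fixpoint net_size {d1 d3} (phi : relu_net d1 d3) : nat :=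
  match phi with
  | NLast _ _ A b => (nnz_mx A + nnz_mx b)%N
  | NCons _ _ _ A b rest => (nnz_mx A + nnz_mx b + net_size rest)%N
  end.

Definition net_fun {D} (phi : relu_net D 1) (x : 'cV[R]_D) : R :=
  net_eval phi x 0 0.

(* parameters: w i m j = j-th coordinate of w^{i+1}_m  (layer i = 0..I)     *)
(* hidden spaces are l^2(N), represented as sequences nat -> R              *)
Definition affine_seq (w : nat -> nat -> R) (y : nat -> R) : nat -> R :=
  fun j => w 0%N j + limn (fun K => \sum_(1 <= m < K) w m j * y m.-1).

Definition vec_to_seq {n} (x : 'cV[R]_n) : nat -> R :=
  fun k => if insub k is Some i then x i 0 else 0.

Fixpoint rnn_hidden (w : nat -> nat -> nat -> R) (y0 : nat -> R) (i : nat)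
  : nat -> R :=
  match i with
  | 0%N => affine_seq (w 0%N) y0
  | i'.+1 => affine_seq (w i) (fun k => Num.max (rnn_hidden w y0 i' k) 0)
  end.

Definition rnn_eval {d1 d3 : nat} (I : nat) (w : nat -> nat -> nat -> R)
  (x : 'cV[R]_d1) : 'cV[R]_d3 :=
  \col_(j < d3) rnn_hidden w (vec_to_seq x) I j.

Definition l2sq (v : nat -> R) : \bar R := (\sum_(j <oo) ((v j) ^+ 2)%:E)%E.

(* admissible parameter of a network of depth I from R^d1 to R^d3:
   every w^{i+1}_m lies in l^2, the total variation norm sum_m ||w_m||
   is finite, the first layer only acts on the d1 input coordinates and
   the last layer has values in R^d3. *)
Definition rnn_param_ok (d1 d3 I : nat) (w : nat -> nat -> nat -> R) : Prop :=
  (forall i m, (i <= I)%N -> (l2sq (w i m) < +oo)%E) /\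
  (forall i, (i <= I)%N ->
     (\sum_(m <oo) (Num.sqrt (fine (l2sq (w i m))))%:E < +oo)%E) /\
  (forall m j, (d1 < m)%N -> w 0%N m j = 0) /\
  (forall m j, (d3 <= j)%N -> w I m j = 0).

Definition is_RanNN (d1 d3 I : nat) (mu : Omega -> nat -> nat -> nat -> R)
  : Prop :=
  (forall i m j, measurable_fun setT (fun w => mu w i m j)) /\
  (forall w, rnn_param_ok d1 d3 I (mu w)).

Definition rnn_size (I : nat) (w : nat -> nat -> nat -> R) : \bar R :=
  (\sum_(i < I.+1) \esum_(mj in [set: nat * nat])
      ((w i mj.1 mj.2 != 0)%:R)%:E)%E.

Definition growthE {D m : nat} (h : 'cV[R]_D -> 'cV[R]_m) : \bar R :=
  ereal_sup [set ((enorm (h x)) / (1 + enorm x))%:E | x in [set: 'cV[R]_D]].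

Definition tgrid (T : R) (N n : nat) : R := n%:R * T / N%:R.

(* V_n via k = N - n:  Vaux 0 = g(t_N, .),
   Vaux (k+1) x = max (g(t_{N-k-1}, x), E[Vaux k (f_{N-k-1}(x, .))]) *)
Fixpoint Vaux (P : probability Omega R) (T : R) (N : nat) {D : nat}
  (g : R -> 'cV[R]_D -> R) (f : nat -> 'cV[R]_D -> Omega -> 'cV[R]_D)
  (k : nat) : 'cV[R]_D -> R :=
  match k with
  | 0%N => g (tgrid T N N)
  | k'.+1 => fun x =>
      Num.max (g (tgrid T N (N - k)) x)
        (Rintegral P setT (fun w => Vaux P T N g f k' (f (N - k)%N x w)))
  end.

Definition Vfun (P : probability Omega R) (T : R) (N : nat) {D : nat}
  (g : R -> 'cV[R]_D -> R) (f : nat -> 'cV[R]_D -> Omega -> 'cV[R]_D)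
  (n : nat) : 'cV[R]_D -> R := Vaux P T N g f (N - n).

(* integral of h against rho~^{N0}_{n+1}:
   E[ sum_{k<N0} ||W_{t^n_{k+1}} - W_{t^n_k}||^2 h(X_{t_{n+1}}) ] *)
Definition rho_integral (P : probability Omega R) (T : R) (N N0 n : nat)
  {D : nat} (W X : R -> Omega -> 'cV[R]_D) (h : 'cV[R]_D -> R) : \bar R :=
  let dt := T / (N * N0)%:R in
  let tk k := tgrid T N n + k%:R * dt in
  (\int[P]_w
     ((\sum_(k < N0) enorm (W (tk k.+1) w - W (tk k) w) ^+ 2)
        * h (X (tgrid T N n.+1) w))%:E)%E.

Definition cond_C3 (P : probability Omega R) (T : R) (N : nat)
  (F : R -> set (set Omega)) {D : nat} (X : R -> Omega -> 'cV[R]_D)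
  (x0 : 'cV[R]_D) (f : nat -> 'cV[R]_D -> Omega -> 'cV[R]_D)
  (p c q : R) : Prop :=
  (forall n, (n < N)%N -> forall B, BorelD D B ->
     exists Y : Omega -> R,
       rmeasurable_wrt (sigma_of (X (tgrid T N n))) Y /\
       cond_exp_version P (F (tgrid T N n))
         (fun w => (X (tgrid T N n.+1) w \in B)%:R) Y) /\
  (forall n, (n < N)%N ->
     (forall B, BorelD D B ->
        <<s [set A `*` E | A in BorelD D & E in F (tgrid T N n.+1)] >>
          ((fun xw : 'cV[R]_D * Omega => f n xw.1 xw.2) @^-1` B)) /\
     {ae P, forall w, X (tgrid T N n.+1) w = f n (X (tgrid T N n) w) w} /\
     (forall x, indep_of P (F (tgrid T N n)) (f n x)) /\
     (forall i : 'I_D,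
        let m w := Rintegral P setT (fun w' => f n (X (tgrid T N n) w) w' i 0) in
        cond_exp_version P (F (tgrid T N n))
          (fun w => X (tgrid T N n.+1) w i 0) m /\
        cond_exp_version P (sigma_of (X (tgrid T N n)))
          (fun w => X (tgrid T N n.+1) w i 0) m)) /\
  (forall n, (n < N)%N ->
     ((\int[P]_w ((growthE (fun x => f n x w)) `^ p)) `^ p^-1
        <= (c * D%:R `^ q)%:E)%E /\
     exists (I : nat) (mu : Omega -> nat -> nat -> nat -> R),
       is_RanNN D D I mu /\ I%:R <= c * D%:R `^ q /\
       {ae P, forall w, forall x, f n x w = rnn_eval I (mu w) x} /\
       (\int[P]_w rnn_size I (mu w) <= (c * D%:R `^ q)%:E)%E) /\
  enorm x0 <= c * D%:R `^ q.

End Defs.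

Definition cond_C5 {R : realType} (T : R) (N D : nat)
  (g : R -> 'cV[R]_D -> R) (c q r : R) : Prop :=
  forall (eps : R), 0 < eps -> forall n, (n <= N)%N ->
    (exists gh : relu_net D 1,
      (forall x, `|net_fun gh x - g (tgrid T N n) x|
                   <= eps * c * D%:R `^ q * (1 + enorm x)) /\
      (net_size gh)%:R <= c * D%:R `^ q * eps `^ (- r) /\
      (forall x y, `|net_fun gh x - net_fun gh y| <= c * D%:R `^ q * enorm (x - y)))
    /\ `|g (tgrid T N n) 0| <= c * D%:R `^ q.

(* Main.v *)
Require Import Defs.
From mathcomp Require Import all_boot all_order all_algebra.
From mathcomp Require Import all_classical all_reals all_analysis.
From mathcomp Require Import measurable_realfun ring lra zify.
Set Implicit Arguments.
Unset Strict Implicit.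
Unset Printing Implicit Defensive.
Import Order.TTheory GRing.Theory Num.Theory numFieldNormedType.Exports.
Local Open Scope classical_set_scope.
Local Open Scope ring_scope.

(** The value functions are approximated by backward induction on the time index.
    If [h] is a network close to V_{k+1}, then the conditional expectation
    E[V_{k+1}(f(x, .))] is approximated by a Monte Carlo average
    M^-1 * \sum_j h(f(x, omega_j)); for almost every omega_j the function
    f(., omega_j) is a ReLU network, since a random network of finite size has
    finitely many nonzero entries, so the average and its maximum with a network for g
    are networks again.  The omega_j are chosen one after the other, keeping the
    weighted mean square error and the total size below a constant times their
    expectations; this is done for an arbitrary weight S and state Y with
    E[S (1 + |Y|)^2] <= 1, which makes the induction go through: the new weight and
    state live on the product space.  The networks obtained so far have no useful growth
    bound, so at each stage they are clipped to +- Gam (1 + |x|_1), which does not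
    increase the error.  The weight of the theorem is the squared increment of W: by
    Young's inequality u^2 A^2 <= dt (A^p + 1 + (u^2/dt)^m) for m (p - 2) >= p, so that
    its second moment against A = 1 + |X| is bounded by p-th moments of X and Gaussian
    moments. *)

(** * ReLU networks: operations, with depth and size *)

Section Nets.
Context {R : realType}.
Local Notation net := (@relu_net R).

(** The increments of W up to t_{n+1} and the state X_{t_{n+1}} may be dependent, so the weighted
    second moment cannot be factorised; the surplus p > 2 pays for separating the two pointwise. In
    the backward step a fresh argument of f is drawn on a product space, so that E V(f(x, .)) is an
    inner integral handled by Tonelli. Independence of f(x, .) from the past enters through the
    moments of X. There the random argument X_{t_n} is rounded to a countable grid, because
    independence is known for fixed x only, and the continuity of networks removes the rounding. The
    exponents must not depend on D. In each dimension all constants go into one B, every size is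
    bounded by a power of t = B / eps >= 2, and the exponent is fixed before the dimension and the
    spaces. Networks can be added only at equal depth, so depth is tracked exactly, while size is
    merely bounded. *)

Fixpoint net_depth {a b} (phi : net a b) : nat :=
  match phi with
  | NLast _ _ _ _ => 0
  | NCons _ _ _ _ _ rest => (net_depth rest).+1
  end.

Lemma nnz_mxD m n (A B : 'M[R]_(m, n)) :
  (nnz_mx (A + B)%R <= nnz_mx A + nnz_mx B)%N.
Proof.
rewrite /nnz_mx -big_split; apply: leq_sum => i _.
rewrite -big_split; apply: leq_sum => j _; rewrite mxE.
by case: (eqVneq (A i j) 0) => [->|]; case: (eqVneq (B i j) 0) => [->|] //=;
   rewrite ?addr0 ?add0r ?eqxx //= => *; case: (_ != _).
Qed.

Lemma nnz_mxZ m n c (A : 'M[R]_(m, n)) : (nnz_mx (c *: A)%R <= nnz_mx A)%N.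
Proof.
rewrite /nnz_mx; apply: leq_sum => i _; apply: leq_sum => j _; rewrite mxE.
by rewrite mulf_eq0 negb_or; case: (c != 0).
Qed.

(** A nonzero entry (i, j) of the product forces some k with [A i k] and [B k j] both nonzero, so it
    can be charged to that pair. *)
Lemma nnz_mxM m n p (A : 'M[R]_(m, n)) (B : 'M[R]_(n, p)) :
  (nnz_mx (A *m B) <= nnz_mx A * nnz_mx B)%N.
Proof.
rewrite /nnz_mx big_distrl; apply: leq_sum => i _ /=.
apply: (@leq_trans (\sum_(j < p) \sum_k (A i k != 0%R) * (B k j != 0%R))%N).
  apply: leq_sum => j _; case: (eqVneq ((A *m B) i j) 0) => //=.
  rewrite mxE => nz.
  suff [k Ak Bk] : exists2 k, A i k != 0 & B k j != 0.
    by rewrite (bigD1 k) //= Ak Bk.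
  apply: contrapT => H; move/eqP: nz; apply; apply: big1 => k _.
  apply/eqP; rewrite mulf_eq0; apply: contrapT => /negP; rewrite negb_or => /andP[Ak Bk].
  by apply: H; exists k.
rewrite exchange_big /= big_distrl /=; apply: leq_sum => k _.
rewrite -big_distrr /= leq_mul2l; apply/orP; right.
by rewrite [leqRHS](bigD1 k) //= leq_addr.
Qed.

Lemma nnz_mx0 m n : nnz_mx (0 : 'M[R]_(m, n)) = 0%N.
Proof. by apply: big1 => i _; apply: big1 => j _; rewrite mxE eqxx. Qed.

Lemma nnz_mx_le m n (A : 'M[R]_(m, n)) : (nnz_mx A <= m * n)%N.
Proof.
rewrite -[X in (_ <= X * _)%N]card_ord -sum_nat_const; apply: leq_sum => i _.
rewrite -[X in (_ <= X)%N]card_ord -[X in (_ <= X)%N]muln1 -sum_nat_const.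
by apply: leq_sum => j _; case: (_ != _).
Qed.

Lemma nnz_col_mx m1 m2 n (A : 'M[R]_(m1, n)) (B : 'M[R]_(m2, n)) :
  nnz_mx (col_mx A B) = (nnz_mx A + nnz_mx B)%N.
Proof.
rewrite /nnz_mx big_split_ord /=; congr addn; apply: eq_bigr => i _;
  apply: eq_bigr => j _; by rewrite ?col_mxEu ?col_mxEd.
Qed.

Lemma nnz_row_mx m n1 n2 (A : 'M[R]_(m, n1)) (B : 'M[R]_(m, n2)) :
  nnz_mx (row_mx A B) = (nnz_mx A + nnz_mx B)%N.
Proof.
rewrite /nnz_mx -big_split /=; apply: eq_bigr => i _.
by rewrite big_split_ord; congr addn; apply: eq_bigr => j _;
  rewrite ?row_mxEl ?row_mxEr.
Qed.

Lemma relu_vec_col_mx m1 m2 (u : 'cV[R]_m1) (v : 'cV[R]_m2) :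
  relu_vec (col_mx u v) = col_mx (relu_vec u) (relu_vec v).
Proof.
apply/colP => i; rewrite [LHS]mxE -(splitK i); case: (fintype.split i) => j /=.
  by rewrite !col_mxEu [RHS]mxE.
by rewrite !col_mxEd [RHS]mxE.
Qed.

(** An affine map in front costs no layer: it merges with the first affine map of [psi]. The [.+1]
    covers the bias of [psi], which survives unmultiplied. *)
Lemma net_precomp b c (psi : net b c) a (A : 'M[R]_(b, a)) (v : 'cV[R]_b) :
  exists chi : net a c, [/\ net_depth chi = net_depth psi,
    (net_size chi <= net_size psi * (nnz_mx A + nnz_mx v).+1)%N &
    forall x, net_eval chi x = net_eval psi (A *m x + v)].
Proof.
have nz b' c' (A' : 'M[R]_(c', b')) (v' : 'cV[R]_c')
   (A0 : 'M[R]_(b', a)) (v0 : 'cV[R]_b') :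
   (nnz_mx (A' *m A0) + nnz_mx (A' *m v0 + v')%R <=
    (nnz_mx A' + nnz_mx v') * (nnz_mx A0 + nnz_mx v0).+1)%N.
  apply: leq_trans (leq_add (nnz_mxM _ _) (leq_trans (nnz_mxD _ _) (leq_add (nnz_mxM _ _) (leqnn _)))) _.
  by move: (nnz_mx A') (nnz_mx v') (nnz_mx A0) (nnz_mx v0) => *; nia.
case: psi A v => [b' c' A' v'|b' c' e A' v' rest] A v.
- exists (NLast (A' *m A) (A' *m v + v')); split => //=.
  by move=> x; rewrite mulmxDr mulmxA addrA.
- exists (NCons (A' *m A) (A' *m v + v') rest); split => //=.
    by have := nz _ _ A' v' A v; nia.
  by move=> x; rewrite mulmxDr mulmxA addrA.
Qed.

Lemma net_comp a b (phi : net a b) c (psi : net b c) :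
  exists chi : net a c, [/\ net_depth chi = (net_depth psi + net_depth phi)%N,
    (net_size chi <= net_size psi * (net_size phi).+1 + net_size phi)%N &
    forall x, net_eval chi x = net_eval psi (net_eval phi x)].
Proof.
elim: phi psi => {a b} [a b A v|a b b' A v rest IH] psi.
- have [chi [dc sc ec]] := net_precomp psi A v.
  exists chi; split => //=; first by rewrite dc addn0.
  exact: leq_trans sc (leq_addr _ _).
- have [chi [dc sc ec]] := IH psi.
  exists (NCons A v chi); split => /=; first by rewrite dc addnS.
    nia.
  by move=> x; rewrite ec.
Qed.

(** Hidden layers run side by side as block-diagonal matrices, and the last layers are joined in a
    row, which adds the outputs. Equal depth aligns the two stacks. *)
Lemma net_par a c (phi : net a c) b (psi : net b c) :
  net_depth phi = net_depth psi ->
  exists chi : net (a + b) c, [/\ net_depth chi = net_depth phi,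
    (net_size chi <= net_size phi + net_size psi)%N &
    forall x y, net_eval chi (col_mx x y) = net_eval phi x + net_eval psi y].
Proof.
elim: phi b psi => {a c} [a c A v|a a' c A v rest IH] b psi.
- move: A v; case: psi => [b' c' A' v'|//] A v _.
  exists (NLast (row_mx A A') (v + v')); split => //=.
    by rewrite nnz_row_mx; have := nnz_mxD v v'; lia.
  by move=> x y; rewrite mul_row_col addrACA.
- move: rest IH; case: psi => [//|b' b'' c' A' v' rest'] rest IH /= [dE].
  have [chi [dc sc ec]] := IH _ rest' dE.
  exists (NCons (block_mx A 0 0 A') (col_mx v v') chi); split => /=.
  + by rewrite dc.
  + rewrite block_mxEv !nnz_col_mx !nnz_row_mx !nnz_mx0; lia.
  + move=> x y; rewrite mul_block_col !mul0mx addr0 add0r add_col_mx.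
    rewrite -ec relu_vec_col_mx; reflexivity.
Qed.

Lemma net_add a c (phi psi : net a c) :
  net_depth phi = net_depth psi ->
  exists chi : net a c, [/\ net_depth chi = net_depth phi,
    (net_size chi <= net_size phi + net_size psi)%N &
    forall x, net_eval chi x = net_eval phi x + net_eval psi x].
Proof.
case: phi psi => {a c} [a c A v|a a' c A v rest] psi.
- move: A v; case: psi => [b' c' A' v'|//] A v _.
  exists (NLast (A + A') (v + v')); split => //=.
    by have := nnz_mxD v v'; have := nnz_mxD A A'; lia.
  by move=> x; rewrite mulmxDl addrACA.
- move: A rest; case: psi => [//|b' b'' c' A' v' rest'] A rest /= [dE].
  have [chi [dc sc ec]] := net_par dE.
  exists (NCons (col_mx A A') (col_mx v v') chi); split => /=.
  + by rewrite dc.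
  + by rewrite !nnz_col_mx; lia.
  + move=> x; rewrite mul_col_mx add_col_mx -ec relu_vec_col_mx; reflexivity.
Qed.

Lemma net_scale (k : R) a c (phi : net a c) :
  exists chi : net a c, [/\ net_depth chi = net_depth phi,
    (net_size chi <= net_size phi)%N &
    forall x, net_eval chi x = k *: net_eval phi x].
Proof.
elim: phi => {a c} [a c A v|a a' c A v rest [chi [dc sc ec]]].
- exists (NLast (k *: A) (k *: v)); split => //=; first exact: leq_add (nnz_mxZ _ _) (nnz_mxZ _ _).
  by move=> x; rewrite scalerDr scalemxAl.
- exists (NCons A v chi); split => /=; first by rewrite dc.
    by rewrite leq_add2l.
  by move=> x; rewrite ec.
Qed.

(** Depth is exact, because sums need equal depth, whereas size is only an upper bound; stating it
    for the function hides the concrete weights. *)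
Definition net_rep D (L K : nat) (h : 'cV[R]_D -> R) :=
  exists phi : net D 1, [/\ net_depth phi = L, (net_size phi <= K)%N &
    forall x, net_fun phi x = h x].

Lemma net_rep_le D L K K' (h : 'cV[R]_D -> R) :
  (K <= K')%N -> net_rep L K h -> net_rep L K' h.
Proof.
by move=> le [phi [d s e]]; exists phi; split => //; exact: leq_trans le.
Qed.

Lemma net_rep_ext D L K (h h' : 'cV[R]_D -> R) :
  (forall x, h x = h' x) -> net_rep L K h -> net_rep L K h'.
Proof. by move=> eh [phi [d s e]]; exists phi; split => // x; rewrite e. Qed.

Lemma net_repD D L K1 K2 (h1 h2 : 'cV[R]_D -> R) :
  net_rep L K1 h1 -> net_rep L K2 h2 ->
  net_rep L (K1 + K2) (fun x => h1 x + h2 x).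
Proof.
move=> [phi1 [d1 s1 e1]] [phi2 [d2 s2 e2]].
have [chi [d s e]] := net_add (etrans d1 (esym d2)).
exists chi; split; first by rewrite d.
  exact: leq_trans s (leq_add s1 s2).
by move=> x; rewrite /net_fun e mxE -e1 -e2.
Qed.

Lemma net_repZ D L K k (h : 'cV[R]_D -> R) :
  net_rep L K h -> net_rep L K (fun x => k * h x).
Proof.
move=> [phi [d s e]]; have [chi [d' s' e']] := net_scale k phi.
exists chi; split; first by rewrite d'.
  exact: leq_trans s' s.
by move=> x; rewrite /net_fun e' mxE -e.
Qed.

Lemma net_rep0 D L : net_rep L 0 (fun _ : 'cV[R]_D => 0).
Proof.
suff [phi [d s e]] : exists phi : net D 1, [/\ net_depth phi = L,
   (net_size phi <= 0)%N & forall x, net_eval phi x = 0].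
  by exists phi; split => // x; rewrite /net_fun e mxE.
elim: L D => [|L IH] D.
  exists (NLast 0 0); split; rewrite //= ?nnz_mx0 //.
  by move=> x; rewrite mul0mx addr0.
have [phi [d s e]] := IH 1%N.
exists (NCons 0 0 phi); split; rewrite //= ?nnz_mx0 //; by rewrite d.
Qed.

Lemma net_rep_sum D L (M : nat) (K : 'I_M -> nat) (h : 'I_M -> 'cV[R]_D -> R) :
  (forall j, net_rep L (K j) (h j)) ->
  net_rep L (\sum_j K j) (fun x => \sum_j h j x).
Proof.
elim: M K h => [|M IH] K h H.
  rewrite big_ord0; apply: net_rep_ext (net_rep0 _ _) => x; by rewrite big_ord0.
rewrite big_ord_recl; apply: net_rep_ext (net_repD (H ord0) (IH _ _ (fun j => H (lift ord0 j)))).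
by move=> x; rewrite big_ord_recl.
Qed.

Lemma net_rep_comp D L K (h : 'cV[R]_D -> R) (psi : net 1 1) :
  net_rep L K h ->
  net_rep (net_depth psi + L) (net_size psi * K.+1 + K)
    (fun x => net_eval psi (const_mx (h x)) 0 0).
Proof.
move=> [phi [d s e]]; have [chi [d' s' e']] := net_comp phi psi.
exists chi; split; first by rewrite d' d.
  by apply: leq_trans s' _; nia.
move=> x; rewrite /net_fun e'; congr (net_eval psi _ _ _).
by apply/matrixP => i j; rewrite !ord1 mxE -e.
Qed.

Lemma net_rep_compv D a L K (h : 'cV[R]_a -> R) (phi : net D a) :
  net_rep L K h ->
  net_rep (L + net_depth phi) (K * (net_size phi).+1 + net_size phi)
    (fun x => h (net_eval phi x)).
Proof.
move=> [psi [d s e]]; have [chi [d' s' e']] := net_comp phi psi.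
exists chi; split; first by rewrite d' d.
  by apply: leq_trans s' _; nia.
by move=> x; rewrite /net_fun e' -e.
Qed.

(** ReLU does not pass a signed number, so y is carried as the pair of its positive and negative
    parts, which further ReLU layers fix; the last layer subtracts. *)
Lemma net_id j : exists psi : net 1 1, [/\ net_depth psi = j,
   (net_size psi <= 2 * j + 2)%N & forall y, net_eval psi (const_mx y) 0 0 = y].
Proof.
case: j => [|j].
  exists (NLast 1%:M 0); split => //=.
    by rewrite nnz_mx0; have := nnz_mx_le (1%:M : 'M[R]_1); lia.
  by move=> y; rewrite mul1mx addr0 mxE.
suff [psi [d s e]] : exists psi : net (1 + 1) 1, [/\ net_depth psi = j,
   (net_size psi <= 2 * j + 2)%N &
    forall u v, 0 <= u -> 0 <= v ->
     net_eval psi (col_mx (const_mx u) (const_mx v)) 0 0 = u - v].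
  exists (NCons (col_mx 1%:M (- 1%:M)) 0 psi); split => /=; first by rewrite d.
    rewrite nnz_mx0.
    by apply: leq_trans (leq_add (leq_add (nnz_mx_le _) (leqnn 0)) s) _; lia.
  move=> y; have -> : relu_vec (col_mx 1%:M (- 1%:M) *m const_mx y + 0) =
     col_mx (const_mx (Num.max y 0)) (const_mx (Num.max (- y) 0)) :> 'cV[R]_(1 + 1).
    rewrite addr0 mul_col_mx mulNmx mul1mx relu_vec_col_mx.
    by congr col_mx; apply/colP => i; rewrite !mxE.
  rewrite e ?le_max ?lexx ?orbT //.
  by rewrite !maxEle; case: ifPn => ?; case: ifPn => ?; lra.
elim: j => [|j [psi [d s e]]].
  exists (NLast (row_mx 1%:M (- 1%:M)) 0); split => //=.
    by rewrite nnz_mx0 addn0; apply: leq_trans (nnz_mx_le _) _.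
  by move=> u v _ _; rewrite addr0 mul_row_col mulNmx !mul1mx !mxE.
exists (NCons 1%:M 0 psi); split => /=; first by rewrite d.
  rewrite nnz_mx0.
  suff : (nnz_mx (1%:M : 'M[R]_(1 + 1)) <= 2)%N by lia.
  rewrite /nnz_mx !big_ord_recl !big_ord0 !mxE /= ?eqxx ?oner_eq0.
  by vm_compute.
move=> u v u0 v0; rewrite mul1mx addr0 -[in RHS](e u v) //.
congr (net_eval psi _ _ _); rewrite relu_vec_col_mx.
by congr col_mx; apply/colP => i; rewrite !mxE; apply/max_idPl.
Qed.

Lemma net_rep_pad D L K j (h : 'cV[R]_D -> R) :
  net_rep L K h -> net_rep (j + L) ((2 * j + 3) * K.+1) h.
Proof.
move=> H; have [psi [d s e]] := net_id j.
have := net_rep_comp psi H; rewrite d => H'.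
apply: (@net_rep_le _ _ _ _ _ _ (net_rep_ext _ H')); last by move=> x; rewrite e.
nia.
Qed.

Lemma net_rep_relu D L K (h : 'cV[R]_D -> R) :
  net_rep L K h -> net_rep L.+1 (5 * K.+1) (fun x => Num.max (h x) 0).
Proof.
move=> H.
have H' := net_rep_comp (NCons 1%:M 0 (NLast 1%:M 0)) H.
apply: (@net_rep_le _ _ _ _ _ _ (net_rep_ext _ H')).
  rewrite /= !nnz_mx0; have := nnz_mx_le (1%:M : 'M[R]_1); nia.
by move=> x /=; rewrite !mul1mx !addr0 !mxE.
Qed.

(** Uses max(a, b) = max(a - b, 0) + b; the summand b is padded by one identity layer to match
    depths. *)
Lemma net_rep_max D L K1 K2 (h1 h2 : 'cV[R]_D -> R) :
  net_rep L K1 h1 -> net_rep L K2 h2 ->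
  net_rep L.+1 (10 * (K1 + K2).+1) (fun x => Num.max (h1 x) (h2 x)).
Proof.
move=> H1 H2.
have H := net_repD (net_rep_relu (net_repD H1 (net_repZ (- 1) H2)))
  (net_rep_pad 1 H2).
apply: (@net_rep_le _ _ _ _ _ _ (net_rep_ext _ H)); first by lia.
by move=> x; rewrite !maxEle mulN1r subr_le0; case: ifPn => ?; rewrite ?add0r ?subrK.
Qed.

Lemma net_rep_min D L K1 K2 (h1 h2 : 'cV[R]_D -> R) :
  net_rep L K1 h1 -> net_rep L K2 h2 ->
  net_rep L.+1 (10 * (K1 + K2).+1) (fun x => Num.min (h1 x) (h2 x)).
Proof.
move=> /(net_repZ (-1)) H1 /(net_repZ (-1)) H2.
apply: net_rep_ext (net_repZ (-1) (net_rep_max H1 H2)) => x.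
by rewrite !mulN1r oppr_max !opprK.
Qed.

Lemma net_rep_cst D (c : R) : net_rep 0 1 (fun _ : 'cV[R]_D => c).
Proof.
exists (NLast 0 (const_mx c)); split => //=.
  by rewrite nnz_mx0; exact: (nnz_mx_le (const_mx c : 'cV[R]_1)).
by move=> x; rewrite /net_fun /= mul0mx add0r mxE.
Qed.

Lemma net_rep_coord D (i : 'I_D) : net_rep 0 D (fun x : 'cV[R]_D => x i 0).
Proof.
exists (NLast (delta_mx 0 i) 0); split => //=.
  by rewrite nnz_mx0 addn0 -[X in (_ <= X)%N]mul1n; exact: nnz_mx_le.
by move=> x; rewrite /net_fun /= addr0 -rowE mxE.
Qed.

(** The l1 norm stands in for the Euclidean one because a ReLU network computes it exactly, through
    |u| = max(u, -u). *)
Lemma net_rep_norm1 D (c : R) :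
  net_rep 1 (60 * D.+1 ^ 3)
    (fun x : 'cV[R]_D => c * (1 + \sum_i `|x i 0|)).
Proof.
have Hi (i : 'I_D) : net_rep 1 (10 * (D + D).+1) (fun x : 'cV[R]_D => `|x i 0|).
  apply: net_rep_ext (net_rep_max (net_rep_coord i) (net_repZ (-1) (net_rep_coord i))).
  by move=> x; rewrite mulN1r maxEle; case: ger0P => ?; case: ifPn => ?; lra.
have H := net_repZ c (net_repD (net_rep_pad 1 (net_rep_cst D 1)) (net_rep_sum Hi)).
apply: net_rep_le H; rewrite sum_nat_const card_ord /=.
rewrite !expnS expn0; nia.
Qed.

(** [h'] is the projection of [h] onto [-u, u] with u = Gam (1 + |x|_1); projecting onto an interval
    does not increase the distance to its points. The input depth [L.+1] leaves room to pad the
    depth-1 network of u. *)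
Lemma net_rep_clip D L K (Gam : R) (h : 'cV[R]_D -> R) : 0 <= Gam ->
  net_rep L.+1 K h ->
  exists h' : 'cV[R]_D -> R, [/\ net_rep L.+3 (100 * (100 * (3 * (K + L.+1 * D.+1 ^ 3).+1))) h',
    forall x : 'cV[R]_D, `|h' x| <= Gam * (1 + \sum_i `|x i 0|) &
    forall (x : 'cV[R]_D) (y : R), `|y| <= Gam * (1 + \sum_i `|x i 0|) -> `|y - h' x| <= `|y - h x|].
Proof.
move=> G0 H; have N1 := net_rep_norm1 D Gam.
have P1 := net_rep_pad L N1; rewrite addn1 in P1.
have P2 := net_rep_pad L.+1 (net_repZ (-1) N1); rewrite addn1 in P2.
have := net_rep_max P2 (net_rep_min P1 H).
set h' := fun x => _; move=> H'; exists h'; split.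
- apply: net_rep_le H'.
  move: (D.+1 ^ 3)%N (expn_gt0 D.+1 3) => e /= e0.
  have := leq_pmulr L e0; nia.
- move=> x; rewrite /h'.
  have : 0 <= Gam * (1 + \sum_i `|x i 0|).
    by rewrite mulr_ge0 // addr_ge0 // sumr_ge0.
  move: (Gam * _) (h x) => u v u0.
  by rewrite mulN1r ler_norml !maxEle !minEle; case: (lerP u v) => ?;
    case: ifPn => ?; lra.
- move=> x y; rewrite /h'; move: (Gam * _) (h x) => u v.
  rewrite mulN1r !ler_norml => /andP[yu uy].
  rewrite !maxEle !minEle; case: (lerP u v) => uv; case: ifPn => ?;
    case: (ler0P (y - v)) => ?; lra.
Qed.

(** (C5) bounds size only, while padding costs grow with depth. A hidden layer with zero matrix
    makes the network constant; without such a layer each one contributes a nonzero weight, so depth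
    is at most size. *)
Lemma net_depth_reduce a (phi : net a 1) :
  exists psi : net a 1, [/\ (net_depth psi <= net_size phi)%N,
    (net_size psi <= net_size phi)%N &
    forall x, net_fun psi x = net_fun phi x].
Proof.
(* The factor c allows for a constant output with all c entries nonzero; in the application c = 1.
   Size 0 needs separate care, since the constant must then be 0. *)
have key b c (chi : net b c) : (net_depth chi <= net_size chi)%N \/
   exists v, (forall x, net_eval chi x = v) /\ (nnz_mx v <= c * net_size chi)%N.
  elim: chi => {b c} [b c A v|b b' c A v rest]; first by left.
  have [A0|A0] := posnP (nnz_mx A).
    move=> _; right; exists (net_eval rest (relu_vec v)); split.
      move=> x /=; suff -> : A = 0 by rewrite mul0mx add0r.
      apply/matrixP => i j; rewrite mxE; move/eqP: A0.
      rewrite /nnz_mx sum_nat_eq0 => /forallP/(_ i)/implyP/(_ isT).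
      rewrite sum_nat_eq0 => /forallP/(_ j)/implyP/(_ isT).
      by rewrite eqb0 negbK => /eqP.
    have [s0|s0] := posnP (net_size (NCons A v rest)); last first.
      by apply: leq_trans (nnz_mx_le _) _; rewrite leq_mul2l s0 orbT.
    have ev0 e f (xi : net e f) : net_size xi = 0%N -> net_eval xi 0 = 0.
      have z0 m n (M : 'M[R]_(m, n)) : nnz_mx M = 0%N -> M = 0.
        move=> M0; apply/matrixP => i j; rewrite mxE; move/eqP: M0.
        rewrite /nnz_mx sum_nat_eq0 => /forallP/(_ i)/implyP/(_ isT).
        rewrite sum_nat_eq0 => /forallP/(_ j)/implyP/(_ isT).
        by rewrite eqb0 negbK => /eqP.
      elim: xi => {e f} [e f M u|e f f' M u r IH] /=.
        by move=> ?; rewrite mulmx0 add0r; apply: z0; lia.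
      move=> ?; rewrite mulmx0 add0r (z0 _ _ u); last by lia.
      rewrite -[RHS]IH; last by lia.
      by congr net_eval; apply/colP => i; rewrite !mxE maxxx.
    have v0 : relu_vec v = 0.
      have : nnz_mx v = 0%N by move: s0 => /=; lia.
      move=> /eqP; rewrite /nnz_mx sum_nat_eq0 => /forallP H.
      apply/colP => i; rewrite !mxE; move: (H i) => /implyP/(_ isT).
      rewrite sum_nat_eq0 => /forallP/(_ 0)/implyP/(_ isT).
      by rewrite eqb0 negbK => /eqP ->; rewrite maxxx.
    by rewrite v0 ev0 ?nnz_mx0 //; move: s0 => /=; lia.
  move=> [dr|[u [eu nu]]]; [left|right] => /=; first by lia.
  by exists u; split => //=; nia.
case: (key _ _ phi) => [dp|[v [ev nv]]]; first by exists phi.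
exists (NLast 0 v); split => //=; first by rewrite nnz_mx0 add0n; lia.
by move=> x; rewrite /net_fun /= mul0mx add0r ev.
Qed.

End Nets.

(** * Monotonicity of integrals *)

Section IntegralMonotone.
Context d (T : measurableType d) (R : realType) (mu : {measure set T -> \bar R}).
Import HBNNSimple.

(* For nonnegative functions the integral is a supremum over simple functions
   below the integrand, so monotonicity needs no measurability. *)
Lemma ge0_le_integral_nomeas (f g : T -> \bar R) :
  (forall x, 0 <= f x)%E -> (forall x, f x <= g x)%E ->
  (\int[mu]_x f x <= \int[mu]_x g x)%E.
Proof.
move=> f0 fg.
have g0 x : (0 <= g x)%E := le_trans (f0 x) (fg x).
rewrite ge0_integralE; last by move=> x _.
rewrite ge0_integralE; last by move=> x _.
rewrite !patch_setT.
apply: ereal_sup_le => _ [h hf <-].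
by exists h => // x; exact: le_trans (hf x) (fg x).
Qed.

End IntegralMonotone.

(** * Measurability of vector-valued maps and of networks *)

Section VectorMeasurability.
Context {R : realType}.

Definition vec_measurable d (T : measurableType d) D (Y : T -> 'cV[R]_D) :=
  forall B, @BorelD R D B -> measurable (Y @^-1` B).

Lemma vec_measurable_coord d (T : measurableType d) D (Y : T -> 'cV[R]_D) i :
  vec_measurable Y -> measurable_fun setT (fun w => Y w i 0).
Proof.
move=> mY; apply: (measurability _ (RGenOpens.measurableE R)) => _ [_ [a [b ->] <-]].
rewrite setTI.
rewrite (_ : _ @^-1` _ = Y @^-1` ((fun M : 'cV[R]_D => M i 0) @^-1` `]a, b[%classic)) //.
apply: mY; apply: sub_sigma_algebra.
move/continuousP: (@coord_continuous R D 1 i 0); apply; exact: interval_open.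
Qed.

Lemma measurable_enorm d (T : measurableType d) D (Y : T -> 'cV[R]_D) :
  (forall i, measurable_fun setT (fun w => Y w i 0)) ->
  measurable_fun setT (fun w => enorm (Y w)).
Proof.
move=> mY.
have ms : measurable_fun setT (@Num.sqrt R).
  by apply: continuous_measurable_fun; exact: sqrt_continuous.
apply: (@measurableT_comp _ _ _ _ _ _ (@Num.sqrt R)) => //.
by apply: measurable_sum => i; exact: measurable_funX.
Qed.

(** Makes R^D with its Borel sets a measurable type, so that a claim that some set of vectors is
    Borel can be proved as measurability of maps on it. *)
Definition borelT D := g_sigma_algebraType [set A : set 'cV[R]_D | open A].

Lemma vec_measurable_borelT D : vec_measurable (fun x : borelT D => x : 'cV[R]_D).
Proof. by move=> B; rewrite preimage_id. Qed.

Lemma BorelD_enorm D (B : set R) : measurable B ->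
  @BorelD R D ((fun x : 'cV[R]_D => enorm x) @^-1` B).
Proof.
move=> mB; have m : measurable_fun setT (fun x : borelT D => enorm (x : 'cV[R]_D)).
  by apply: measurable_enorm => i; apply: vec_measurable_coord; exact: vec_measurable_borelT.
by have := m measurableT B mB; rewrite setTI.
Qed.

Lemma BorelD_coords D (B : 'I_D -> set R) : (forall i, measurable (B i)) ->
  @BorelD R D [set x : 'cV[R]_D | forall i, B i (x i 0)].
Proof.
move=> mB.
suff : measurable [set x : borelT D | forall i, B i ((x : 'cV[R]_D) i 0)] by [].
rewrite (_ : [set x | _] = \big[setI/setT]_(i < D) [set x : borelT D | B i ((x : 'cV[R]_D) i 0)]).
  apply: bigsetI_measurable => i _.
  have := @vec_measurable_coord _ _ _ _ i (@vec_measurable_borelT D) measurableT _ (mB i).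
  by rewrite setTI.
rewrite -bigcap_seq; apply/seteqP; split=> x /=.
  by move=> H i _; exact: H.
by move=> H i; apply: H => /=; rewrite mem_index_enum.
Qed.

(** Good-sets argument: the sets with measurable preimage under w -> (Y w.1, w.2) form a
    sigma-algebra, and it contains the rectangles that generate the one of (C3). *)
Lemma vec_measurable_joint d1 (T1 : measurableType d1) d2 (T2 : measurableType d2)
    a b (G : set (set T2)) (h : 'cV[R]_a -> T2 -> 'cV[R]_b) (Y : T1 -> 'cV[R]_a) :
  G `<=` measurable ->
  (forall B, @BorelD R b B -> <<s [set A `*` E | A in @BorelD R a & E in G] >>
     ((fun xw : 'cV[R]_a * T2 => h xw.1 xw.2) @^-1` B)) ->
  vec_measurable Y ->
  vec_measurable (fun w : T1 * T2 => h (Y w.1) w.2).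
Proof.
move=> Gm mh mY B /mh.
pose phi (w : T1 * T2) := (Y w.1, w.2).
suff : <<s [set A `*` E | A in @BorelD R a & E in G] >> `<=`
  [set U | measurable (phi @^-1` U)] by move/[apply].
apply: smallest_sub.
  split => /=.
  - by rewrite preimage_set0.
  - by move=> A mA; rewrite setTD preimage_setC; exact: measurableC.
  - by move=> A mA; rewrite preimage_bigcup; exact: bigcupT_measurable.
move=> _ [A bA [E gE <-]] /=.
rewrite (_ : phi @^-1` _ = (Y @^-1` A) `*` E); last by apply/seteqP; split.
by apply: measurableX; [exact: mY|exact: Gm].
Qed.

Lemma vec_measurable_pair2 d1 (T1 : measurableType d1) d2 (T2 : measurableType d2)
    b (h : T1 * T2 -> 'cV[R]_b) (x : T1) :
  vec_measurable h -> vec_measurable (fun y => h (x, y)).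
Proof.
move=> mh B /mh mB.
have := measurable_xsection x mB; congr measurable; apply/seteqP; split => y /=;
by rewrite /xsection /= in_setE.
Qed.

Lemma vec_measurable_cst d1 (T1 : measurableType d1) D (x : 'cV[R]_D) :
  vec_measurable (fun _ : T1 => x).
Proof.
move=> B _; have [xB|xB] := pselect (B x).
  by rewrite (_ : _ @^-1` _ = setT) //; apply/seteqP; split.
by rewrite (_ : _ @^-1` _ = set0) //; apply/seteqP; split.
Qed.

Lemma net_eval_measurable d (T : measurableType d) a b (phi : @relu_net R a b)
    (Y : T -> 'cV[R]_a) :
  (forall i, measurable_fun setT (fun w => Y w i 0)) ->
  forall i, measurable_fun setT (fun w => net_eval phi (Y w) i 0).
Proof.
have aff m n (A : 'M[R]_(m, n)) v (Z : T -> 'cV[R]_n) :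
    (forall i, measurable_fun setT (fun w => Z w i 0)) ->
    forall i, measurable_fun setT (fun w => (A *m Z w + v) i 0).
  move=> mZ i; rewrite (_ : (fun w => _) = (fun w => \sum_j A i j * Z w j 0 + v i 0)).
    apply: measurable_funD => //; apply: measurable_sum => j.
    exact: measurable_funM.
  by apply/funext => w; rewrite !mxE.
elim: phi Y => {a b} [a b A v|a c b A v rest IH] Y mY i /=; first exact: aff.
apply: IH => j; rewrite (_ : (fun w => _) =
  (fun w => (A *m Y w + v) j 0) \max cst 0).
  by apply: measurable_maxr => //; exact: aff.
by apply/funext => w; rewrite [LHS]mxE.
Qed.

Lemma net_eval_cvg a b (phi : @relu_net R a b) (y : nat -> 'cV[R]_a) (x : 'cV[R]_a) :
  (forall i, (fun n => y n i 0) @ \oo --> x i 0) ->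
  forall i, (fun n => net_eval phi (y n) i 0) @ \oo --> net_eval phi x i 0.
Proof.
have aff m n (A : 'M[R]_(m, n)) v (z : nat -> 'cV[R]_n) (u : 'cV[R]_n) :
    (forall i, (fun k => z k i 0) @ \oo --> u i 0) ->
    forall i, (fun k => (A *m z k + v) i 0) @ \oo --> (A *m u + v) i 0.
  move=> zu i; rewrite (_ : (fun w => _) = (fun k => \sum_j A i j * z k j 0 + v i 0)).
    rewrite !mxE; apply: cvgD; last exact: cvg_cst.
    apply: (cvg_big (@add_continuous _)) => j _.
    by apply: cvgM; [exact: cvg_cst|exact: zu].
  by apply/funext => w; rewrite !mxE.
elim: phi y x => {a b} [a b A v|a c b A v rest IH] y x yx i /=; first exact: aff.
apply: IH => j; rewrite (_ : (fun w => _) =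
  (fun w => Num.max ((A *m y w + v) j 0) 0)); last by apply/funext => w; rewrite [LHS]mxE.
rewrite [X in _ --> X]mxE.
rewrite maxr_absE; under eq_fun do rewrite maxr_absE.
have H := aff _ _ A v y x yx j.
apply: cvgM; last exact: cvg_cst.
by apply: cvgD; [apply: cvgD => //; exact: cvg_cst|apply: cvg_norm; apply: cvgB => //; exact: cvg_cst].
Qed.

End VectorMeasurability.

(** * Second moments under a probability *)

Section SquareIntegrable.
Context d (T : measurableType d) (R : realType) (P : probability T R).
Implicit Types h : T -> R.

(** Otherwise A > b almost everywhere, and integrating gives b <= a. This is how a good sample is
    picked from a bound on the mean. *)
Lemma prob_exists_le (A : T -> \bar R) (a b : R) (Q : T -> Prop) :
  measurable_fun setT A -> (forall w, 0 <= A w)%E ->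
  (\int[P]_w A w <= a%:E)%E -> a < b -> {ae P, forall w, Q w} ->
  exists w, Q w /\ (A w <= b%:E)%E.
Proof.
move=> mA A0 Aa ab aQ; apply: contrapT => H.
have a0 : 0 <= a by rewrite -lee_fin; apply: le_trans Aa; exact: integral_ge0.
have : (b%:E <= a%:E)%E; last by rewrite lee_fin leNgt ab.
apply: le_trans Aa.
rewrite (_ : b%:E = \int[P]_(w in setT) (cst b%:E w))%E; last first.
  by rewrite integral_cst // [X in (_ * X)%E]probability_setT mule1.
apply: ae_ge0_le_integral => //.
- by move=> w _; rewrite lee_fin ltW // (le_lt_trans a0).
apply: filterS aQ => w Qw _ /=; rewrite leNgt; apply/negP => lt.
by apply: H; exists w; split => //; exact: ltW.
Qed.

Lemma sq_integrable h : measurable_fun setT h ->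
  (\int[P]_w ((h w) ^+ 2)%:E < +oo)%E ->
  P.-integrable setT (EFin \o h) /\ P.-integrable setT (EFin \o (fun w => h w ^+ 2)).
Proof.
move=> mh h2.
have i2 : P.-integrable setT (EFin \o (fun w => h w ^+ 2)).
  apply/integrableP; split; first by apply/measurable_EFinP; exact: measurable_funX.
  by under eq_integral => w _ do rewrite /= ger0_norm ?sqr_ge0 //.
split => //.
apply: (@le_integrable _ _ _ P setT measurableT _ (fun w => (1 + h w ^+ 2)%:E)).
- exact/measurable_EFinP.
- move=> w _ /=; rewrite lee_fin [leRHS]ger0_norm ?addr_ge0 ?sqr_ge0 //.
  by have := sqr_ge0 (`|h w| - 1); rewrite -(normr_id (h w)) -(real_normK (num_real (h w))) normr_id; nra.
- have i1 : P.-integrable setT (cst 1%:E) by exact: finite_measure_integrable_cst.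
  exact: (integrableD measurableT i1 i2).
Qed.

Lemma integral_sq_shift h (c : R) : measurable_fun setT h ->
  (\int[P]_w ((h w) ^+ 2)%:E < +oo)%E ->
  (\int[P]_w ((c - h w) ^+ 2)%:E + (2 * c * Rintegral P setT h)%:E =
   (c ^+ 2)%:E + \int[P]_w ((h w) ^+ 2)%:E)%E.
Proof.
move=> mh h2; have [i1 i2] := sq_integrable mh h2.
have f1 := integrable_fin_num measurableT i1.
have -> : (\int[P]_w ((c - h w) ^+ 2)%:E =
    \int[P]_w ((c ^+ 2)%:E - (2 * c)%:E * (h w)%:E + ((h w) ^+ 2)%:E))%E.
  by apply: eq_integral => w _; rewrite -EFinM -EFinB -EFinD; congr EFin; ring.
have ic : P.-integrable setT (cst (c ^+ 2)%:E) by exact: finite_measure_integrable_cst.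
have iz : P.-integrable setT (fun w => (2 * c)%:E * (h w)%:E)%E by exact: integrableZl.
have -> : (\int[P]_w ((c ^+ 2)%:E - (2 * c)%:E * (h w)%:E + ((h w) ^+ 2)%:E) =
    \int[P]_w ((c ^+ 2)%:E - (2 * c)%:E * (h w)%:E) + \int[P]_w ((h w) ^+ 2)%:E)%E.
  exact: (integralD measurableT (integrableB measurableT ic iz) i2).
have -> : (\int[P]_w ((c ^+ 2)%:E - (2 * c)%:E * (h w)%:E) =
    (c ^+ 2)%:E - (2 * c)%:E * \int[P]_w (h w)%:E)%E.
  rewrite -(integralZl measurableT i1).
  rewrite (integralB measurableT ic iz) integral_cst //.
  by rewrite [X in (_ * X)%E]probability_setT mule1.
rewrite /Rintegral (EFinM (2 * c)) fineK //.
have f2 := integrable_fin_num measurableT i2.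
rewrite -(fineK f1) -(fineK f2) -!EFinM -!EFinB -!EFinD; congr EFin; ring.
Qed.

(** Jensen, read off from the shift identity with c equal to the mean; an infinite right side is
    trivial. *)
Lemma Rintegral_sq_le h : measurable_fun setT h ->
  ((Rintegral P setT h ^+ 2)%:E <= \int[P]_w ((h w) ^+ 2)%:E)%E.
Proof.
move=> mh; have [h2|] := ltP (\int[P]_w ((h w) ^+ 2)%:E)%E +oo%E; last first.
  by rewrite leye_eq => /eqP ->; rewrite leey.
have := integral_sq_shift (Rintegral P setT h) mh h2.
set m := Rintegral P setT h; set I1 := integral _ _ _; set I2 := integral _ _ _ => E.
have I10 : (0 <= I1)%E by apply: integral_ge0 => w _; rewrite lee_fin sqr_ge0.
have : (m ^+ 2)%:E + (m ^+ 2)%:E = (2 * m * m)%:E by rewrite -EFinD; congr EFin; ring.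
move=> E2; rewrite -(@leeD2lE _ (m ^+ 2)%:E) // E2 -E leeDr //.
Qed.

(** The mean minus h is centred, so the cross term with [s] vanishes and the left side is s^2 plus
    the variance of h. This is the additivity of variances behind Monte Carlo, one sample at a
    time. *)
Lemma integral_sq_recenter h (s : R) : measurable_fun setT h ->
  (\int[P]_w ((h w) ^+ 2)%:E < +oo)%E ->
  (\int[P]_w ((s + (Rintegral P setT h - h w)) ^+ 2)%:E <=
   (s ^+ 2)%:E + \int[P]_w ((h w) ^+ 2)%:E)%E.
Proof.
move=> mh h2; set m := Rintegral P setT h.
under eq_integral => w _ do rewrite addrA.
have := integral_sq_shift (s + m) mh h2; rewrite -/m.
set I1 := integral _ _ _; set I2 := integral _ _ _ => E.
rewrite -(@leeD2rE _ (2 * (s + m) * m)%:E) // E addeAC leeD2r // -EFinD lee_fin.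
by have := sqr_ge0 m; nra.
Qed.

End SquareIntegrable.

(** * Derandomised Monte Carlo *)

Section GreedySampling.
Context d1 (T1 : measurableType d1) d2 (T2 : measurableType d2) (R : realType).
Variables (mu : {sigma_finite_measure set T1 -> \bar R}) (P : probability T2 R).

(** Positive and negative parts are measurable by Tonelli; applying [fine] to their difference also
    covers the default values taken at infinite integrals. *)
Lemma measurable_Rintegral_fst (h : T1 * T2 -> R) : measurable_fun setT h ->
  measurable_fun setT (fun x => Rintegral P setT (fun w => h (x, w))).
Proof.
move=> mh.
have mp : measurable_fun setT (fun x : T1 * T2 => ((EFin \o h)^\+)%E x).
  by apply: measurable_funepos; exact/measurable_EFinP.
have mn : measurable_fun setT (fun x : T1 * T2 => ((EFin \o h)^\-)%E x).
  by apply: measurable_funeneg; exact/measurable_EFinP.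
rewrite (_ : (fun x => _) = (fun x => fine
   (fubini_F P ((EFin \o h)^\+)%E x - fubini_F P ((EFin \o h)^\-)%E x)%E)); last first.
  apply/funext => x; rewrite /Rintegral integralE /fubini_F.
  congr (fine (_ - _)%E); apply: eq_integral => w _.
    by rewrite funeposE [RHS]funeposE.
  by rewrite funenegE [RHS]funenegE.
apply: (measurableT_comp (fine_measurable measurableT)).
by apply: emeasurable_funB; exact: measurable_fun_fubini_tonelli_F.
Qed.

Variables (S : T1 -> R) (h : T1 * T2 -> R).
Hypotheses (mS : measurable_fun setT S) (S0 : forall x, 0 <= S x).
Hypothesis mh : measurable_fun setT h.
Hypothesis h2 : forall x, (\int[P]_w ((h (x, w)) ^+ 2)%:E < +oo)%E.
Let m x := Rintegral P setT (fun w => h (x, w)).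
Variable v : R.
Hypothesis v0 : 0 < v.
Hypothesis hv : (\int[mu]_x ((S x)%:E * \int[P]_w ((h (x, w)) ^+ 2)%:E) <= v%:E)%E.

(** [s] is the error accumulated by earlier samples. Tonelli lets the new sample be averaged first,
    for fixed x, where [integral_sq_recenter] applies. *)
Lemma sample_step (s : T1 -> R) (a : R) : measurable_fun setT s ->
  (\int[mu]_x (S x * s x ^+ 2)%:E <= a%:E)%E ->
  measurable_fun setT (fun w => \int[mu]_x (S x * (s x + (m x - h (x, w))) ^+ 2)%:E)%E /\
  (\int[P]_w (\int[mu]_x (S x * (s x + (m x - h (x, w))) ^+ 2)%:E) <= a%:E + v%:E)%E.
Proof.
move=> ms sa.
have mm : measurable_fun setT m by exact: measurable_Rintegral_fst.
have mF : measurable_fun setT (fun z : T1 * T2 =>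
    (S z.1 * (s z.1 + (m z.1 - h z)) ^+ 2)%:E).
  apply/measurable_EFinP; apply: measurable_funM; first exact: measurableT_comp.
  apply: measurable_funX; apply: measurable_funD; first exact: measurableT_comp.
  by apply: measurable_funB => //; exact: measurableT_comp.
have F0 z : (0 <= (S z.1 * (s z.1 + (m z.1 - h z)) ^+ 2)%:E)%E.
  by rewrite lee_fin mulr_ge0 ?sqr_ge0.
split.
  exact: (@measurable_fun_fubini_tonelli_G _ _ _ _ _ mu _ mF F0).
have := @fubini_tonelli _ _ _ _ _ mu P _ mF F0 => /= <-.
apply: (@le_trans _ _ (\int[mu]_x ((S x * s x ^+ 2)%:E +
   (S x)%:E * \int[P]_w ((h (x, w)) ^+ 2)%:E))%E).
  apply: ge0_le_integral_nomeas => x.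
    by apply: integral_ge0 => w _; rewrite lee_fin mulr_ge0 ?sqr_ge0.
  have mhx : measurable_fun setT (fun w => h (x, w)) by exact: measurable_fun_pair2.
  under eq_integral => w _ do rewrite EFinM.
  rewrite ge0_integralZl //.
  - rewrite EFinM -ge0_muleDr ?lee_fin ?sqr_ge0 //; last first.
      by apply: integral_ge0 => w _; rewrite lee_fin sqr_ge0.
    by apply: lee_wpmul2l; rewrite ?lee_fin //; exact: integral_sq_recenter.
  - apply/measurable_EFinP; apply: measurable_funX; apply: measurable_funD => //.
    exact: measurable_funB.
  - by move=> w _; rewrite lee_fin sqr_ge0.
  - by rewrite lee_fin.
rewrite ge0_integralD //; first exact: leeD.
- by move=> x _; rewrite lee_fin mulr_ge0 ?sqr_ge0.
- by apply/measurable_EFinP; apply: measurable_funM => //; exact: measurable_funX.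
- move=> x _; apply: mule_ge0; rewrite ?lee_fin //.
  by apply: integral_ge0 => w _; rewrite lee_fin sqr_ge0.
- apply: emeasurable_funM; first exact/measurable_EFinP.
  apply: (@measurable_fun_fubini_tonelli_F _ _ _ _ _ P (fun z => ((h z) ^+ 2)%:E)).
    by apply/measurable_EFinP; exact: measurable_funX.
  by move=> z; rewrite lee_fin sqr_ge0.
Qed.

(* Derandomised Monte Carlo: the samples are chosen one after the other so
   that the accumulated variance and the accumulated cost Z stay below
   their expected growth. *)
Lemma greedy_sample (Z : T2 -> \bar R) (b : R) (Q : T2 -> Prop) :
  measurable_fun setT Z -> (forall w, 0 <= Z w)%E -> 0 < b ->
  (\int[P]_w Z w <= b%:E)%E -> {ae P, forall w, Q w} ->
  forall M : nat, exists om : nat -> T2,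
    [/\ forall j, (j < M)%N -> Q (om j),
        (\sum_(j < M) Z (om j) <= (3 * M%:R * b)%:E)%E &
        (\int[mu]_x (S x * (\sum_(j < M) (m x - h (x, om j))) ^+ 2)%:E
           <= (3 * M%:R * v)%:E)%E].
Proof.
move=> mZ Z0 b0 Zb aQ.
have mm : measurable_fun setT m by exact: measurable_Rintegral_fst.
have mhw w : measurable_fun setT (fun x => h (x, w)) by exact: measurable_fun_pair1.
(* The potential e / v + z / b controls error and cost by a single choice: on average a sample
   raises it by at most 2, so some sample in Q raises it by at most 3. Both parts are nonnegative,
   hence each is at most 3 M. *)
suff H M : exists om : nat -> T2, (forall j, (j < M)%N -> Q (om j)) /\
   exists e z : R, [/\ 0 <= e, 0 <= z, e / v + z / b <= 3 * M%:R,
     (\sum_(j < M) Z (om j) <= z%:E)%E &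
     (\int[mu]_x (S x * (\sum_(j < M) (m x - h (x, om j))) ^+ 2)%:E <= e%:E)%E].
  move=> M; have [om [Qo [e [z [e0 z0 ez Hz He]]]]] := H M.
  exists om; split => //.
    apply: le_trans Hz _; rewrite lee_fin -ler_pdivrMr //.
    by apply: le_trans ez; rewrite lerDr divr_ge0 // ltW.
  apply: le_trans He _; rewrite lee_fin -ler_pdivrMr //.
  by apply: le_trans ez; rewrite lerDl divr_ge0 // ltW.
elim: M => [|M [om [Qo [e [z [e0 z0 ez Hz He]]]]]].
  exists (fun=> point); split => //; exists 0, 0; split => //.
  - by rewrite !mul0r mulr0 addr0.
  - by rewrite big_ord0.
  - rewrite integral0_eq // => x _; by rewrite big_ord0 expr0n mulr0.
pose s x := \sum_(j < M) (m x - h (x, om j)).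
have ms : measurable_fun setT s.
  by apply: measurable_sum => j; exact: measurable_funB.
have [mA A1] := sample_step ms He.
set A := (fun w => _) in mA A1.
have A0 w : (0 <= A w)%E.
  by apply: integral_ge0 => x _; rewrite lee_fin mulr_ge0 ?sqr_ge0.
have vi0 : 0 <= v^-1 by rewrite invr_ge0 ltW.
have bi0 : 0 <= b^-1 by rewrite invr_ge0 ltW.
pose B w := ((v^-1)%:E * A w + (b^-1)%:E * Z w)%E.
have B1 : (\int[P]_w B w <= (e / v + 2)%:E)%E.
  rewrite /B ge0_integralD //; last 4 first.
  - by move=> w _; apply: mule_ge0; rewrite ?lee_fin.
  - by apply: emeasurable_funM => //; exact: measurable_cst.
  - by move=> w _; apply: mule_ge0; rewrite ?lee_fin.
  - by apply: emeasurable_funM => //; exact: measurable_cst.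
  rewrite ge0_integralZl ?lee_fin // ge0_integralZl ?lee_fin //.
  apply: (@le_trans _ _ ((v^-1)%:E * (e%:E + v%:E) + (b^-1)%:E * b%:E)%E).
    by apply: leeD; apply: lee_wpmul2l; rewrite ?lee_fin.
  rewrite -(EFinD e v) -!EFinM -EFinD lee_fin mulrDr !mulVf ?gt_eqF //.
  by rewrite mulrC; lra.
have mB : measurable_fun setT B.
  by apply: emeasurable_funD; apply: emeasurable_funM => //; exact: measurable_cst.
have B0 w : (0 <= B w)%E by apply: adde_ge0; apply: mule_ge0; rewrite ?lee_fin.
have lt3 : e / v + 2 < e / v + 3 by rewrite ltrD2l; lra.
have [w [Qw Bw]] := prob_exists_le mB B0 B1 lt3 aQ.
have fA : A w \is a fin_num.
  rewrite ge0_fin_numE //; rewrite ltNge leye_eq; apply/negP => /eqP Aw.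
  move: Bw; rewrite /B Aw gt0_muley ?lte_fin ?invr_gt0 // addye ?leye_eq //.
  by rewrite gt_eqF // (@lt_le_trans _ _ 0%E) ?ltNye // mule_ge0 ?lee_fin.
have fZ : Z w \is a fin_num.
  rewrite ge0_fin_numE //; rewrite ltNge leye_eq; apply/negP => /eqP Zw.
  move: Bw; rewrite /B Zw gt0_muley ?lte_fin ?invr_gt0 // addey ?leye_eq //.
  by rewrite gt_eqF // (@lt_le_trans _ _ 0%E) ?ltNye // mule_ge0 ?lee_fin.
exists (fun j => if (j < M)%N then om j else w); split.
  by move=> j _; case: ifPn => // /Qo.
exists (fine (A w)), (z + fine (Z w)).
have EM G : (\sum_(j < M) G (if (j < M)%N then om j else w) = \sum_(j < M) G (om j) :> R).
  by apply: eq_bigr => j _; rewrite ltn_ord.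
split.
- exact: fine_ge0.
- by rewrite addr_ge0 // fine_ge0.
- move: Bw; rewrite /B -(fineK fA) -(fineK fZ) -!EFinM -EFinD lee_fin /= => Bw.
  rewrite mulrDl -natr1; move: ez Bw; rewrite ![_^-1 * _]mulrC; lra.
- rewrite big_ord_recr /= ltnn EFinD fineK //; apply: leeD => //.
  by apply: le_trans Hz; apply: lee_sum => j _; rewrite ltn_ord.
- rewrite fineK // /A le_eqVlt; apply/orP; left; apply/eqP.
  apply: eq_integral => x _; rewrite big_ord_recr /= ltnn.
  by rewrite (EM (fun o => m x - h (x, o))).
Qed.

End GreedySampling.

Section Enorm.
Context {R : realType} {D : nat}.
Implicit Types x y : 'cV[R]_D.

Lemma enorm_ge0 x : 0 <= enorm x. Proof. exact: sqrtr_ge0. Qed.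

Lemma enorm_sq x : enorm x ^+ 2 = \sum_i x i 0 ^+ 2.
Proof. by rewrite sqr_sqrtr // sumr_ge0 // => i _; exact: sqr_ge0. Qed.

Lemma ler_coord_enorm x i : `|x i 0| <= enorm x.
Proof.
rewrite -(@ler_pXn2r _ 2) ?nnegrE ?enorm_ge0 // enorm_sq real_normK ?num_real //.
by rewrite (bigD1 i) //= lerDl sumr_ge0 // => j _; exact: sqr_ge0.
Qed.

Lemma norm1_le_enorm x : \sum_i `|x i 0| <= D%:R * enorm x.
Proof.
apply: (@le_trans _ _ (\sum_(i < D) enorm x)).
  by apply: ler_sum => i _; exact: ler_coord_enorm.
by rewrite sumr_const card_ord mulr_natl.
Qed.

End Enorm.

(** * Integrals of real functions and weighted square errors *)

Section RealIntegrals.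
Context d (T : measurableType d) (R : realType) (mu : {measure set T -> \bar R}).
Implicit Types h : T -> R.

Lemma ge0_le_integral_fin h1 h2 : (forall x, 0 <= h1 x) ->
  (forall x, h1 x <= h2 x) ->
  (\int[mu]_x (h1 x)%:E <= \int[mu]_x (h2 x)%:E)%E.
Proof. by move=> h0 h; apply: ge0_le_integral_nomeas => x; rewrite lee_fin. Qed.

Lemma ge0_integralZ_fin (c : R) h : 0 <= c -> (forall x, 0 <= h x) ->
  measurable_fun setT h ->
  (\int[mu]_x (c * h x)%:E = c%:E * \int[mu]_x (h x)%:E)%E.
Proof.
move=> c0 h0 mh; under eq_integral => x _ do rewrite EFinM.
by rewrite ge0_integralZl //; [exact/measurable_EFinP|move=> x _; rewrite lee_fin].
Qed.

Lemma ge0_integralD_fin h1 h2 : (forall x, 0 <= h1 x) -> (forall x, 0 <= h2 x) ->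
  measurable_fun setT h1 -> measurable_fun setT h2 ->
  (\int[mu]_x (h1 x + h2 x)%:E = \int[mu]_x (h1 x)%:E + \int[mu]_x (h2 x)%:E)%E.
Proof.
move=> h10 h20 m1 m2; under eq_integral => x _ do rewrite EFinD.
by rewrite ge0_integralD //; try (by move=> x _; rewrite lee_fin); exact/measurable_EFinP.
Qed.

(** From (a + b + c)^2 <= 3 (a^2 + b^2 + c^2): three terms e / 9, times 3, give e. *)
Lemma integral_sq_triangle (S a b c u : T -> R) (e : R) :
  measurable_fun setT S -> (forall x, 0 <= S x) ->
  measurable_fun setT a -> measurable_fun setT b -> measurable_fun setT c ->
  (forall x, `|u x| <= `|a x| + `|b x| + `|c x|) ->
  (\int[mu]_x (S x * a x ^+ 2)%:E <= (e / 9)%:E)%E ->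
  (\int[mu]_x (S x * b x ^+ 2)%:E <= (e / 9)%:E)%E ->
  (\int[mu]_x (S x * c x ^+ 2)%:E <= (e / 9)%:E)%E ->
  (\int[mu]_x (S x * u x ^+ 2)%:E <= e%:E)%E.
Proof.
move=> mS S0 ma mb mc H ea eb ec.
have mq h : measurable_fun setT h -> measurable_fun setT (fun x => S x * h x ^+ 2).
  by move=> mh; apply: measurable_funM => //; exact: measurable_funX.
have q0 h x : 0 <= S x * h x ^+ 2 by rewrite mulr_ge0 ?sqr_ge0.
apply: (@le_trans _ _ (\int[mu]_x
  (3 * (S x * a x ^+ 2 + (S x * b x ^+ 2 + S x * c x ^+ 2)))%:E)%E).
  apply: ge0_le_integral_fin => x; first exact: q0.
  rewrite -!mulrDr [leRHS]mulrCA; apply: ler_wpM2l => //.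
  rewrite -(real_normK (num_real (u x))) -(real_normK (num_real (a x))).
  rewrite -(real_normK (num_real (b x))) -(real_normK (num_real (c x))).
  move: (H x) (normr_ge0 (u x)).
  move: `|u x| `|a x| `|b x| `|c x| => u' a' b' c' h u0.
  have : u' ^+ 2 <= (a' + b' + c') ^+ 2 by rewrite ler_pXn2r ?nnegrE //; lra.
  have := sqr_ge0 (a' - b'); have := sqr_ge0 (b' - c'); have := sqr_ge0 (a' - c').
  nra.
rewrite ge0_integralZ_fin //; last 2 first.
- by move=> x; rewrite !addr_ge0.
- by apply: measurable_funD; [exact: mq|apply: measurable_funD; exact: mq].
rewrite ge0_integralD_fin //; last 3 first.
- by move=> x; rewrite addr_ge0.
- exact: mq.
- by apply: measurable_funD; exact: mq.
rewrite ge0_integralD_fin //; [|exact: mq|exact: mq].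
apply: (@le_trans _ _ (3%:E * ((e / 9)%:E + ((e / 9)%:E + (e / 9)%:E)))%E).
  by apply: lee_wpmul2l; rewrite ?lee_fin //; apply: leeD => //; exact: leeD.
by rewrite -!EFinD -EFinM lee_fin; lra.
Qed.

End RealIntegrals.

(** * Bookkeeping with powers of one number t >= 2 *)

Section PowerBounds.
Context {R : realType}.
Variable t : R.
Hypothesis t2 : 2 <= t.

Let t1 : 1 <= t. Proof. by apply: le_trans t2; rewrite ler1n. Qed.

(** Through n <= 2^n, numerical constants become powers of [t], at the price of a crude exponent. *)
Lemma le_pow_cst (n : nat) : n%:R <= t ^+ n.
Proof.
apply: (@le_trans _ _ (2 ^+ n)); last by rewrite lerXn2r ?nnegrE // (le_trans _ t1).
by rewrite -natrX ler_nat ltnW // ltn_expl.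
Qed.

Lemma le_powD x y (a b : nat) : x <= t ^+ a -> y <= t ^+ b -> x + y <= t ^+ (a + b).+1.
Proof.
move=> xa yb; have pa : 1 <= t ^+ a by exact: exprn_ege1.
have pb : 1 <= t ^+ b by exact: exprn_ege1.
rewrite exprS exprD; apply: (@le_trans _ _ (2 * (t ^+ a * t ^+ b))); first by nra.
by apply: ler_wpM2r => //; rewrite mulr_ge0 // exprn_ge0 // (le_trans _ t1).
Qed.

Lemma le_powM x y (a b : nat) : 0 <= x -> 0 <= y ->
  x <= t ^+ a -> y <= t ^+ b -> x * y <= t ^+ (a + b).
Proof. by move=> x0 y0 xa yb; rewrite exprD; exact: ler_pM. Qed.

Lemma le_pow_mono x (a b : nat) : (a <= b)%N -> x <= t ^+ a -> x <= t ^+ b.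
Proof. by move=> ab xa; apply: le_trans xa _; exact: ler_weXn2l. Qed.

End PowerBounds.

Lemma exists_nat_approx {R : realType} (x : R) : 0 <= x ->
  exists M : nat, [/\ (0 < M)%N, x <= M%:R & M%:R <= x + 1].
Proof.
move=> x0; exists (Num.truncn x).+1; split => //.
  by apply: ltW; exact: truncnS_gt.
by rewrite -natr1 lerD2r truncn_le.
Qed.

(* [K2] is the size of a clipped network; the two conclusions bound depth and size
   of the network produced by one backward step. *)
Lemma stage_poly {R : realType} (C r e : nat) : exists C' : nat,
  forall (t B : R) (L K M I s Lg Kg D : nat),
  2 <= t -> 0 <= B -> B <= t -> D%:R <= B -> L%:R <= t ^+ C -> K%:R <= t ^+ C ->
  M%:R <= t ^+ e -> I%:R <= B -> s%:R <= 3 * M%:R * B ->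
  Lg%:R <= t ^+ r -> Kg%:R <= t ^+ r ->
  let K2 := (100 * (100 * (3 * ((2 * 1 + 3) * K.+1 + L.+1 * D.+1 ^ 3).+1)))%N in
  ((Lg + (L.+3 + I)).+1)%:R <= t ^+ C' /\
  ((10 * ((2 * (L.+3 + I) + 3) * Kg.+1 +
     (2 * Lg + 3) * (K2 * (s + M) + s).+1).+1)%N)%:R <= t ^+ C'.
Proof.
(* The exponent is a sum of two unknowns; the structural rules below instantiate one while bounding
   the depth and the other while bounding the size. *)
eapply (ex_intro _ (_ + _)%N); move=> t B L K M I s Lg Kg D t2 B0 Bt DB HL HK HM HI Hs HLg HKg /=.
have hI : I%:R <= t ^+ 1 by rewrite expr1; exact: le_trans Bt.
have hD : D%:R <= t ^+ 1 by rewrite expr1; exact: le_trans Bt.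
have hB : B <= t ^+ 1 by rewrite expr1.
have hs : s%:R <= t ^+ (3 + e + 1).
  apply: le_trans Hs _; apply: le_powM => //.
  by apply: le_powM => //; exact: (le_pow_cst t2 3).
have h1 : 1%:R <= t ^+ 0 by rewrite expr0.
have hS n a : n%:R <= t ^+ a -> n.+1%:R <= t ^+ (a + 0).+1.
  by move=> h; rewrite -natr1; exact: le_powD.
have hA n m a b : n%:R <= t ^+ a -> m%:R <= t ^+ b -> (n + m)%:R <= t ^+ (a + b).+1.
  by move=> ? ?; rewrite natrD; exact: le_powD.
have hM n m a b : n%:R <= t ^+ a -> m%:R <= t ^+ b -> (n * m)%:R <= t ^+ (a + b).
  by move=> ? ?; rewrite natrM; exact: le_powM.
have hX n m a : n%:R <= t ^+ a -> (n ^ m)%:R <= t ^+ (a * m).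
  by move=> ?; rewrite natrX exprM lerXn2r ?nnegrE // exprn_ge0 //; lra.
have hc n := le_pow_cst t2 n.
split.
  apply: (le_pow_mono t2 (leq_addr _ _)).
  repeat first [eassumption | eapply hc | eapply hA | eapply hS].
apply: (le_pow_mono t2 (leq_addl _ _)).
repeat first [eassumption | eapply hc | eapply hM | eapply hA | eapply hX | eapply hS].
Qed.

(** * Constants in a fixed dimension and growth of the value functions *)

Section StageData.
Context dO (Om : measurableType dO) (R : realType) (P : probability Om R).
Variables (T : R) (N D : nat) (g : R -> 'cV[R]_D -> R).
Variables (f : nat -> 'cV[R]_D -> Om -> 'cV[R]_D) (B : R) (r : nat).

(* In a fixed dimension all constants of (C3) and (C5) are absorbed into the one
   bound [B]; [Z] dominates the size of the network realising [f n]. *)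
Record stage_data : Prop := StageData {
  sd_B : 2 <= B;
  sd_D : D%:R <= B;
  sd_g : forall n, (n <= N)%N -> forall e, 0 < e -> e <= 1 ->
    exists gh : @relu_net R D 1,
     (forall x, `|net_fun gh x - g (tgrid T N n) x| <= e * (1 + enorm x)) /\
     (net_size gh)%:R <= (B / e) ^+ r;
  sd_gB : forall n, (n <= N)%N -> forall x,
     `|g (tgrid T N n) x| <= B * (1 + enorm x);
  sd_fm : forall n, (n < N)%N -> forall d1 (T1 : measurableType d1)
     (Y : T1 -> 'cV[R]_D), vec_measurable Y ->
     vec_measurable (fun w : T1 * Om => f n (Y w.1) w.2);
  sd_f2 : forall n, (n < N)%N -> forall x,
    (\int[P]_w ((enorm (f n x w)) ^+ 2)%:E <= (B * (1 + enorm x) ^+ 2)%:E)%E;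
  sd_net : forall n, (n < N)%N -> exists (Z : Om -> \bar R) (I : nat),
    [/\ measurable_fun setT Z, (forall w, 0 <= Z w)%E,
        (\int[P]_w Z w <= B%:E)%E, I%:R <= B &
        {ae P, forall w, exists phi : @relu_net R D D,
          [/\ net_depth phi = I, ((net_size phi)%:R%:E <= Z w)%E &
              forall x, f n x w = net_eval phi x]}]
}.

Hypothesis sd : stage_data.

(** [g] is the pointwise limit of networks of accuracy 1 / (j + 1), and networks are measurable. *)
Lemma sd_g_measurable n d1 (T1 : measurableType d1) (Y : T1 -> 'cV[R]_D) :
  (n <= N)%N -> vec_measurable Y ->
  measurable_fun setT (fun w => g (tgrid T N n) (Y w)).
Proof.
move=> nN mY.
have H j : exists gh : @relu_net R D 1,
    forall x, `|net_fun gh x - g (tgrid T N n) x| <= (j.+1%:R)^-1 * (1 + enorm x).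
  have [gh [H _]] := sd_g sd nN (e := (j.+1%:R)^-1) ltac:(by rewrite invr_gt0)
     ltac:(by rewrite invf_le1 // ler1n).
  by exists gh.
have [G HG] := choice H.
apply: (@measurable_fun_cvg _ _ _ setT (fun j w => net_fun (G j) (Y w))).
  by move=> j; apply: net_eval_measurable => i; exact: vec_measurable_coord.
move=> w _; apply/cvgrPdist_le => e e0.
near=> j; rewrite distrC; apply: le_trans (HG j (Y w)) _.
rewrite mulrC ler_pdivrMr // mulrC -ler_pdivrMr //.
apply: (@le_trans _ _ j%:R); last by rewrite ler_nat.
near: j; exact: nbhs_infty_ger.
Unshelve. all: by end_near. Qed.

Lemma sd_f_measurable n x : (n < N)%N -> vec_measurable (f n x).
Proof.
move=> nN; have := sd_fm sd nN (@vec_measurable_cst R _ Om D x).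
by move/(vec_measurable_pair2 point).
Qed.

(** The factor 4 B is what one step costs in weighted second moment; the next weight of the
    induction is divided by it. *)
Lemma sd_f_sq n x : (n < N)%N ->
  (\int[P]_w ((1 + enorm (f n x w)) ^+ 2)%:E <= (4 * B * (1 + enorm x) ^+ 2)%:E)%E.
Proof.
move=> nN; have B2 := sd_B sd; have x0 := enorm_ge0 x.
have me : measurable_fun setT (fun w => enorm (f n x w) ^+ 2).
  apply: measurable_funX; apply: measurable_enorm => i.
  by apply: vec_measurable_coord; exact: sd_f_measurable.
apply: (@le_trans _ _ (\int[P]_w (2 + 2 * enorm (f n x w) ^+ 2)%:E)%E).
  apply: ge0_le_integral_fin => w; first exact: sqr_ge0.
  by have := sqr_ge0 (1 - enorm (f n x w)); nra.
rewrite ge0_integralD_fin //; last 2 first.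
- by move=> w; rewrite mulr_ge0 ?sqr_ge0.
- by apply: measurable_funM => //; exact: measurable_cst.
rewrite integral_cst // [X in (_ * X)%E]probability_setT mule1.
rewrite ge0_integralZ_fin //; last by move=> w; exact: sqr_ge0.
apply: (@le_trans _ _ (2%:E + 2%:E * (B * (1 + enorm x) ^+ 2)%:E)%E).
  by apply: leeD2l; apply: lee_wpmul2l; rewrite ?lee_fin //; exact: sd_f2.
rewrite -EFinM -EFinD lee_fin.
have : 1 <= (1 + enorm x) ^+ 2 by rewrite exprn_ege1 //; lra.
nra.
Qed.

Lemma Vaux_measurable k d1 (T1 : measurableType d1) (Y : T1 -> 'cV[R]_D) :
  (k <= N)%N -> vec_measurable Y ->
  measurable_fun setT (fun w => Vaux P T N g f k (Y w)).
Proof.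
elim: k d1 T1 Y => [|k IH] d1 T1 Y kN mY /=; first exact: sd_g_measurable.
apply: (measurable_maxr (sd_g_measurable _ mY)); first exact: leq_subr.
apply: (@measurable_Rintegral_fst _ _ _ _ _ P
  (fun z => Vaux P T N g f k (f (N - k.+1)%N (Y z.1) z.2))).
by apply: (IH _ _ _ (ltnW kN)); apply: sd_fm => //; lia.
Qed.

(** One backward step multiplies the growth constant by at most the square root of 4 B, and 4 B <=
    B^4 as B >= 2: two more powers of B per step. The initial B comes from [sd_gB]. *)
Definition Vbound k : R := B ^+ (2 * k + 1).

Lemma Vbound_ge1 k : 1 <= Vbound k.
Proof. by have := sd_B sd => ?; rewrite exprn_ege1 //; lra. Qed.

Lemma Vaux_bound k x : (k <= N)%N ->
  `|Vaux P T N g f k x| <= Vbound k * (1 + enorm x).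
Proof.
have B2 := sd_B sd.
elim: k x => [|k IH] x kN /=; first by rewrite /Vbound expr1; exact: sd_gB.
have x0 := enorm_ge0 x; have G1 := Vbound_ge1 k.
have E : Vbound k.+1 = Vbound k * B ^+ 2 by rewrite /Vbound -exprD; congr (_ ^+ _); lia.
have B4 : 4 * B <= B ^+ 2 * B ^+ 2.
  have : 4 <= B ^+ 2 by nra.
  have : 2 * B <= B ^+ 2 by nra.
  move: (B ^+ 2) => u; nra.
set h := fun w => _.
have mh : measurable_fun setT h.
  by apply: Vaux_measurable; [lia|apply: sd_f_measurable; lia].
have /= := Rintegral_sq_le P mh.
have hb : (\int[P]_w ((h w) ^+ 2)%:E <=
   ((Vbound k) ^+ 2)%:E * (4 * B * (1 + enorm x) ^+ 2)%:E)%E.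
  apply: (@le_trans _ _ (\int[P]_w ((Vbound k) ^+ 2 *
     (1 + enorm (f (N - k.+1)%N x w)) ^+ 2)%:E)%E).
    apply: ge0_le_integral_fin => w; first exact: sqr_ge0.
    rewrite -exprMn -(real_normK (num_real (h w))) ler_pXn2r ?nnegrE //.
      by apply: IH; exact: ltnW.
    by rewrite mulr_ge0 ?addr_ge0 ?enorm_ge0 //; lra.
  rewrite ge0_integralZ_fin ?sqr_ge0 //; last 2 first.
  - by move=> w; exact: sqr_ge0.
  - apply: measurable_funX; apply: measurable_funD; first exact: measurable_cst.
    apply: measurable_enorm => i; apply: vec_measurable_coord.
    by apply: sd_f_measurable; lia.
  by apply: lee_wpmul2l; rewrite ?lee_fin ?sqr_ge0 //; apply: sd_f_sq; lia.
move=> /le_trans/(_ hb); rewrite -EFinM lee_fin => Hm.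
have Hm' : `|Rintegral P setT h| <= Vbound k.+1 * (1 + enorm x).
  rewrite -(@ler_pXn2r _ 2) ?nnegrE //; last first.
    by rewrite mulr_ge0 // ?(le_trans _ (Vbound_ge1 _)) //; lra.
  rewrite real_normK ?num_real //; apply: le_trans Hm _.
  rewrite E (_ : (_ * _ * _) ^+ 2 =
    Vbound k ^+ 2 * (B ^+ 2 * B ^+ 2 * (1 + enorm x) ^+ 2)); last by ring.
  apply: ler_wpM2l; first exact: sqr_ge0.
  by apply: ler_wpM2r => //; exact: sqr_ge0.
have Hg : `|g (tgrid T N (N - k.+1)) x| <= Vbound k.+1 * (1 + enorm x).
  apply: le_trans (sd_gB sd (leq_subr _ _) x) _.
  apply: ler_wpM2r; first by lra.
  rewrite E -[leLHS]mul1r; apply: ler_pM => //; first by lra.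
  by rewrite expr2; nra.
by rewrite maxEle; case: ifP.
Qed.

End StageData.

Lemma net_rep_measurable {R : realType} d (T : measurableType d) D L K
    (h : 'cV[R]_D -> R) (Y : T -> 'cV[R]_D) :
  net_rep L K h -> vec_measurable Y -> measurable_fun setT (fun w => h (Y w)).
Proof.
move=> [phi [_ _ e]] mY; under eq_fun do rewrite -e.
by apply: net_eval_measurable => i; exact: vec_measurable_coord.
Qed.

(** The base measures of the backward induction range over subprobabilities, a class stable under
    the product with [P]. *)
Lemma integral_product_subprobability {R : realType} d1 (T1 : measurableType d1)
    d2 (T2 : measurableType d2) (m1 : subprobability T1 R) (m2 : subprobability T2 R)
    (F : T1 * T2 -> R) :
  measurable_fun setT F -> (forall z, 0 <= F z) ->
  (\int[product_subprobability (m1, m2)]_z (F z)%:E =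
   \int[m1]_x \int[m2]_w (F (x, w))%:E)%E.
Proof.
move=> mF F0.
apply: (@fubini_tonelli1 _ _ _ _ _ m1 m2 (EFin \o F)) => /=.
  exact/measurable_EFinP.
by move=> z; rewrite lee_fin.
Qed.

(** * One backward step and the induction *)

Section StageStep.
Context dO (Om : measurableType dO) (R : realType) (P : probability Om R).
Variables (T : R) (N D : nat) (g : R -> 'cV[R]_D -> R).
Variables (f : nat -> 'cV[R]_D -> Om -> 'cV[R]_D) (B : R) (r : nat).
Hypothesis sd : stage_data P T N g f B r.

(** Both norm comparisons are used: |x|_1 <= D |x| <= B |x| turns l1 clipping into a Euclidean
    growth bound with a lost factor B, and |x| <= |x|_1 puts every admissible y inside the clipping
    interval. *)
Lemma net_clip L K (h : 'cV[R]_D -> R) (Gam : R) : 0 <= Gam -> net_rep L K h ->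
  exists h' : 'cV[R]_D -> R, [/\
    net_rep L.+3 (100 * (100 * (3 * ((2 * 1 + 3) * K.+1 + L.+1 * D.+1 ^ 3).+1))) h',
    forall x, `|h' x| <= Gam * B * (1 + enorm x) &
    forall x (y : R), `|y| <= Gam * (1 + enorm x) -> `|y - h' x| <= `|y - h x|].
Proof.
move=> G0 /(net_rep_pad 1); rewrite add1n => H.
have [h' [H1 H2 H3]] := net_rep_clip G0 H.
have B2 := sd_B sd; have DB := sd_D sd.
exists h'; split => // [x|x y yb].
- apply: le_trans (H2 x) _; rewrite -mulrA; apply: ler_wpM2l => //.
  have := norm1_le_enorm x; have := enorm_ge0 x => e0 n1.
  have : D%:R * enorm x <= B * enorm x by apply: ler_wpM2r.
  by lra.
- apply: H3; apply: le_trans yb _; apply: ler_wpM2l => //; rewrite lerD2l.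
  rewrite -(@ler_pXn2r _ 2) ?nnegrE ?enorm_ge0 ?sumr_ge0 // enorm_sq.
  have sub (s : seq 'I_D) : \sum_(i <- s) x i 0 ^+ 2 <= (\sum_(i <- s) `|x i 0|) ^+ 2.
    elim: s => [|i s IH]; first by rewrite !big_nil expr0n.
    rewrite !big_cons; have : 0 <= \sum_(j <- s) `|x j 0| by rewrite sumr_ge0.
    have := normr_ge0 (x i 0); rewrite -(real_normK (num_real (x i 0))).
    by move: IH; nra.
  exact: sub.
Qed.

(** [greedy_sample] bounds the weighted square of the sum of M errors by 3 M v; dividing by M^2
    leaves 3 v / M. [s] is the total size of the M sampled networks, and [K] is paid once per sample
    because each is composed with [Vc]. *)
Lemma stage_mc d1 (T1 : measurableType d1) (m1 : subprobability T1 R)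
    (S : T1 -> R) (Y : T1 -> 'cV[R]_D) (n L K : nat) (Vc : 'cV[R]_D -> R) (Gam : R)
    (M : nat) :
  measurable_fun setT S -> (forall x, 0 <= S x) -> vec_measurable Y ->
  (\int[m1]_x (S x * (1 + enorm (Y x)) ^+ 2)%:E <= 1)%E ->
  (n < N)%N -> 1 <= Gam -> net_rep L K Vc ->
  (forall x, `|Vc x| <= Gam * B * (1 + enorm x)) -> (0 < M)%N ->
  exists (I s : nat) (avg : 'cV[R]_D -> R),
    [/\ net_rep (L + I) (K * (s + M) + s) avg, I%:R <= B,
        s%:R <= 3 * M%:R * B &
        (\int[m1]_x (S x * (Rintegral P setT (fun w => Vc (f n (Y x) w)) - avg (Y x)) ^+ 2)%:E
          <= (3 / M%:R * (4 * Gam ^+ 2 * B ^+ 3))%:E)%E].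
Proof.
move=> mS S0 mY SY nN G1 rV Vb M0.
have B2 := sd_B sd.
have GB0 : 0 <= Gam * B by rewrite mulr_ge0 //; lra.
pose h (z : T1 * Om) := Vc (f n (Y z.1) z.2).
have mh : measurable_fun setT h.
  by apply: (net_rep_measurable rV); exact: (sd_fm sd).
have hsq x : (\int[P]_w ((h (x, w)) ^+ 2)%:E <=
    ((Gam * B) ^+ 2 * (4 * B) * (1 + enorm (Y x)) ^+ 2)%:E)%E.
  apply: (@le_trans _ _ (\int[P]_w ((Gam * B) ^+ 2 * (1 + enorm (f n (Y x) w)) ^+ 2)%:E)%E).
    apply: ge0_le_integral_fin => w; first exact: sqr_ge0.
    rewrite -exprMn -(real_normK (num_real (h _))) ler_pXn2r ?nnegrE //.
      exact: Vb.
    by rewrite mulr_ge0 // addr_ge0 ?enorm_ge0.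
  rewrite ge0_integralZ_fin ?sqr_ge0 //; last 2 first.
  - by move=> w; exact: sqr_ge0.
  - apply: measurable_funX; apply: measurable_funD; first exact: measurable_cst.
    apply: measurable_enorm => i; apply: vec_measurable_coord.
    exact: (sd_f_measurable sd).
  rewrite -(mulrA ((Gam * B) ^+ 2)) (EFinM ((Gam * B) ^+ 2)).
  apply: lee_wpmul2l; rewrite ?lee_fin ?sqr_ge0 //.
  exact: (sd_f_sq sd).
have h2 x : (\int[P]_w ((h (x, w)) ^+ 2)%:E < +oo)%E.
  by apply: le_lt_trans (hsq x) _; exact: ltry.
(* The squared growth constant (Gam B)^2 of [Vc] times the factor 4 B of [sd_f_sq]. *)
pose v := 4 * Gam ^+ 2 * B ^+ 3.
have v0 : 0 < v by rewrite /v mulr_gt0 ?mulr_gt0 ?exprn_gt0 //; lra.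
have hv : (\int[m1]_x ((S x)%:E * \int[P]_w ((h (x, w)) ^+ 2)%:E) <= v%:E)%E.
  apply: (@le_trans _ _ (\int[m1]_x (v * (S x * (1 + enorm (Y x)) ^+ 2))%:E)%E).
    apply: ge0_le_integral_nomeas => x.
      by apply: mule_ge0; rewrite ?lee_fin //; apply: integral_ge0 => w _; rewrite lee_fin sqr_ge0.
    rewrite mulrCA EFinM; apply: lee_wpmul2l; rewrite ?lee_fin //.
    apply: le_trans (hsq x) _; rewrite lee_fin le_eqVlt; apply/orP; left; apply/eqP.
    by rewrite /v; ring.
  rewrite ge0_integralZ_fin //; last 3 first.
  - exact: ltW.
  - by move=> x; rewrite mulr_ge0 ?sqr_ge0.
  - apply: measurable_funM => //; apply: measurable_funX.
    apply: measurable_funD; first exact: measurable_cst.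
    by apply: measurable_enorm => i; exact: vec_measurable_coord.
  rewrite -[leRHS]mule1; apply: lee_wpmul2l => //.
  by rewrite lee_fin ltW.
have [Z [I [mZ Z0 Zb Ib aZ]]] := sd_net sd nN.
have b0 : 0 < B by lra.
have [om [Qo Zo Eo]] := greedy_sample mS S0 mh h2 v0 hv mZ Z0 b0 Zb aZ M.
have [phi Hphi] := @choice 'I_M _ _ (fun j : 'I_M => Qo j (ltn_ord j)).
pose s := (\sum_(j < M) net_size (phi j))%N.
exists I, s, (fun x => M%:R^-1 * \sum_(j < M) Vc (net_eval (phi j) x)); split => //.
- apply: net_repZ.
  have : net_rep (L + I) (\sum_(j < M) (K * (net_size (phi j)).+1 + net_size (phi j)))
     (fun x => \sum_(j < M) Vc (net_eval (phi j) x)).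
    apply: net_rep_sum => j; have [<- _ _] := Hphi j; exact: net_rep_compv.
  apply: net_rep_le; rewrite big_split /= -/s leq_add2r -big_distrr /= leq_mul2l.
  apply/orP; right; rewrite /s -[X in (_ + X)%N]card_ord -sum1_card -big_split /=.
  by apply: leq_sum => j _; rewrite addn1.
- rewrite -lee_fin; apply: le_trans Zo; rewrite /s natr_sum -sumEFin.
  by apply: lee_sum => j _; have [_ + _] := Hphi j.
- have Mr0 : 0 < M%:R :> R by rewrite ltr0n.
  rewrite (_ : (\int[m1]_x _)%E = (\int[m1]_x (M%:R^-1 ^+ 2 *
     (S x * (\sum_(j < M) (Rintegral P setT (fun w => h (x, w)) - h (x, om j))) ^+ 2))%:E)%E); last first.
    apply: eq_integral => x _; congr EFin.
    rewrite [RHS]mulrCA -exprMn; congr (_ * _ ^+ 2).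
    rewrite sumrB sumr_const card_ord mulrBr /h /=; set m := Rintegral _ _ _.
    rewrite -(mulr_natl m M) mulKf ?gt_eqF //.
    congr (_ - _ * _); apply: eq_bigr => j _.
    by have [_ _ E] := Hphi j; rewrite /h /= E.
  rewrite ge0_integralZ_fin ?sqr_ge0 //; last 2 first.
  - by move=> x; rewrite mulr_ge0 ?sqr_ge0.
  - apply: measurable_funM => //; apply: measurable_funX; apply: measurable_sum => j.
    apply: measurable_funB; first exact: measurable_Rintegral_fst.
    exact: measurable_fun_pair1.
  apply: (@le_trans _ _ ((M%:R^-1 ^+ 2)%:E * (3 * M%:R * v)%:E)%E).
    by apply: lee_wpmul2l; rewrite ?lee_fin ?sqr_ge0.
  rewrite -EFinM lee_fin le_eqVlt; apply/orP; left; apply/eqP; rewrite /v.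
  by field; rewrite gt_eqF.
Qed.

End StageStep.

(** The maximum is 1-Lipschitz; [c] is inserted to separate the propagated error from the sampling
    error. *)
Lemma ler_dist_max {R : realType} (a b c a' b' : R) :
  `|Num.max a b - Num.max a' b'| <= `|a - a'| + `|b - c| + `|c - b'|.
Proof.
rewrite -addrA; apply: le_trans (lerD (lexx _) (ler_distD c b b')).
have := ler_norm (a - a'); have := ler_norm (a' - a); rewrite (distrC a' a).
have := ler_norm (b - b'); have := ler_norm (b' - b); rewrite (distrC b' b).
move: `|a - a'| `|b - b'| => u v *.
by rewrite ler_norml !maxEle; case: ifPn => ?; case: ifPn => ?; lra.
Qed.

Lemma Vbound_sqM {R : realType} (B : R) k :
  B ^+ (4 * k + 5) = Vbound B k ^+ 2 * B ^+ 3.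
Proof. by rewrite /Vbound -exprM -exprD; congr (_ ^+ _); lia. Qed.

(** [C] comes before the dimension, the spaces, the measure, the weight and the state. The induction
    lives on this generality: the hypothesis at [k] is applied on [T1 * Om], to the next state and a
    renormalised weight. *)
Lemma stage_net {R : realType} (T : R) (N r k : nat) : (k <= N)%N ->
  exists C : nat, forall dO (Om : measurableType dO) (P : probability Om R) D
    (g : R -> 'cV[R]_D -> R) (f : nat -> 'cV[R]_D -> Om -> 'cV[R]_D) (B : R),
  stage_data P T N g f B r ->
  forall d1 (T1 : measurableType d1) (m1 : subprobability T1 R)
    (S : T1 -> R) (Y : T1 -> 'cV[R]_D),
  measurable_fun setT S -> (forall x, 0 <= S x) -> vec_measurable Y ->
  (\int[m1]_x (S x * (1 + enorm (Y x)) ^+ 2)%:E <= 1)%E ->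
  forall eps : R, 0 < eps -> eps <= 1 ->
  exists (L K : nat) (Vh : 'cV[R]_D -> R),
    [/\ net_rep L K Vh, L%:R <= (B / eps) ^+ C, K%:R <= (B / eps) ^+ C &
      (\int[m1]_x (S x * (Vaux P T N g f k (Y x) - Vh (Y x)) ^+ 2)%:E
        <= (eps ^+ 2)%:E)%E].
Proof.
elim: k => [|k IH] kN.
  exists r => dO Om P D g f B sd d1 T1 m1 S Y mS S0 mY SY eps e0 e1.
  have [gh [gh1 gh2]] := sd_g sd (leqnn N) e0 e1.
  have [psi [p1 p2 p3]] := net_depth_reduce gh.
  exists (net_depth psi), (net_size psi), (net_fun psi); split.
  - by exists psi.
  - by apply: le_trans gh2; rewrite ler_nat.
  - by apply: le_trans gh2; rewrite ler_nat.
  - apply: (@le_trans _ _ (\int[m1]_x (eps ^+ 2 * (S x * (1 + enorm (Y x)) ^+ 2))%:E)%E).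
      apply: ge0_le_integral_fin => x; first by rewrite mulr_ge0 ?sqr_ge0.
      rewrite [leRHS]mulrCA; apply: ler_wpM2l => //.
      rewrite -exprMn -(real_normK (num_real (_ - _))) ler_pXn2r ?nnegrE //.
        by rewrite p3 distrC; exact: gh1.
      by rewrite mulr_ge0 ?addr_ge0 ?enorm_ge0 // ltW.
    rewrite ge0_integralZ_fin ?sqr_ge0 //; last 2 first.
    + by move=> x; rewrite mulr_ge0 ?sqr_ge0.
    + apply: measurable_funM => //; apply: measurable_funX.
      apply: measurable_funD; first exact: measurable_cst.
      by apply: measurable_enorm => i; exact: vec_measurable_coord.
    by rewrite -[leRHS]mule1; apply: lee_wpmul2l; rewrite ?lee_fin ?sqr_ge0.
have [C HC] := IH (ltnW kN).
(* The exponents anticipate the bounds below: B / dl <= t^5, B / (eps / 3) = 3 t <= t^3, and M <=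
   108 B^(4 k + 5) eps^(-2) + 1 with 108 <= t^108. *)
have [C' HC'] := @stage_poly R (5 * C) (3 * r) (108 + (4 * k + 5 + 2) + 0).+1.
exists C' => dO Om P D g f B sd d1 T1 m1 S Y mS S0 mY SY eps e0 e1.
have B2 := sd_B sd; have B0 : 0 < B by lra.
set t := B / eps.
have Bt : B <= t by rewrite /t ler_pdivlMr // ler_piMr // ltW.
have t2 : 2 <= t by exact: le_trans Bt.
have et : eps^-1 <= t by rewrite /t ler_peMl // ?invr_ge0 ?ltW //; lra.
have e30 : 0 < eps / 3 by rewrite divr_gt0.
have e31 : eps / 3 <= 1 by lra.
have t0 : 0 <= t by lra.
have t4 : 4 <= t ^+ 2 by nra.
have t8 : 6 <= t ^+ 3 by rewrite exprS; move: (t ^+ 2) t4 => u; nra.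
have t3 : 3 * t <= t ^+ 3.
  by rewrite exprSr; apply: ler_wpM2r => //; apply: le_trans t4; lra.
have B0' := ltW B0.
pose n := (N - k.+1)%N.
have nN : (n < N)%N by rewrite /n ltn_subrL /=; exact: leq_ltn_trans kN.
(* Chosen so that 4 B dl^2 = eps^2 / (9 B), which fits into the share eps^2 / 9. *)
pose dl := eps / (6 * B).
have dl0 : 0 < dl by rewrite divr_gt0 // mulr_gt0.
have dl1 : dl <= 1 by rewrite ler_pdivrMr ?mulr_gt0 // mul1r; lra.
have tdl : B / dl <= t ^+ 5.
  have -> : B / dl = 6 * B * t.
    by rewrite /dl /t; field; rewrite !gt_eqF.
  apply: (@le_trans _ _ (t ^+ 3 * t * t)); last by rewrite -!exprSr.
  apply: ler_wpM2r => //.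
  exact: ler_pM.
have tdl0 : 0 <= B / dl by rewrite divr_ge0 // ltW.
(* The next state is built with a fresh copy of the noise, and dividing the weight by 4 B restores
   the bound 1. *)
pose S' (z : T1 * Om) := (4 * B)^-1 * S z.1.
pose Y' (z : T1 * Om) := f n (Y z.1) z.2.
have mS' : measurable_fun setT S'.
  by apply: measurable_funM; [exact: measurable_cst|exact: measurableT_comp].
have iB0 : 0 <= (4 * B)^-1 by rewrite invr_ge0; lra.
have S'0 z : 0 <= S' z by rewrite mulr_ge0.
have mY' : vec_measurable Y' by exact: (sd_fm sd).
have mfx x : vec_measurable (f n x) by exact: (sd_f_measurable sd).
have menY : measurable_fun setT (fun x => S x * (1 + enorm (Y x)) ^+ 2).
  apply: measurable_funM => //; apply: measurable_funX.
  apply: measurable_funD; first exact: measurable_cst.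
  by apply: measurable_enorm => i; exact: vec_measurable_coord.
have men d2 (T2 : measurableType d2) (U : T2 -> 'cV[R]_D) : vec_measurable U ->
    measurable_fun setT (fun x => (1 + enorm (U x)) ^+ 2).
  move=> mU; apply: measurable_funX; apply: measurable_funD; first exact: measurable_cst.
  by apply: measurable_enorm => i; exact: vec_measurable_coord.
pose m1' := product_subprobability (m1, P : subprobability Om R).
have SY' : (\int[m1']_z (S' z * (1 + enorm (Y' z)) ^+ 2)%:E <= 1)%E.
  rewrite integral_product_subprobability; last 2 first.
  - by apply: measurable_funM => //; exact: men.
  - by move=> z; rewrite mulr_ge0 ?sqr_ge0.
  apply: le_trans SY; apply: ge0_le_integral_nomeas => x.
    by apply: integral_ge0 => w _; rewrite lee_fin mulr_ge0 ?sqr_ge0.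
  rewrite /S' /Y' /= ge0_integralZ_fin //; last 3 first.
  - by rewrite mulr_ge0.
  - by move=> w; rewrite sqr_ge0.
  - exact: men.
  apply: le_trans (lee_wpmul2l _ (sd_f_sq sd (Y x) nN)) _.
    by rewrite lee_fin mulr_ge0.
  rewrite -EFinM lee_fin le_eqVlt; apply/orP; left; apply/eqP.
  by field; rewrite gt_eqF.
have [L [K [V0 [rV0 HL HK E0]]]] := HC _ _ P D g f B sd _ _ m1' S' Y' mS' S'0 mY' SY' dl dl0 dl1.
have G1 := Vbound_ge1 sd k; set Gam := Vbound B k in G1.
have [Vc [rVc Vcb Vca]] := net_clip sd (le_trans ler01 G1) rV0.
set K2 := (100 * _)%N in rVc.
(* With v = 4 Gam^2 B^3, taking M >= 27 v / eps^2 brings the sampling error 3 v / M below eps^2 /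
   9. *)
have v0 : 0 <= 27 * (4 * Gam ^+ 2 * B ^+ 3) / eps ^+ 2.
  apply: divr_ge0; last exact: sqr_ge0.
  by do ?[apply: mulr_ge0 => //]; apply: exprn_ge0 => //; exact: le_trans G1.
have [M [M0 vM Mv]] := exists_nat_approx v0.
have [I [s [avg [ravg HI Hs Eavg]]]] := stage_mc sd mS S0 mY SY nN G1 rVc Vcb M0.
have [gh [gh1 gh2]] := sd_g sd (leq_subr k.+1 N) e30 e31.
have [psi [p1 p2 p3]] := net_depth_reduce gh.
have sizeg : (net_size gh)%:R <= t ^+ (3 * r).
  apply: le_trans gh2 _; rewrite exprM; apply: lerXn2r; rewrite ?nnegrE //.
  - by rewrite divr_ge0 // ltW.
  - exact: exprn_ge0.
  - rewrite (_ : B / _ = 3 * t) //; rewrite /t; clear -e0.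
    by field; rewrite gt_eqF.
have HMt : M%:R <= t ^+ (108 + (4 * k + 5 + 2) + 0).+1.
  apply: le_trans Mv _; apply: le_powD => //.
  rewrite (_ : _ / _ = 108 * (B ^+ (4 * k + 5) * (eps^-1) ^+ 2)); last first.
    have E (u : R) : 27 * (4 * u) / eps ^+ 2 = 108 * (u * eps^-1 ^+ 2).
      by clear -e0; field; rewrite gt_eqF.
    by rewrite Vbound_sqM -/Gam -E (mulrA 4).
  have ie0 : 0 <= eps^-1 by rewrite invr_ge0 ltW.
  apply: le_powM => //.
  - by rewrite mulr_ge0 ?exprn_ge0 // ltW.
  - exact: (le_pow_cst t2 108).
  - apply: le_powM; rewrite ?exprn_ge0 //.
      by apply: lerXn2r; rewrite ?nnegrE //.
    by apply: lerXn2r; rewrite ?nnegrE //.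
have HLt : L%:R <= t ^+ (5 * C).
  by apply: le_trans HL _; rewrite exprM; apply: lerXn2r; rewrite ?nnegrE ?exprn_ge0 //.
have HKt : K%:R <= t ^+ (5 * C).
  by apply: le_trans HK _; rewrite exprM; apply: lerXn2r; rewrite ?nnegrE ?exprn_ge0 //.
have Lg : (net_depth psi)%:R <= t ^+ (3 * r) by apply: le_trans sizeg; rewrite ler_nat.
have Kg : (net_size psi)%:R <= t ^+ (3 * r) by apply: le_trans sizeg; rewrite ler_nat.
have [HLf HKf] := HC' t B L K M I s _ _ D t2 (ltW B0) Bt (sd_D sd) HLt HKt HMt HI Hs Lg Kg.
have rpsi : net_rep (net_depth psi) (net_size psi) (net_fun psi) by exists psi.
have := net_rep_pad (L.+3 + I) rpsi; rewrite [X in net_rep X]addnC => rg.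
have rmax := net_rep_max rg (net_rep_pad (net_depth psi) ravg).
refine (ex_intro _ _ (ex_intro _ _ (ex_intro _ (fun x => Num.max (net_fun psi x) (avg x))
  (And4 rmax HLf HKf _)))).
pose RV x := Rintegral P setT (fun w => Vaux P T N g f k (f n (Y x) w)).
pose RC x := Rintegral P setT (fun w => Vc (f n (Y x) w)).
have mVf : measurable_fun setT (fun z : T1 * Om => Vaux P T N g f k (f n (Y z.1) z.2)).
  by apply: (Vaux_measurable sd (ltnW kN)); exact: (sd_fm sd).
have mCf : measurable_fun setT (fun z : T1 * Om => Vc (f n (Y z.1) z.2)).
  by apply: (net_rep_measurable rVc); exact: (sd_fm sd).
have mRV : measurable_fun setT RV by exact: (measurable_Rintegral_fst P mVf).
have mRC : measurable_fun setT RC by exact: (measurable_Rintegral_fst P mCf).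
have mg : measurable_fun setT (fun x => g (tgrid T N n) (Y x)).
  exact: (sd_g_measurable sd (leq_subr _ _)).
have mgh : measurable_fun setT (fun x => net_fun psi (Y x)) by exact: (net_rep_measurable rpsi).
have mavg : measurable_fun setT (fun x => avg (Y x)) by exact: (net_rep_measurable ravg).
(* Three errors: the network for [g], the clipped network replacing the value function inside the
   expectation, and the sampling. *)
apply: (@integral_sq_triangle _ _ _ _ S
   (fun x => g (tgrid T N n) (Y x) - net_fun psi (Y x)) (fun x => RV x - RC x)
   (fun x => RC x - avg (Y x))) => //.
- exact: measurable_funB.
- exact: measurable_funB.
- exact: measurable_funB.
- move=> x /=; rewrite -/n -/(RV x).
  move: (g _ _) (RV x) (RC x) (net_fun psi _) (avg _) => a b c a' b'.
  exact: ler_dist_max.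
- apply: (@le_trans _ _ (\int[m1]_x (eps ^+ 2 / 9 * (S x * (1 + enorm (Y x)) ^+ 2))%:E)%E).
    apply: ge0_le_integral_fin => x; first by rewrite mulr_ge0 ?sqr_ge0.
    rewrite [leRHS]mulrCA; apply: ler_wpM2l => //.
    rewrite (_ : eps ^+ 2 / 9 = (eps / 3) ^+ 2); last by field.
    rewrite -exprMn -(real_normK (num_real (_ - _))) ler_pXn2r ?nnegrE //.
      by rewrite p3 distrC; exact: gh1.
    by rewrite mulr_ge0 ?addr_ge0 ?enorm_ge0 // ltW.
  rewrite ge0_integralZ_fin //; last 2 first.
  + by rewrite divr_ge0 ?sqr_ge0.
  + by move=> x; rewrite mulr_ge0 ?sqr_ge0.
  by rewrite -[leRHS]mule1; apply: lee_wpmul2l; rewrite ?lee_fin ?divr_ge0 ?sqr_ge0.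
- pose dV (z : T1 * Om) := Vaux P T N g f k (f n (Y z.1) z.2) - Vc (f n (Y z.1) z.2).
  have mdV : measurable_fun setT dV by exact: measurable_funB.
  (* Linear growth makes both integrands square integrable, so that the difference of expectations
     is the expectation of [dV]. *)
  have bnd (u : 'cV[R]_D -> R) (c : R) x : 0 <= c ->
      (forall y, `|u y| <= c * (1 + enorm y)) ->
      (\int[P]_w ((u (f n (Y x) w)) ^+ 2)%:E < +oo)%E.
    move=> c0 ub.
    apply: (@le_lt_trans _ _ (\int[P]_w (c ^+ 2 * (1 + enorm (f n (Y x) w)) ^+ 2)%:E)%E).
      apply: ge0_le_integral_fin => w; first exact: sqr_ge0.
      rewrite -exprMn -(real_normK (num_real (u _))) ler_pXn2r ?nnegrE //.
      by rewrite mulr_ge0 ?addr_ge0 ?enorm_ge0.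
    rewrite ge0_integralZ_fin ?sqr_ge0 //; last 2 first.
    + by move=> w; exact: sqr_ge0.
    + exact: men.
    apply: le_lt_trans (lee_wpmul2l _ (sd_f_sq sd (Y x) nN)) _.
      by rewrite lee_fin sqr_ge0.
    by rewrite -EFinM ltry.
  have RVC x : RV x - RC x = Rintegral P setT (fun w => dV (x, w)).
    rewrite /RV /RC /dV RintegralB //=.
    + have := @sq_integrable _ _ _ P (fun w => Vaux P T N g f k (f n (Y x) w)).
      case=> //; first exact: (measurable_fun_pair2 x mVf).
      apply: (bnd _ Gam); first exact: le_trans G1.
      by move=> y; exact: (Vaux_bound sd _ (ltnW kN)).
    + have := @sq_integrable _ _ _ P (fun w => Vc (f n (Y x) w)).
      case=> //; first exact: (measurable_fun_pair2 x mCf).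
      by apply: (bnd _ (Gam * B)) => //; rewrite mulr_ge0 // (le_trans ler01 G1).
  (* Jensen moves the square inside, Tonelli passes to the product space, and the clipping property
     replaces [Vc] by [V0], whose error the induction hypothesis controls. *)
  apply: (@le_trans _ _ (\int[m1]_x \int[P]_w (S x * (dV (x, w)) ^+ 2)%:E)%E).
    apply: ge0_le_integral_nomeas => x; first by rewrite lee_fin mulr_ge0 ?sqr_ge0.
    have mdx : measurable_fun setT (fun w => dV (x, w)) by exact: measurable_fun_pair2.
    rewrite RVC ge0_integralZ_fin //; last 2 first.
    + by move=> w; exact: sqr_ge0.
    + exact: measurable_funX.
    by rewrite EFinM; apply: lee_wpmul2l; rewrite ?lee_fin //; exact: Rintegral_sq_le.
  rewrite -(@integral_product_subprobability _ _ _ _ _ m1 P (fun z => S z.1 * dV z ^+ 2)); last 2 first.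
  + by apply: measurable_funM; [exact: measurableT_comp|exact: measurable_funX].
  + by move=> z; rewrite mulr_ge0 ?sqr_ge0.
  apply: (@le_trans _ _ (\int[m1']_z (4 * B *
     (S' z * (Vaux P T N g f k (Y' z) - V0 (Y' z)) ^+ 2))%:E)%E).
    apply: ge0_le_integral_fin => z; first by rewrite mulr_ge0 ?sqr_ge0.
    rewrite /S' -(mulrA (4 * B)^-1) mulVKf; last by rewrite gt_eqF ?mulr_gt0.
    apply: ler_wpM2l => //.
    rewrite -(real_normK (num_real (dV z))) -(real_normK (num_real (_ - V0 _))).
    rewrite ler_pXn2r ?nnegrE //; apply: Vca.
    exact: (Vaux_bound sd _ (ltnW kN)).
  rewrite ge0_integralZ_fin //; last 3 first.
  + by lra.
  + by move=> z; rewrite mulr_ge0 ?sqr_ge0.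
  + apply: measurable_funM => //; apply: measurable_funX; apply: measurable_funB => //.
    exact: (net_rep_measurable rV0).
  apply: (@le_trans _ _ ((4 * B)%:E * (dl ^+ 2)%:E)%E).
    by apply: lee_wpmul2l; rewrite ?lee_fin //; lra.
  rewrite -EFinM lee_fin (_ : 4 * B * dl ^+ 2 = eps ^+ 2 / 9 / B); last first.
    by rewrite /dl; field; rewrite gt_eqF.
  by rewrite ler_pdivrMr // ler_peMr ?divr_ge0 ?sqr_ge0 //; lra.
- apply: le_trans Eavg _; rewrite lee_fin.
  have Mr0 : 0 < M%:R :> R by rewrite ltr0n.
  move: vM; rewrite ler_pdivrMr ?exprn_gt0 // => vM.
  rewrite mulrAC ler_pdivrMr //.
  move: vM; move: (4 * _ * _) (eps ^+ 2) => a b; lra.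
Qed.

(** * Random networks of finite size are ReLU networks *)

Section RanNN.
Context {R : realType}.
Implicit Types w : nat -> nat -> R.

Definition layer_count w : \bar R :=
  \esum_(mj in [set: nat * nat]) ((w mj.1 mj.2 != 0)%:R)%:E.

Lemma layer_count_ge w (s : seq (nat * nat)) : uniq s ->
  (((\sum_(mj <- s) (w mj.1 mj.2 != 0%R))%N)%:R%:E <= layer_count w)%E.
Proof.
move=> us; apply: esum_ge; exists [set` s].
  by split => //; exact: finite_seq.
by rewrite -fsbig_seq // natr_sum -sumEFin.
Qed.

(** An infinite support would contain finite sets of any cardinality, against the finite count. For
    a finite support, the sum of all first indices bounds each of them. *)
Lemma layer_count_bounded w : (layer_count w < +oo)%E ->
  exists H, forall m j, (H < m)%N -> w m j = 0.
Proof.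
move=> fin.
have [F|I] := pselect (finite_set [set mj : nat * nat | w mj.1 mj.2 != 0]).
  have /finite_seqP[s E] := F.
  exists (\sum_(mj <- s) mj.1)%N => m j Hm; apply/eqP/negPn/negP => nz.
  have : [set` s] (m, j) by rewrite -E.
  move=> /= ms; move: Hm; rewrite (big_rem _ ms) /= ltnNge => /negP; apply.
  exact: leq_addr.
exfalso; have fc : layer_count w \is a fin_num.
  rewrite ge0_fin_numE //; apply: esum_ge0 => x _; by rewrite lee_fin.
have [M [_ M1 _]] := exists_nat_approx (@normr_ge0 _ _ (fine (layer_count w))).
have [Bs BI cB] := infinite_set_fset M.+1 I.
have := layer_count_ge w (finmap.fset_uniq Bs).
rewrite -(fineK fc) lee_fin => le1.
have : (M.+1)%:R <= M%:R :> R; last by rewrite ler_nat ltnn.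
apply: le_trans (le_trans (ler_norm _) M1); apply: le_trans le1; rewrite ler_nat.
apply: leq_trans cB _; rewrite -sum1_size big_seq [leqRHS]big_seq.
by apply: leq_sum => mj mjB; have /= -> := BI mj mjB.
Qed.

Definition layer_mx a b w : 'M[R]_(b, a) := \matrix_(j < b, m < a) w m.+1 j.
Definition layer_bias b w : 'cV[R]_b := \col_(j < b) w 0%N j.

(** Bias and matrix are the disjoint windows m = 0 and 1 <= m <= a of one array, so together they
    count a part of its entries. *)
Lemma layer_nnz a b w :
  ((nnz_mx (layer_mx a b w) + nnz_mx (layer_bias b w))%N%:R%:E <= layer_count w)%E.
Proof.
pose s := [seq (m, j) | m <- iota 0 a.+1, j <- iota 0 b].
have us : uniq s by apply: allpairs_uniq; rewrite ?iota_uniq // => -[? ?] [? ?].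
apply: le_trans (layer_count_ge w us); rewrite lee_fin ler_nat /s.
rewrite big_allpairs /= big_cons addnC leq_eqVlt; apply/orP; left; apply/eqP.
have E n (G : nat -> nat) : (\sum_(i <- iota 0 n) G i = \sum_(i < n) G i)%N.
  by rewrite -(big_mkord xpredT) /index_iota subn0.
rewrite (iotaDl 1 0 a) big_map !E; congr addn.
  by apply: eq_bigr => j _; rewrite big_ord_recl big_ord0 addn0 mxE.
rewrite /nnz_mx exchange_big; apply: eq_bigr => m _; rewrite /= E.
by apply: eq_bigr => j _; rewrite mxE.
Qed.

Lemma affine_seqE n w (y : nat -> R) j : (forall m, (n < m)%N -> w m j = 0) ->
  affine_seq w y j = w 0%N j + \sum_(m < n) w m.+1 j * y m.
Proof.
move=> w0; congr (_ + _); apply: lim_near_cst; first exact: norm_hausdorff.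
near=> K; have nK : (n.+1 <= K)%N by near: K; exact: nbhs_infty_ge.
rewrite (@big_cat_nat _ _ _ n.+1) //= [X in _ + X]big1_seq; last first.
  by move=> m /andP[_]; rewrite mem_index_iota => /andP[nm _]; rewrite w0 ?mul0r.
by rewrite addr0 big_add1 /= big_mkord.
Unshelve. all: by end_near. Qed.

Lemma layerE a b w (y : nat -> R) : (forall m j, (a < m)%N -> w m j = 0) ->
  layer_mx a b w *m (\col_(m < a) y m) + layer_bias b w =
  \col_(j < b) affine_seq w y j.
Proof.
move=> w0; apply/colP => j; rewrite !mxE (@affine_seqE a); last by move=> m; exact: w0.
by rewrite addrC; congr (_ + _); apply: eq_bigr => m _; rewrite !mxE.
Qed.

Lemma relu_vec_col b (y : nat -> R) :
  relu_vec (\col_(j < b) y j) = \col_(j < b) Num.max (y j) 0.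
Proof. by apply/colP => j; rewrite !mxE. Qed.

(** Finite size leaves finitely many nonzero columns, so one H serves all layers: hidden coordinates
    beyond the first H are never read by the next layer and can be cut. Cutting only drops entries,
    so the size does not grow. *)
Lemma ranNN_relu_net D I (w : nat -> nat -> nat -> R) :
  (forall m j, (D < m)%N -> w 0%N m j = 0) -> (rnn_size I w < +oo)%E ->
  exists phi : @relu_net R D D, [/\ net_depth phi = I,
    ((net_size phi)%:R%:E <= rnn_size I w)%E &
    forall x, net_eval phi x = rnn_eval I w x].
Proof.
move=> w0 fin.
have sizeE : rnn_size I w = (\sum_(0 <= l < I.+1) layer_count (w l))%E.
  by rewrite /rnn_size big_mkord.
have c0 l : (0 <= layer_count (w l))%E by apply: esum_ge0 => x _; rewrite lee_fin.
have cfin l : (l <= I)%N -> (layer_count (w l) < +oo)%E.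
  move=> lI; apply: le_lt_trans fin; rewrite /rnn_size.
  rewrite (bigD1 (Ordinal (n := I.+1) (m := l) lI)) //= leeDl //.
  by apply: sume_ge0 => i _; exact: c0.
have [H wH] : exists H, forall l, (l <= I)%N -> forall m j, (H < m)%N -> w l m j = 0.
  have ex (l : 'I_I.+1) := layer_count_bounded (cfin l (ltn_ord l)).
  have [h Hh] := choice ex.
  exists (\sum_(l < I.+1) h l)%N => l lI m j Hm.
  apply: (Hh (Ordinal (n := I.+1) (m := l) lI)); apply: leq_ltn_trans Hm.
  by rewrite [leqRHS](bigD1 (Ordinal (n := I.+1) (m := l) lI)) //= leq_addr.
(* Induction from the output: [k] counts the hidden layers still to come after layer [i], whose
   activated output feeds [psi]. *)
have tail k i : (k + i.+1)%N = I -> exists psi : @relu_net R H D,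
   [/\ net_depth psi = k,
       ((net_size psi)%:R%:E <= \sum_(i.+1 <= l < I.+1) layer_count (w l))%E &
       forall y, net_eval psi (\col_(j < H) Num.max (rnn_hidden w y i j) 0) =
         \col_(j < D) rnn_hidden w y I j].
  elim: k i => [|k IH] i kI.
    exists (NLast (layer_mx H D (w i.+1)) (layer_bias D (w i.+1))); split => //.
      by rewrite -kI add0n big_nat1; exact: layer_nnz.
    move=> y /=; rewrite (layerE _ (fun k => Num.max (rnn_hidden w y i k) 0)); last by apply: wH; rewrite -kI.
    by rewrite -kI.
  have [psi [d s e]] := IH i.+1 ltac:(by rewrite addnS).
  exists (NCons (layer_mx H H (w i.+1)) (layer_bias H (w i.+1)) psi); split => /=.
  - by rewrite d.
  - rewrite natrD EFinD big_ltn; last by rewrite ltnS -kI; lia.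
    by apply: leeD => //; exact: layer_nnz.
  - move=> y; rewrite (layerE _ (fun k => Num.max (rnn_hidden w y i k) 0)); last by apply: wH; lia.
    by rewrite relu_vec_col -e.
have xE (x : 'cV[R]_D) : \col_(m < D) vec_to_seq x m = x.
  apply/colP => m; rewrite mxE /vec_to_seq insubT //= => lt.
  by congr (x _ 0); exact: val_inj.
case: I fin sizeE cfin wH tail => [|I] fin sizeE cfin wH tail.
  exists (NLast (layer_mx D D (w 0%N)) (layer_bias D (w 0%N))); split => //=.
    by rewrite sizeE big_nat1; exact: layer_nnz.
  by move=> x; rewrite -[in LHS](xE x) layerE.
have [psi [d s e]] := tail I 0%N ltac:(by rewrite addn1).
exists (NCons (layer_mx D H (w 0%N)) (layer_bias H (w 0%N)) psi); split => /=.
- by rewrite d.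
- rewrite sizeE natrD EFinD big_ltn //.
  by apply: leeD => //; exact: layer_nnz.
- by move=> x; rewrite -[in LHS](xE x) layerE // relu_vec_col e.
Qed.

Lemma rnn_size_ge0 I (w : nat -> nat -> nat -> R) : (0 <= rnn_size I w)%E.
Proof. by apply: sume_ge0 => i _; apply: esum_ge0 => x _; rewrite lee_fin. Qed.

(** The sum over pairs becomes an iterated series of indicators of measurable events. *)
Lemma rnn_size_measurable d (Om : measurableType d) I
    (mu : Om -> nat -> nat -> nat -> R) :
  (forall i m j, measurable_fun setT (fun o => mu o i m j)) ->
  measurable_fun setT (fun o => rnn_size I (mu o)).
Proof.
move=> mm; apply: emeasurable_sum => i.
rewrite (_ : (fun o => _) = (fun o =>
  \sum_(m <oo) \sum_(j <oo) ((mu o i m j != 0)%:R)%:E)%E); last first.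
  apply/funext => o.
  rewrite (_ : [set: nat * nat] = [set: nat] `*`` (fun=> [set: nat])); last first.
    by apply/seteqP; split.
  rewrite -(@esum_esum R _ _ _ _ (fun m j => ((mu o i m j != 0)%:R)%:E)); last first.
    by move=> *; rewrite lee_fin.
  rewrite nneseries_esum; last by move=> m _; apply: nneseries_ge0 => j _ _; rewrite lee_fin.
  rewrite (_ : [set x | _] = setT); last by apply/seteqP; split.
  apply: eq_esum => m _; rewrite nneseries_esum; last by move=> j _; rewrite lee_fin.
  by congr esum; apply/seteqP; split.
apply: ge0_emeasurable_sum => [m o _ _|m _].
  by apply: nneseries_ge0 => j _ _; rewrite lee_fin.
apply: ge0_emeasurable_sum => [j o _ _|j _]; first by rewrite lee_fin.
apply/measurable_EFinP.
have mb : measurable_fun setT (fun o => mu o i m j != 0).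
  apply: (measurable_fun_bool true).
  rewrite setTI (_ : _ @^-1` _ = (fun o => mu o i m j) @^-1` (~` [set 0])).
    by rewrite -[X in measurable X]setTI; apply: mm => //; exact: measurableC.
  apply/seteqP; split => o /=; first by move=> h /eqP; apply/negP; exact: h.
  by move=> /eqP.
exact: (measurableT_comp (f := fun b : bool => b%:R : R) _ mb).
Qed.

End RanNN.

(** * Even moments from Gaussian interval probabilities *)

Section GaussianMoments.
Context {R : realType}.

(** On the interval the density is at most its peak times exp(-k^2 / 2), and peak times length s is
    at most 1. *)
Lemma normal_prob_itv_le (s a b : R) (k : nat) : 0 < s -> b - a = s ->
  (forall x, a < x <= b -> k%:R * s <= `|x|) ->
  (normal_prob 0 s `]a, b] <= (expR (- (k%:R ^+ 2 / 2)))%:E)%E.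
Proof.
move=> s0 bas Hx; rewrite /normal_prob.
apply: (@le_trans _ _ (\int[lebesgue_measure]_(x in `]a, b])
   (cst (normal_peak s * expR (- (k%:R ^+ 2 / 2)))%:E x))%E).
  apply: ge0_le_integral => //.
  - by move=> x _; rewrite lee_fin normal_pdf_ge0.
  - by apply/measurable_EFinP; apply: measurable_funTS; exact: measurable_normal_pdf.
  - move=> x /=; rewrite in_itv /= => /Hx kx.
    rewrite lee_fin normal_pdfE ?gt_eqF //; apply: ler_wpM2l; first exact: normal_peak_ge0.
    rewrite /normal_fun ler_expR subr0 mulNr lerN2 -(real_normK (num_real x)).
    rewrite ler_pdivlMr ?mulrn_wgt0 ?exprn_gt0 //.
    rewrite (_ : _ / 2 * _ = (k%:R * s) ^+ 2); last by rewrite -mulr_natr exprMn; field.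
    by rewrite ler_pXn2r ?nnegrE // mulr_ge0 // ltW.
rewrite integral_cst //= lebesgue_measure_itv /= lte_fin -subr_gt0 bas s0.
rewrite -EFinB bas -EFinM lee_fin mulrAC ler_piMl ?expR_ge0 //.
rewrite /normal_peak mulrC ler_pdivrMr; last first.
  by rewrite sqrtr_gt0 mulrn_wgt0 // mulr_gt0 ?pi_gt0 // exprn_gt0.
rewrite mul1r -[leLHS](ger0_norm (ltW s0)) -sqrtr_sqr ler_wsqrtr //.
rewrite -mulrnAr ler_peMr ?sqr_ge0 //.
by have := @pi_ge2 R; rewrite mulr2n; lra.
Qed.

(** Combines (k + 1)^(2 m) <= (2 m)! e^(k + 1), then k + 1 - k^2 / 2 <= 3 - k, which is (k - 2)^2 >=
    0, and e^(-k) <= 2^(-k). The result is a summable geometric term. *)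
Lemma gauss_series_term (m k : nat) (s : R) : 0 < s ->
  (k.+1%:R * s) ^+ (2 * m) * (2 * expR (- (k%:R ^+ 2 / 2))) <=
  (4 * ((2 * m)`!)%:R * expR 3 * s ^+ (2 * m)) / (2 ^ k.+1)%:R.
Proof.
move=> s0.
have e2 : 2 <= expR 1 :> R by have := @expR_ge1Dx R 1; lra.
have ek : expR (- k%:R) <= (2 ^+ k)^-1 :> R.
  rewrite expRN lef_pV2 ?posrE ?exprn_gt0 ?expR_gt0 //.
  by rewrite -[k%:R]mulr1 expRM_natl; apply: lerXn2r; rewrite ?nnegrE ?expR_ge0.
have fk : (k.+1%:R) ^+ (2 * m) <= ((2 * m)`!)%:R * expR (k.+1%:R) :> R.
  case: (2 * m)%N => [|j].
    by rewrite expr0 fact0 mul1r -expR0 ler_expR.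
  rewrite mulrC -ler_pdivrMr ?ltr0n ?fact_gt0 //.
  by have := @expR_ge1Dxn R k.+1%:R j (ler0n _ _); lra.
have ee : expR k.+1%:R * expR (- (k%:R ^+ 2 / 2)) <= expR 3 * expR (- k%:R) :> R.
  rewrite -!expRD ler_expR -natr1; have := sqr_ge0 (k%:R - 2 : R).
  by rewrite !expr2; lra.
have S0 : 0 <= s ^+ (2 * m) by rewrite exprn_ge0 // ltW.
rewrite exprMn natrX (exprS 2 k) invfM.
have ek2 := expR_ge0 (- (k%:R ^+ 2 / 2)) : 0 <= _ :> R.
have e30 := expR_ge0 3 : 0 <= _ :> R.
apply: (@le_trans _ _ (2 * s ^+ (2 * m) * (((2 * m)`!)%:R *
   (expR k.+1%:R * expR (- (k%:R ^+ 2 / 2)))))).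
  rewrite [leLHS](_ : _ = 2 * s ^+ (2 * m) * (k.+1%:R ^+ (2 * m) * expR (- (k%:R ^+ 2 / 2)))); last by ring.
  by apply: ler_wpM2l; [exact: mulr_ge0|rewrite mulrA; exact: ler_wpM2r].
rewrite [leRHS](_ : _ = 2 * s ^+ (2 * m) * (((2 * m)`!)%:R * (expR 3 * (2 ^+ k)^-1))); last first.
  by field; rewrite expf_neq0.
apply: ler_wpM2l; first exact: mulr_ge0.
apply: ler_wpM2l => //; apply: le_trans ee _.
exact: ler_wpM2l.
Qed.

Context d (Om : measurableType d) (P : probability Om R).

(** The line is cut into slices of length s; on the k-th pair of slices the power is at most ((k +
    1) s)^(2 m), and the series of these bounds is geometric. *)
Lemma gauss_moment (U : Om -> R) (s : R) (m : nat) : measurable_fun setT U -> 0 < s ->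
  (forall a b : R, a < b -> (P [set w | (a < U w <= b)%R] <= normal_prob 0 s `]a, b])%E) ->
  (\int[P]_w ((U w) ^+ (2 * m))%:E <=
    (4 * ((2 * m)`!)%:R * expR 3 * s ^+ (2 * m))%:E)%E.
Proof.
move=> mU s0 HU.
pose Ip k : set Om := [set w | k%:R * s < U w <= k.+1%:R * s].
pose In k : set Om := [set w | - (k.+1%:R * s) < U w <= - (k%:R * s)].
have mI (a b : R) : measurable [set w | a < U w <= b].
  rewrite (_ : [set w | _] = U @^-1` `]a, b]%classic); last first.
    by apply/seteqP; split => w /=; rewrite in_itv.
  by rewrite -[X in measurable X]setTI; exact: mU.
have ksE k : k.+1%:R * s - k%:R * s = s by rewrite -natr1; ring.
have klt k : k%:R * s < k.+1%:R * s by rewrite ltr_pM2r // ltr_nat.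
have ks0 k : 0 <= k%:R * s by rewrite mulr_ge0 // ltW.
have PIp k : (P (Ip k) <= (expR (- (k%:R ^+ 2 / 2)))%:E)%E.
  apply: le_trans (HU _ _ (klt k)) _; apply: normal_prob_itv_le => // x /andP[x1 _].
  by rewrite (le_trans (ltW x1)) // ler_norm.
have PIn k : (P (In k) <= (expR (- (k%:R ^+ 2 / 2)))%:E)%E.
  apply: le_trans (HU _ _ _) _; first by rewrite ltrN2.
  apply: normal_prob_itv_le => //; first by rewrite opprK addrC.
  by move=> x /andP[_ x1]; rewrite -normrN (le_trans _ (ler_norm _)) // lerNr.
pose c k := (k.+1%:R * s) ^+ (2 * m).
have c0 k : 0 <= c k by rewrite exprn_ge0.
pose G k w : \bar R := (c k * (\1_(Ip k) w + \1_(In k) w))%:E.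
have G0 k w : (0 <= G k w)%E.
  by rewrite lee_fin mulr_ge0 // addr_ge0 // indicE.
apply: (@le_trans _ _ (\int[P]_w (\sum_(k <oo) G k w))%E).
  apply: ge0_le_integral_nomeas => w.
    by rewrite lee_fin exprM exprn_ge0 // sqr_ge0.
  (* Slices are open on the left: for U <= 0 the index is the integer part of -U / s, for U > 0 it
     is one less than the least n with U <= n s. *)
  have [k hk] : exists k : nat, (U w <= 0 -> In k w) /\ (0 < U w -> Ip k w).
    have [u0|u0] := lerP (U w) 0.
      have q0 : 0 <= - U w / s by rewrite divr_ge0 ?oppr_ge0 // ltW.
      exists (Num.truncn (- U w / s)); split => // _.
      have := truncn_le (- U w / s); have := truncnS_gt (- U w / s).
      rewrite q0 ler_pdivlMr // ltr_pdivrMr // => h1 h2.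
      by rewrite /In /= ltrNl h1 /= lerNr h2.
    have ex : exists n : nat, U w <= n%:R * s.
      have [n [_ n1 _]] := exists_nat_approx (ltW (divr_gt0 u0 s0)).
      by exists n; rewrite -ler_pdivrMr.
    have [n0 n1 n2] := ex_minnP ex.
    case: n0 n1 n2 => [|n0] n1 n2; first by move: n1; rewrite mul0r leNgt u0.
    exists n0; split => // _; rewrite /Ip /= n1 andbT ltNge; apply/negP => h.
    by have := n2 _ h; rewrite ltnn.
  apply: (@le_trans _ _ (G k w)).
    rewrite /G lee_fin -[leLHS]mulr1; apply: ler_pM => //.
    - by rewrite exprM exprn_ge0 // sqr_ge0.
    - rewrite /c exprM [leRHS]exprM; apply: lerXn2r; rewrite ?nnegrE ?sqr_ge0 //.
      rewrite -(real_normK (num_real (U w))) ler_pXn2r ?nnegrE ?ks0 //.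
      have [u0|u0] := lerP (U w) 0.
        by have /andP[h _] := hk.1 u0; rewrite ler0_norm // lerNl ltW.
      by have /andP[_ h] := hk.2 u0; rewrite gtr0_norm.
    - rewrite !indicE; have [u0|u0] := lerP (U w) 0.
        by rewrite (mem_set (hk.1 u0)) lerDr.
      by rewrite (mem_set (hk.2 u0)) lerDl.
  rewrite (@nneseriesD1 _ (fun i => G i w) k xpredT) //.
  by rewrite leeDl //; apply: nneseries_ge0 => i _ _; exact: G0.
have mG k : measurable_fun setT (G k).
  apply/measurable_EFinP; apply: measurable_funM; first exact: measurable_cst.
  by apply: measurable_funD; apply: measurable_indic; exact: mI.
rewrite integral_nneseries //.
apply: (@le_trans _ _ (\sum_(k <oo)
   ((4 * ((2 * m)`!)%:R * expR 3 * s ^+ (2 * m)) / (2 ^ k.+1)%:R)%:E)%E).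
  apply: lee_nneseries => k _; first by move=> _; exact: integral_ge0.
  apply: (@le_trans _ _ (((c k) * (2 * expR (- (k%:R ^+ 2 / 2))))%:E)); last first.
    by rewrite lee_fin; exact: gauss_series_term.
  rewrite /G ge0_integralZ_fin //; last first.
    by apply: measurable_funD; apply: measurable_indic; exact: mI.
  rewrite EFinM; apply: lee_wpmul2l; rewrite ?lee_fin //.
  rewrite ge0_integralD_fin //; try (by move=> w; rewrite indicE); try by apply: measurable_indic; exact: mI.
  rewrite !integral_indic ?setIT //; [|exact: mI|exact: mI].
  apply: le_trans (leeD (PIp k) (PIn k)) _; rewrite -EFinD lee_fin.
  by move: (expR _) => e; lra.
apply: epsilon_trick0.
by rewrite !mulr_ge0 ?expR_ge0 ?exprn_ge0 // ltW.
Qed.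

(** The law is given on full boxes. The slab is the increasing limit of boxes with other sides ]-K,
    K], whose factors are at most 1. *)
Lemma box_marginal_le D (U : Om -> 'cV[R]_D) (s : R) (i : 'I_D) (a b : R) :
  (forall j, measurable_fun setT (fun w => U w j 0)) ->
  (forall a b : 'cV[R]_D, P [set w | forall j, a j 0 < U w j 0 <= b j 0] =
     (\prod_(j < D) normal_prob 0%R s `]a j ord0, b j ord0])%E) ->
  (P [set w | (a < U w i 0 <= b)%R] <= normal_prob 0 s `]a, b])%E.
Proof.
move=> mU HU.
pose aK (K : nat) : 'cV[R]_D := \col_j if j == i then a else - K%:R.
pose bK (K : nat) : 'cV[R]_D := \col_j if j == i then b else K%:R.
pose A K : set Om := [set w | forall j, aK K j 0 < U w j 0 <= bK K j 0].
have mA K : measurable (A K).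
  rewrite (_ : A K = \big[setI/setT]_(j < D) ((fun w => U w j 0) @^-1` `]aK K j 0, bK K j 0]%classic)).
    apply: bigsetI_measurable => j _.
    by rewrite -[X in measurable X]setTI; exact: mU.
  rewrite -bigcap_seq; apply/seteqP; split=> w /=.
    by move=> H j _ /=; rewrite in_itv; exact: H.
  move=> H j; have := H j; rewrite /= in_itv /=; apply.
  by rewrite mem_index_enum.
have ndA : nondecreasing_seq A.
  move=> m n mn; apply/subsetPset => w Aw j; move: (Aw j); rewrite !mxE.
  case: ifP => // _ /andP[h1 h2]; have mn' : m%:R <= n%:R :> R by rewrite ler_nat.
  by apply/andP; split; [apply: le_lt_trans h1; rewrite lerN2|exact: le_trans mn'].
have UA : \bigcup_K A K = [set w | a < U w i 0 <= b].
  apply/seteqP; split => w /=.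
    by move=> [K _ Aw]; have := Aw i; rewrite !mxE eqxx.
  move=> h; have [M [_ HM _]] := exists_nat_approx (enorm_ge0 (U w)).
  exists M.+1 => // j; rewrite !mxE; case: ifPn => [/eqP -> //|_].
  have := ler_coord_enorm (U w) j; rewrite ler_norml -natr1 => /andP[h1 h2].
  by apply/andP; split; lra.
rewrite -UA; have mUA : measurable (\bigcup_K A K) by exact: bigcupT_measurable.
have cv := nondecreasing_cvg_mu (mu := P) mA mUA ndA.
rewrite -(cvg_lim _ cv) //; apply: lime_le; first by apply/cvg_ex; eexists; exact: cv.
apply: nearW => K /=; rewrite HU (bigD1 i) //= !mxE eqxx.
rewrite -[leRHS]mule1; apply: lee_wpmul2l; first exact: measure_ge0.
suff /andP[] : (0 <= \prod_(j < D | j != i) normal_prob 0 s `]aK K j ord0, bK K j ord0] <= 1)%E by [].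
apply: (big_ind (fun x => 0 <= x <= 1)%E) => [|x y /andP[x0 x1] /andP[y0 y1]|j _].
- by rewrite lee01 lexx.
- by rewrite mule_ge0 // -[leRHS]mule1 lee_pmul.
- by rewrite measure_ge0 /=; apply: probability_le1.
Qed.

End GaussianMoments.

(** * Independence for integrals *)

Section IndependentIntegral.
Context d (Om : measurableType d) (R : realType) (P : probability Om R).

Lemma ge0_integral_mrestr (A : set Om) (mA : measurable A) (h : Om -> \bar R) :
  measurable_fun setT h -> (forall w, 0 <= h w)%E ->
  (\int[mrestr P mA]_w h w = \int[P]_(w in A) h w)%E.
Proof.
move=> mh h0.
rewrite (@ge0_negligible_integral _ _ _ (mrestr P mA) setT (~` A)) //; last 2 first.
- exact: measurableC.
- by rewrite /= /mrestr setICl measure0.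
rewrite setTD setCK; apply: eq_measure_integral => B mB BA.
by rewrite /= /mrestr setIidl.
Qed.

(** Independence says that two measures on the line agree: the law of |Y| under [P] restricted to A,
    and P(A) times its law under [P]. Integrate [h] against both. *)
Lemma indep_integral (G : set (set Om)) D (Y : Om -> 'cV[R]_D) (A : set Om)
    (h : R -> R) :
  indep_of P G Y -> vec_measurable Y -> G A -> measurable A ->
  measurable_fun setT h -> (forall x, 0 <= h x) ->
  (\int[P]_w (\1_A w * h (enorm (Y w)))%:E =
   P A * \int[P]_w (h (enorm (Y w)))%:E)%E.
Proof.
move=> ind mY GA mA mh h0.
have mU : measurable_fun setT (fun w => enorm (Y w)).
  by apply: measurable_enorm => i; exact: vec_measurable_coord.
have mhe : measurable_fun setT (EFin \o h) by exact/measurable_EFinP.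
have mhU : measurable_fun setT (fun w => (h (enorm (Y w)))%:E).
  by apply/measurable_EFinP; exact: measurableT_comp.
transitivity (\int[P]_(w in A) (h (enorm (Y w)))%:E)%E.
  rewrite [RHS]integral_mkcond; apply: eq_integral => w _.
  rewrite patchE indicE; case: ifPn => wA; first by rewrite mul1r.
  by rewrite mul0r.
rewrite -(ge0_integral_mrestr mA) //; last by move=> w; rewrite lee_fin.
have fA : P A \is a fin_num by exact: fin_num_measure.
have pA0 : 0 <= fine (P A) by exact: fine_ge0.
have hp : {in [set: R], forall y, 0 <= (EFin \o h) y}%E by move=> y _; rewrite lee_fin.
have L1 := ge0_integral_pushforward mU (mrestr P mA) measurableT mhe hp.
have L2 := ge0_integral_pushforward mU P measurableT mhe hp.
rewrite preimage_setT in L1; rewrite preimage_setT in L2.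
rewrite -[LHS]L1 -[X in (_ * X)%E]L2 -(fineK fA).
rewrite -[X in (X%:E * _)%E]/((NngNum pA0)%:num) -ge0_integral_mscale //; last first.
  by move=> x _; rewrite lee_fin.
apply: eq_measure_integral => B mB _.
rewrite /= /mscale /pushforward /mrestr /= fineK // setIC.
by apply: (ind A (fun x => B (enorm x)) GA); exact: BorelD_enorm.
Qed.

End IndependentIntegral.

(** * Rounding vectors to a countable grid *)

Section Discretisation.
Context {R : realType} {D : nat}.

(* Rounding goes towards zero, so that it never increases the norm. *)
Definition grid_code (j : nat) (x : 'cV[R]_D) : {ffun 'I_D -> int} :=
  [ffun i => Num.floor (x i 0 * j.+1%:R)].

Definition grid_point (j : nat) (v : {ffun 'I_D -> int}) : 'cV[R]_D :=
  \col_i ((if 0 <= v i then v i else v i + 1)%:~R / j.+1%:R).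

Lemma grid_point_code j (x : 'cV[R]_D) i :
  `|grid_point j (grid_code j x) i 0| <= `|x i 0| /\
  `|grid_point j (grid_code j x) i 0 - x i 0| <= j.+1%:R^-1.
Proof.
rewrite mxE ffunE; set v := Num.floor _.
have /andP[v1 v2] : v%:~R <= x i 0 * j.+1%:R < (v + 1)%:~R.
  by rewrite -floor_eq eqxx.
have J0 : 0 < j.+1%:R :> R by rewrite ltr0n.
have E : x i 0 = x i 0 * j.+1%:R / j.+1%:R by rewrite mulfK ?gt_eqF.
rewrite [X in _ <= `|X|]E [X in _ - X]E.
move: v1 v2; set y := x i 0 * _; rewrite intrD => v1 v2.
have nJ (z : R) : `|z / j.+1%:R| = `|z| / j.+1%:R by rewrite normrM [X in _ * X]gtr0_norm ?invr_gt0.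
rewrite -mulrBl !nJ -[X in _ /\ _ <= X]mul1r !ler_pM2r ?invr_gt0 //.
have [v0|v0] := lerP 0 v.
  have v0' : 0 <= v%:~R :> R by rewrite ler0z.
  have y0 : 0 <= y by lra.
  rewrite (ger0_norm v0') (ger0_norm y0).
  by split => //; rewrite ler_norml; lra.
have v0' : v%:~R + 1 <= 0 :> R.
  by rewrite -[1]/(1%:~R) -intrD lerz0 lezD1.
rewrite intrD; split; last by rewrite ler_norml; lra.
have y0 : y <= 0 by lra.
by rewrite (ler0_norm v0') (ler0_norm y0); lra.
Qed.

Lemma grid_code_set j (v : {ffun 'I_D -> int}) :
  BorelD [set x : 'cV[R]_D | grid_code j x = v].
Proof.
rewrite (_ : [set x | _] = [set x : 'cV[R]_D | forall i,
   `[((v i)%:~R / j.+1%:R), ((v i + 1)%:~R / j.+1%:R)[%classic (x i 0)]).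
  by apply: (BorelD_coords (B := fun i => `[((v i)%:~R / j.+1%:R), ((v i + 1)%:~R / j.+1%:R)[%classic)) => i; exact: measurable_itv.
have J0 : 0 < j.+1%:R :> R by rewrite ltr0n.
apply/seteqP; split => x /=.
  move=> <- i; rewrite in_itv /= ffunE ler_pdivrMr // ltr_pdivlMr //.
  by rewrite -floor_eq eqxx.
move=> H; apply/ffunP => i; rewrite ffunE; apply/eqP; rewrite floor_eq.
by have := H i; rewrite in_itv /= ler_pdivrMr // ltr_pdivlMr.
Qed.

Lemma enorm_le (x y : 'cV[R]_D) : (forall i, `|x i 0| <= `|y i 0|) -> enorm x <= enorm y.
Proof.
move=> H; apply: ler_wsqrtr; apply: ler_sum => i _.
rewrite -(real_normK (num_real (x i 0))) -(real_normK (num_real (y i 0))).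
by rewrite ler_pXn2r ?nnegrE.
Qed.

End Discretisation.

(** * Moments of the next state *)

Section MomentStep.
Context d (Om : measurableType d) (R : realType) (P : probability Om R).
Context {D : nat}.
Variables (G : set (set Om)) (X : Om -> 'cV[R]_D) (f : 'cV[R]_D -> Om -> 'cV[R]_D).
Variables (h : R -> R) (a : R).
Hypotheses (Gm : G `<=` measurable) (GX : vmeasurable_wrt G X).
Hypothesis find : forall x, indep_of P G (f x).
Hypothesis mfx : forall x, vec_measurable (f x).
Hypothesis mf : forall Y : Om -> 'cV[R]_D, vec_measurable Y ->
  vec_measurable (fun w => f (Y w) w).
Hypothesis fnet : {ae P, forall w, exists phi : @relu_net R D D,
  forall x, f x w = net_eval phi x}.
Hypotheses (mh : measurable_fun setT h) (h0 : forall t, 0 <= h t).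
Hypothesis hmono : forall s t, 0 <= s -> s <= t -> h s <= h t.
Hypothesis hcont : forall t, 0 <= t -> {for t, continuous h}.
Hypothesis a0 : 0 <= a.
Hypothesis hf : forall x,
  (\int[P]_w (h (enorm (f x w)))%:E <= (a * h (enorm x))%:E)%E.

Let Z j w : 'cV[R]_D := grid_point j (grid_code j (X w)).

Let E j k : set Om := [set w | pickle (grid_code j (X w)) = k].

(** Numbers that are no code get the value 0; their event [E j k] is empty. *)
Let z j k : 'cV[R]_D :=
  if unpickle k is Some v then grid_point j v else 0.

Let EZ j k w : E j k w -> Z j w = z j k.
Proof. by move=> <-; rewrite /z pickleK. Qed.

Let GE j k : G (E j k).
Proof.
(* [unpickle] may succeed on a k that is not the code of its result, hence the extra test. *)
rewrite (_ : E j k = X @^-1` (if unpickle k is Some v then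
   if pickle (v : {ffun 'I_D -> int}) == k then [set x | grid_code j x = v] else set0
   else set0)).
  apply: GX; case: unpickle => [v|]; last exact: (@sigma_algebra0 _ _).
  case: ifP => _; first exact: grid_code_set.
  exact: (@sigma_algebra0 _ _).
apply/seteqP; split => w /=.
  by move=> Ek; rewrite -Ek pickleK eqxx.
case U : (unpickle k) => [v|//]; case: ifPn => // /eqP vk /= Ev.
by rewrite /E /= Ev.
Qed.

Let mE j k : measurable (E j k). Proof. by apply: Gm; exact: GE. Qed.

Let mX : vec_measurable X. Proof. by move=> B bB; apply: Gm; exact: GX. Qed.

Let mZ j : vec_measurable (Z j).
Proof.
move=> B bB; rewrite (_ : _ @^-1` _ = \bigcup_k (E j k `&` [set w | B (z j k)])).
  apply: bigcupT_measurable => k; apply: measurableI => //.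
  have [b|b] := pselect (B (z j k)).
    by rewrite (_ : [set w | _] = setT) //; apply/seteqP; split.
  by rewrite (_ : [set w | _] = set0) //; apply/seteqP; split.
apply/seteqP; split => w /=.
  move=> b; exists (pickle (grid_code j (X w))) => //; split => //=.
  by rewrite -(EZ (w := w)).
by move=> [k _ [Ek b]]; rewrite (EZ Ek).
Qed.

Let menorm (Y : Om -> 'cV[R]_D) : vec_measurable Y ->
  measurable_fun setT (fun w => h (enorm (Y w))).
Proof.
move=> mY; apply: measurableT_comp => //; apply: measurable_enorm => i.
exact: vec_measurable_coord.
Qed.

Let series_E j (u : nat -> R) w k : E j k w -> (forall i, 0 <= u i) ->
  (\sum_(i <oo) (\1_(E j i) w * u i)%:E = (u k)%:E)%E.
Proof.
move=> Ek u0; rewrite (@nneseriesD1 _ _ k xpredT) //; last first.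
  by move=> i _; rewrite lee_fin mulr_ge0 // indicE.
rewrite eseries0 ?adde0.
  by rewrite indicE mem_set // mul1r.
move=> i _ /= ik; rewrite indicE memNset ?mul0r // => Ei.
by move/eqP: ik; apply; rewrite -Ei -Ek.
Qed.

(** On [E j k] the argument is the constant [z j k] and the event lies in [G], so independence for
    fixed x applies cell by cell. Rounding towards zero and monotonicity of [h] lead back to X. *)
Lemma moment_grid j :
  (\int[P]_w (h (enorm (f (Z j w) w)))%:E <= a%:E * \int[P]_w (h (enorm (X w)))%:E)%E.
Proof.
have e1 w : (h (enorm (f (Z j w) w)))%:E =
   (\sum_(k <oo) (\1_(E j k) w * h (enorm (f (z j k) w)))%:E)%E.
  rewrite (@series_E j (fun k => h (enorm (f (z j k) w))) w (pickle (grid_code j (X w)))) //.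
  by rewrite -(EZ (w := w)).
under eq_integral => w _ do rewrite e1.
rewrite integral_nneseries //; last 2 first.
- move=> k; apply/measurable_EFinP; apply: measurable_funM; last exact: menorm.
  exact: measurable_indic.
- by move=> k w _; rewrite lee_fin mulr_ge0 // indicE.
apply: (@le_trans _ _ (\sum_(k <oo) (a%:E *
   \int[P]_w (\1_(E j k) w * h (enorm (z j k)))%:E))%E).
  apply: lee_nneseries => k _.
    by move=> _; apply: integral_ge0 => w _; rewrite lee_fin mulr_ge0 // indicE.
  rewrite (indep_integral (find (z j k)) (mfx _) (GE j k)) //.
  have -> : (\int[P]_w (\1_(E j k) w * h (enorm (z j k)))%:E =
      (h (enorm (z j k)))%:E * P (E j k))%E.
    under eq_integral => w _ do rewrite mulrC.
    by rewrite ge0_integralZ_fin // integral_indic // setIT.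
  by rewrite muleA -EFinM muleC; apply: lee_wpmul2r.
rewrite nneseriesZl; last first.
  by move=> k _; apply: integral_ge0 => w _; rewrite lee_fin mulr_ge0 // indicE.
apply: lee_wpmul2l; rewrite ?lee_fin //.
rewrite -integral_nneseries //; last 2 first.
- move=> k; apply/measurable_EFinP; apply: measurable_funM; first exact: measurable_indic.
  exact: measurable_cst.
- by move=> k w _; rewrite lee_fin mulr_ge0 // indicE.
apply: ge0_le_integral_nomeas => w.
  by apply: nneseries_ge0 => k _ _; rewrite lee_fin mulr_ge0 // indicE.
rewrite (@series_E j (fun k => h (enorm (z j k))) w (pickle (grid_code j (X w)))) //.
rewrite lee_fin -(EZ (w := w)) //; apply: hmono; first exact: enorm_ge0.
by apply: enorm_le => i; have [] := grid_point_code j (X w) i.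
Qed.

(** As the grid is refined, [Z j] tends to X, and f(., w) is continuous for almost every w, being a
    network. Fatou carries the uniform bound of [moment_grid] to the limit. *)
Lemma moment_step :
  (\int[P]_w (h (enorm (f (X w) w)))%:E <= a%:E * \int[P]_w (h (enorm (X w)))%:E)%E.
Proof.
pose F j w := (h (enorm (f (Z j w) w)))%:E.
have mF j : measurable_fun setT (F j).
  by apply/measurable_EFinP; apply: menorm; exact: mf.
have F0 j w : setT w -> (0 <= F j w)%E by move=> _; rewrite lee_fin.
apply: (@le_trans _ _ (\int[P]_w limn_einf (F^~ w))%E).
  apply: ae_ge0_le_integral => //.
  - by move=> w _; rewrite lee_fin.
  - by apply/measurable_EFinP; apply: menorm; exact: mf.
  - move=> w _; rewrite limn_einf_lim; apply: lime_ge; first exact: is_cvg_einfs.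
    by apply: nearW => n; apply: le_ereal_inf_tmp => _ [m /= nm <-]; exact: F0.
  - rewrite (_ : (fun w => _) = (fun w => - limn_esup (fun n => - F n w))%E).
      apply: (@measurableT_comp _ _ _ _ _ _ (-%E : \bar R -> \bar R)).
        exact: oppe_measurable.
      by apply: measurable_fun_limn_esup => n; apply: measurableT_comp => //; exact: oppe_measurable.
    apply/funext => w; rewrite -limn_einfN; congr limn_einf.
    by apply/funext => n; rewrite /comp oppeK.
  apply: filterS fnet => w [phi phiE] _.
  suff cv : F^~ w @ \oo --> (h (enorm (f (X w) w)))%:E.
    rewrite is_cvg_limn_einfE; last by apply/cvg_ex; eexists; exact: cv.
    by rewrite (cvg_lim _ cv).
  apply: cvg_EFin; first by apply: nearW.
  apply: (cvg_comp (fun j => enorm (f (Z j w) w)) h); last exact: (hcont (enorm_ge0 _)).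
  apply: (cvg_comp (fun j => \sum_i f (Z j w) w i 0 ^+ 2) (@Num.sqrt R));
    last exact: sqrt_continuous.
  apply: (cvg_big (@add_continuous _)) => i _.
  have cvi : (fun j => f (Z j w) w i 0) @ \oo --> f (X w) w i 0.
    rewrite phiE; under eq_fun do rewrite phiE.
    apply: net_eval_cvg => i'; apply/cvgrPdist_le => e e0.
    near=> n; have [_ dist] := grid_point_code n (X w) i'.
    rewrite distrC; apply: le_trans dist _.
    rewrite invf_ple ?posrE //; apply: (@le_trans _ _ n%:R); last by rewrite ler_nat.
    by near: n; exact: nbhs_infty_ger.
  by under eq_fun do rewrite expr2; rewrite expr2; apply: cvgM.
apply: le_trans (fatou P measurableT mF F0) _.
rewrite limn_einf_lim; apply: lime_le; first exact: is_cvg_einfs.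
apply: nearW => n; apply: le_trans (moment_grid n).
by apply: ereal_inf_lbound; exists n => /=.
Unshelve. all: by end_near. Qed.

End MomentStep.

(** * Inequalities for real powers *)

Section PowerEstimates.
Context {R : realType}.
Implicit Types p t z A : R.

Lemma sq_le_powR p t : 2 <= p -> 0 <= t -> t ^+ 2 <= 1 + t `^ p.
Proof.
move=> p2 t0; have [t1|t1] := lerP t 1.
  by rewrite -[leLHS]addr0 lerD ?powR_ge0 // exprn_ile1.
rewrite -(powR_mulrn 2 t0) -[leLHS]add0r lerD //.
by apply: ler_powR => //; exact: ltW.
Qed.

Lemma powR_1D_le p t : 0 <= p -> 0 <= t -> (1 + t) `^ p <= 2 `^ p * (1 + t `^ p).
Proof.
move=> p0 t0.
have mono x y : 0 <= x -> x <= y -> x `^ p <= y `^ p.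
  by move=> x0 xy; apply: ge0_ler_powR; rewrite ?nnegrE // (le_trans x0).
have [t1|t1] := lerP t 1.
  apply: (@le_trans _ _ (2 `^ p)); first by apply: mono; lra.
  by rewrite ler_peMr ?powR_ge0 // lerDl powR_ge0.
apply: (@le_trans _ _ ((2 * t) `^ p)); first by apply: mono; lra.
by rewrite powRM // ler_wpM2l ?powR_ge0 // lerDr.
Qed.

(** If z <= A^(p - 2), then z A^2 <= A^p. Otherwise z >= 1 and A <= z^(1 / (p - 2)), so z A^2 <=
    z^(p / (p - 2)) <= z^m. *)
Lemma weighted_sq_le p z A (m : nat) : 2 < p -> 1 <= A -> 0 <= z ->
  p <= m%:R * (p - 2) -> z * A ^+ 2 <= A `^ p + 1 + z ^+ m.
Proof.
move=> p2 A1 z0 mp; have A0 : 0 <= A by lra.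
have p20 : 0 < p - 2 by lra.
have split2 : A `^ p = A `^ (p - 2) * A ^+ 2.
  rewrite -(powR_mulrn 2 A0) -powRD; first by congr (_ `^ _); ring.
  by apply/implyP => _; rewrite gt_eqF //; lra.
have zm0 : 0 <= z ^+ m by rewrite exprn_ge0.
have [zA|zA] := lerP z (A `^ (p - 2)).
  rewrite -addrA -[leLHS]addr0 split2; apply: lerD; last by lra.
  by apply: ler_wpM2r => //; exact: sqr_ge0.
have z1 : 1 <= z.
  apply: le_trans (ltW zA); rewrite -[leLHS](powRr0 A); apply: ler_powR => //; exact: ltW.
apply: (@le_trans _ _ (z ^+ m)); last by rewrite lerDr addr_ge0 ?powR_ge0.
have Az : A <= z `^ ((p - 2)^-1).
  have -> : A = (A `^ (p - 2)) `^ ((p - 2)^-1).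
    by rewrite -powRrM mulfV ?powRr1 // gt_eqF.
  apply: ge0_ler_powR; rewrite ?nnegrE ?powR_ge0 //; last exact: ltW.
  by rewrite invr_ge0 ltW.
have A2z : A ^+ 2 <= z `^ (2 / (p - 2)).
  rewrite (mulrC 2) powRrM powR_mulrn ?powR_ge0 //.
  by apply: lerXn2r; rewrite ?nnegrE ?powR_ge0.
apply: (@le_trans _ _ (z `^ (1 + 2 / (p - 2)))).
  rewrite powRD ?powRr1 //; last by apply/implyP => _; rewrite gt_eqF //; lra.
  exact: ler_wpM2l.
rewrite -(powR_mulrn m z0); apply: ler_powR => //.
rewrite -(ler_pM2r p20) mulrDl mul1r divfK ?gt_eqF //.
by apply: le_trans mp; lra.
Qed.

Lemma poweR_root_le (x : \bar R) (y p : R) : 0 < p -> (0 <= x)%E -> 0 <= y ->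
  (x `^ p^-1 <= y%:E)%E -> (x <= (y `^ p)%:E)%E.
Proof.
move=> p0 x0 y0; case: x x0 => [x| |//] x0; last first.
  by rewrite poweRE invr_eq0 gt_eqF // eqxx leye_eq.
rewrite poweR_EFin !lee_fin => h; rewrite lee_fin in x0.
rewrite -(powRr1 x0) -(mulVf (lt0r_neq0 p0)) powRrM.
by apply: ge0_ler_powR; rewrite ?nnegrE ?powR_ge0 // ltW.
Qed.

Lemma powR_1D_continuous p t : 0 <= t -> {for t, continuous (fun u : R => (1 + u) `^ p)}.
Proof.
move=> t0.
have e : \forall u \near t, expR (p * ln (1 + u)) = (1 + u) `^ p.
  near=> u; rewrite /powR gt_eqF //.
  by have : -1 < u; [near: u; apply: lt_nbhsr; lra|lra].
apply: (cvg_trans (near_eq_cvg e)).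
have -> : (1 + t) `^ p = expR (p * ln (1 + t)) by rewrite /powR gt_eqF //; lra.
apply: (cvg_comp (fun u => p * ln (1 + u)) expR); last exact: continuous_expR.
apply: cvgM; first exact: cvg_cst.
apply: (cvg_comp (fun u : R => 1 + u) (@ln R)); last by apply: continuous_ln; lra.
by apply: cvgD; [exact: cvg_cst|exact: cvg_id].
Unshelve. all: by end_near. Qed.

End PowerEstimates.

(** * From the two conditions to stage data, in a fixed dimension *)

Section OneDimension.
Context {R : realType} (T : R) (N : nat).
Context dO (Om : measurableType dO) (P : probability Om R).
Variables (F : R -> set (set Om)) (D : nat) (X : R -> Om -> 'cV[R]_D).
Variables (x0 : 'cV[R]_D) (g : R -> 'cV[R]_D -> R).
Variables (f : nat -> 'cV[R]_D -> Om -> 'cV[R]_D).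
Variables (p c q c' q' r b : R) (p1 r1 : nat).
Hypotheses (T0 : 0 < T) (N0 : (0 < N)%N) (D0 : (0 < D)%N).
Hypothesis Ffil : is_filtration T F.
Hypothesis Xad : forall t, 0 <= t <= T -> vmeasurable_wrt (F t) (X t).
Hypothesis X0 : forall w, X 0 w = x0.
Hypothesis p2 : 2 < p.
Hypotheses (C3 : cond_C3 P T N F X x0 f p c q) (C5 : cond_C5 T N g c' q' r).
Hypotheses (b1 : 1 <= b) (cb : c * D%:R `^ q <= b) (cb' : c' * D%:R `^ q' <= b).
Hypotheses (c0 : 0 < c) (c'0 : 0 < c').
Hypotheses (pp1 : p <= p1%:R) (rr1 : r <= r1%:R).

Lemma tgrid_itv n : (n <= N)%N -> 0 <= tgrid T N n <= T.
Proof.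
move=> nN; have NR : 0 < N%:R :> R by rewrite ltr0n.
rewrite /tgrid; apply/andP; split; first by rewrite divr_ge0 ?mulr_ge0 // ltW.
by rewrite ler_pdivrMr // mulrC ler_wpM2l ?ler_nat // ltW.
Qed.

Lemma filtration_grid_measurable n : (n <= N)%N -> F (tgrid T N n) `<=` measurable.
Proof. by move=> nN; have [_ [+ _]] := Ffil; apply; exact: tgrid_itv. Qed.

Lemma X_measurable n : (n <= N)%N -> vec_measurable (X (tgrid T N n)).
Proof. by move=> nN B bB; apply: (filtration_grid_measurable nN); apply: Xad => //; exact: tgrid_itv. Qed.

Lemma f_joint_measurable n : (n < N)%N -> forall d1 (T1 : measurableType d1)
  (Y : T1 -> 'cV[R]_D), vec_measurable Y ->
  vec_measurable (fun w : T1 * Om => f n (Y w.1) w.2).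
Proof.
move=> nN d1 T1 Y mY; have [_ [+ _]] := C3 => /(_ n nN)[mf _].
exact: vec_measurable_joint (filtration_grid_measurable nN) mf mY.
Qed.

Lemma f_diag_measurable n (Y : Om -> 'cV[R]_D) : (n < N)%N -> vec_measurable Y ->
  vec_measurable (fun w => f n (Y w) w).
Proof.
move=> nN mY B /(f_joint_measurable nN mY) mB.
have := @measurable_fun_pair _ _ _ _ _ _ (@id Om) (@id Om) (@measurable_id _ _ _)
  (@measurable_id _ _ _) measurableT _ mB.
by rewrite setTI.
Qed.

Lemma f_measurable n x : (n < N)%N -> vec_measurable (f n x).
Proof. by move=> nN; exact: (f_diag_measurable nN (@vec_measurable_cst _ _ Om _ x)). Qed.

Let ratio n x w := enorm (f n x w) / (1 + enorm x).

Let x1 (x : 'cV[R]_D) : 1 <= 1 + enorm x. Proof. by rewrite lerDl enorm_ge0. Qed.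

Let x1_ge0 (x : 'cV[R]_D) : 0 <= 1 + enorm x. Proof. exact: le_trans ler01 (x1 x). Qed.

Let ratio_ge0 n x w : 0 <= ratio n x w.
Proof. by rewrite divr_ge0 ?enorm_ge0. Qed.

Let ratioE n x w : enorm (f n x w) = (1 + enorm x) * ratio n x w.
Proof. by rewrite mulrC divfK // gt_eqF // (lt_le_trans ltr01 (x1 x)). Qed.

Let mratio n x : (n < N)%N -> measurable_fun setT (fun w => ratio n x w `^ p).
Proof.
move=> nN; apply: (measurableT_comp (@measurable_powR R p)).
apply: measurable_funM; last exact: measurable_cst.
by apply: measurable_enorm => i; apply: vec_measurable_coord; exact: f_measurable.
Qed.

Let p0 : 0 < p. Proof. by apply: lt_trans p2. Qed.
Let b_ge0 : 0 <= b. Proof. exact: le_trans b1. Qed.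

(** At fixed x the ratio lies below [growthE], so the moment bound of (C3) passes to it by
    monotonicity alone. *)
Lemma ratio_moment n x : (n < N)%N ->
  (\int[P]_w (ratio n x w `^ p)%:E <= (b `^ p)%:E)%E.
Proof.
move=> nN; have [_ [_ [/(_ n nN)[+ _] _]]] := C3.
have I0 : (0 <= \int[P]_w (growthE (fun x => f n x w) `^ p))%E.
  by apply: integral_ge0 => w _; exact: poweR_ge0.
have cD0 : 0 <= c * D%:R `^ q by rewrite mulr_ge0 ?powR_ge0 // ltW.
move=> /(poweR_root_le p0 I0 cD0) h.
apply: (@le_trans _ _ (((c * D%:R `^ q) `^ p)%:E)); last first.
  by rewrite lee_fin; apply: ge0_ler_powR; rewrite ?nnegrE ?(ltW p0) // (le_trans cD0).
apply: le_trans h; apply: ge0_le_integral_nomeas => w; first by rewrite lee_fin powR_ge0.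
have le1 : ((ratio n x w)%:E <= growthE (fun x => f n x w))%E.
  by apply: ereal_sup_ubound; exists x.
rewrite -poweR_EFin; apply: gt0_ler_poweR => //; first exact: ltW.
  by rewrite in_itv /= lee_fin ratio_ge0 leey.
by rewrite in_itv /= leey andbT; apply: le_trans le1; rewrite lee_fin.
Qed.

Let bp : b `^ p <= b ^+ p1.
Proof. by rewrite -powR_mulrn ?(le_trans ler01) //; exact: ler_powR. Qed.

Let bp1 : 1 <= b ^+ p1. Proof. exact: exprn_ege1. Qed.

Let p1_gt0 : (0 < p1)%N.
Proof. by rewrite -(ltr0n R) (lt_le_trans p0 pp1). Qed.

Let b_le : b <= b ^+ p1.
Proof. by case: p1 p1_gt0 => // k _; rewrite exprS ler_peMr ?exprn_ege1 // (le_trans ler01). Qed.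

(** Comes from (1 + |f(x)|)^p <= (1 + |x|)^p 2^p (1 + ratio^p), with 2^p <= 2^p1 and 1 + b^p <= 2
    b^p1. *)
Definition mom_cst : R := 2 * (2 * b) ^+ p1.

Lemma f_moment n x : (n < N)%N ->
  (\int[P]_w ((1 + enorm (f n x w)) `^ p)%:E <= (mom_cst * (1 + enorm x) `^ p)%:E)%E.
Proof.
move=> nN; set s := 1 + enorm x.
have s1 : 1 <= s by exact: x1.
have s0 : 0 <= s by exact: le_trans s1.
apply: (@le_trans _ _ (\int[P]_w (s `^ p * 2 `^ p * (1 + ratio n x w `^ p))%:E)%E).
  apply: ge0_le_integral_fin => w; first exact: powR_ge0.
  rewrite -mulrA; apply: (@le_trans _ _ (s `^ p * (1 + ratio n x w) `^ p)); last first.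
    by rewrite ler_wpM2l ?powR_ge0 // powR_1D_le // ltW.
  rewrite -powRM //; last by rewrite addr_ge0.
  apply: ge0_ler_powR; rewrite ?nnegrE; [exact: ltW p0|by rewrite addr_ge0 ?enorm_ge0|
    by rewrite mulr_ge0 // addr_ge0|].
  by rewrite ratioE mulrDr mulr1 lerD2r.
rewrite ge0_integralZ_fin ?mulr_ge0 ?powR_ge0 //; last 2 first.
- by move=> w; rewrite addr_ge0 ?powR_ge0.
- by apply: measurable_funD; [exact: measurable_cst|exact: mratio].
rewrite ge0_integralD_fin //; last 2 first.
- by move=> w; exact: powR_ge0.
- exact: mratio.
rewrite integral_cst // [X in (_ * X + _)%E]probability_setT mule1.
apply: (@le_trans _ _ ((s `^ p * 2 `^ p)%:E * (1%:E + (b `^ p)%:E))%E).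
  apply: lee_wpmul2l; first by rewrite lee_fin mulr_ge0 ?powR_ge0.
  by apply: leeD2l; exact: ratio_moment.
rewrite -EFinD -EFinM lee_fin [leRHS]mulrC -mulrA; apply: ler_wpM2l; first exact: powR_ge0.
rewrite /mom_cst exprMn mulrCA; apply: ler_pM; rewrite ?powR_ge0 ?addr_ge0 ?powR_ge0 //.
  by rewrite -powR_mulrn //; apply: ler_powR => //; lra.
by have := bp; have := bp1; lra.
Qed.

Lemma f_sq_moment n x : (n < N)%N ->
  (\int[P]_w ((enorm (f n x w)) ^+ 2)%:E <= ((1 + b ^+ p1) * (1 + enorm x) ^+ 2)%:E)%E.
Proof.
move=> nN; set s := 1 + enorm x.
apply: (@le_trans _ _ (\int[P]_w (s ^+ 2 * (1 + ratio n x w `^ p))%:E)%E).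
  apply: ge0_le_integral_fin => w; first exact: sqr_ge0.
  rewrite ratioE exprMn; apply: ler_wpM2l; first exact: sqr_ge0.
  by apply: sq_le_powR; [exact: ltW p2|exact: ratio_ge0].
rewrite ge0_integralZ_fin ?sqr_ge0 //; last 2 first.
- by move=> w; rewrite addr_ge0 ?powR_ge0.
- by apply: measurable_funD; [exact: measurable_cst|exact: mratio].
rewrite ge0_integralD_fin //; last 2 first.
- by move=> w; exact: powR_ge0.
- exact: mratio.
rewrite integral_cst // [X in (_ * X + _)%E]probability_setT mule1.
apply: (@le_trans _ _ ((s ^+ 2)%:E * (1%:E + (b `^ p)%:E))%E).
  apply: lee_wpmul2l; first by rewrite lee_fin sqr_ge0.
  by apply: leeD2l; exact: ratio_moment.
rewrite -EFinD -EFinM lee_fin mulrC; apply: ler_wpM2r; first exact: sqr_ge0.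
by rewrite lerD2l.
Qed.

(** The random size has finite mean, hence is almost surely finite, and there the RanNN is an
    ordinary network; this size is the cost Z. *)
Lemma f_net n : (n < N)%N -> exists (Z : Om -> \bar R) (I : nat),
    [/\ measurable_fun setT Z, (forall w, 0 <= Z w)%E,
        (\int[P]_w Z w <= b%:E)%E, I%:R <= b &
        {ae P, forall w, exists phi : @relu_net R D D,
          [/\ net_depth phi = I, ((net_size phi)%:R%:E <= Z w)%E &
              forall x, f n x w = net_eval phi x]}].
Proof.
move=> nN; have [_ [_ [/(_ n nN)[_ [I [mu [[mmu okmu] [HI [fE Hs]]]]]] _]]] := C3.
have Hs' : (\int[P]_w rnn_size I (mu w) <= b%:E)%E by apply: le_trans Hs _; rewrite lee_fin.
have ms : measurable_fun setT (fun w => rnn_size I (mu w)) by exact: rnn_size_measurable.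
exists (fun w => rnn_size I (mu w)), I; split => //.
- by move=> w; exact: rnn_size_ge0.
- exact: le_trans cb.
have int : P.-integrable setT (fun w => rnn_size I (mu w)).
  apply/integrableP; split => //; apply: le_lt_trans (ltry b).
  apply: le_trans Hs'; rewrite le_eqVlt; apply/orP; left; apply/eqP.
  by apply: eq_integral => w _; rewrite gee0_abs // rnn_size_ge0.
have := integrable_ae measurableT int.
apply: filterS2 fE => w fEw /(_ Logic.I) fin.
have [_ [_ [w0 _]]] := okmu w.
have [|phi [d s e]] := @ranNN_relu_net R D I (mu w) w0.
  by rewrite -ge0_fin_numE // rnn_size_ge0.
by exists phi; split => // x; rewrite fEw e.
Qed.

(** Large enough for every field of [stage_data]: D for the dimension, b^p1 for the second moment,
    and 3 b for the growth of [g]. *)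
Definition stage_cst : R := 3 * D%:R * b ^+ p1.

Lemma stage_data_of_conditions : stage_data P T N g f stage_cst r1.+1.
Proof.
have D1 : 1 <= D%:R :> R by rewrite ler1n.
have Db : D%:R <= D%:R * b ^+ p1 by rewrite ler_peMr.
have bD : b ^+ p1 <= D%:R * b ^+ p1 by rewrite ler_peMl // (le_trans ler01).
have BE : stage_cst = 3 * (D%:R * b ^+ p1) by rewrite /stage_cst mulrA.
split.
- by rewrite BE; have := bp1; lra.
- by rewrite BE; lra.
- move=> n nN e e0 e1.
  have b0 : 0 < b := lt_le_trans ltr01 b1.
  (* Accuracy e / b in (C5) absorbs the factor c' D^q' <= b; in the size bound this factor costs one
     more power, hence [r1.+1]. *)
  have eb0 : 0 < e / b by rewrite divr_gt0.
  have [[gh [h1 [h2 _]]] _] := C5 eb0 nN.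
  exists gh; split => [x|].
    apply: le_trans (h1 x) _; apply: ler_wpM2r; first exact: x1_ge0.
    rewrite -mulrA; apply: (@le_trans _ _ (e / b * b)); last by rewrite divfK // gt_eqF.
    by apply: ler_wpM2l => //; exact: ltW.
  apply: le_trans h2 _.
  have be1 : 1 <= b / e by rewrite ler_pdivlMr // mul1r (le_trans e1).
  have Bt : b / e <= stage_cst / e.
    by apply: ler_wpM2r; [rewrite invr_ge0 ltW|rewrite BE; have := b_le; lra].
  rewrite powRN; have -> : ((e / b) `^ r)^-1 = (b / e) `^ r.
    by rewrite -[b / e]invf_div -(powR_inv1 (ltW eb0)) -powRrM mulN1r powRN.
  rewrite exprS; apply: ler_pM; rewrite ?powR_ge0 ?mulr_ge0 ?powR_ge0 ?(ltW c'0) //.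
    apply: (le_trans cb'); apply: le_trans Bt; rewrite ler_pdivlMr //.
    by rewrite ler_piMr // ltW.
  apply: (@le_trans _ _ ((b / e) `^ r1%:R)); first exact: ler_powR.
  rewrite powR_mulrn ?(le_trans ler01) //; apply: lerXn2r; rewrite ?nnegrE ?(le_trans ler01) //.
  exact: le_trans Bt.
(* Growth of [g] through its network of accuracy 1: compare the two at x and at 0, with the
   Lipschitz bound in between. *)
- move=> n nN x; have [[gh [h1 [_ h3]]] g0] := C5 ltr01 nN.
  have := h1 x; have := h1 0; have := h3 x 0; rewrite subr0 mul1r => a1 a2 a3.
  have e0 : enorm (0 : 'cV[R]_D) = 0.
    by rewrite /enorm big1 ?sqrtr0 // => i _; rewrite mxE expr0n.
  rewrite e0 addr0 mulr1 in a2.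
  have x0' := enorm_ge0 x; have cbx := ler_wpM2r x0' cb'.
  move: a1 a2 a3 g0 cbx; rewrite mulrDr mulr1; set k := c' * _.
  move: (net_fun gh x) (net_fun gh 0) (g _ x) (g _ 0) => u v y z a1 a2 a3 g0 cbx.
  apply: (@le_trans _ _ (3 * b * (1 + enorm x))); last first.
    by apply: ler_wpM2r; [exact: x1_ge0|rewrite BE; have := b_le; lra].
  have tri : `|y| <= `|u - y| + `|u - v| + `|v - z| + `|z|.
    rewrite [X in `|X| <= _](_ : y = - (u - y) + (u - v) + (v - z) + z); last by ring.
    apply: le_trans (ler_normD _ _) _; rewrite lerD2r.
    apply: le_trans (ler_normD _ _) _; rewrite lerD2r.
    by apply: le_trans (ler_normD _ _) _; rewrite lerD2r normrN.
  have be0 : 0 <= b * enorm x by rewrite mulr_ge0.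
  have -> : 3 * b * (1 + enorm x) = 3 * b + 3 * (b * enorm x) by ring.
  have kb : k <= b by [].
  by apply: le_trans tri _; move: (b * enorm x) (k * enorm x) be0 cbx a1 a3 a2 g0 kb => m1 m2;
    move: k `|z| `|v - z| `|u - v| `|u - y| => k' n1 n2 n3 n4; lra.
- exact: f_joint_measurable.
- move=> n nN x; apply: le_trans (f_sq_moment x nN) _.
  rewrite lee_fin; apply: ler_wpM2r; first exact: sqr_ge0.
  by rewrite BE; have := bp1; lra.
- move=> n nN; have [Z [I [h1 h2 h3 h4 h5]]] := f_net nN.
  have bB : b <= stage_cst by rewrite BE; have := b_le; lra.
  exists Z, I; split => //; first by apply: le_trans h3 _; rewrite lee_fin.
  exact: le_trans bB.
Qed.

(** [moment_step] with h(t) = (1 + t)^p, once per grid step; the extra factor in [mom_cst ^+ n.+1]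
    pays for the initial point. *)
Lemma state_moment n : (n <= N)%N ->
  (\int[P]_w ((1 + enorm (X (tgrid T N n) w)) `^ p)%:E <= (mom_cst ^+ n.+1)%:E)%E.
Proof.
have a1 : 1 <= mom_cst.
  rewrite /mom_cst; have : 1 <= (2 * b) ^+ p1; last by lra.
  by rewrite exprn_ege1 //; have := b1; lra.
elim: n => [|n IH] nN.
  rewrite /tgrid !mul0r.
  under eq_integral => w _ do rewrite X0.
  rewrite integral_cst // [X in (_ * X)%E]probability_setT mule1 lee_fin expr1.
  have xb : enorm x0 <= b by have [_ [_ [_ h]]] := C3; exact: le_trans cb.
  apply: (@le_trans _ _ ((2 * b) `^ p)).
    apply: ge0_ler_powR; rewrite ?nnegrE ?(ltW p0) ?addr_ge0 ?enorm_ge0 //; have := b1; lra.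
  apply: (@le_trans _ _ ((2 * b) ^+ p1)).
    by rewrite -powR_mulrn ?mulr_ge0 //; apply: ler_powR => //; have := b1; lra.
  by rewrite /mom_cst ler_peMl // ?exprn_ge0 //; have := b1; lra.
have [_ [/(_ n nN)[_ [Xf [find _]]] _]] := C3.
have menorm (Y : Om -> 'cV[R]_D) : vec_measurable Y ->
    measurable_fun setT (fun w => ((1 + enorm (Y w)) `^ p)%:E).
  move=> mY; apply/measurable_EFinP; apply: (measurableT_comp (@measurable_powR R p)).
  apply: measurable_funD; first exact: measurable_cst.
  by apply: measurable_enorm => i; exact: vec_measurable_coord.
rewrite (@ge0_ae_eq_integral _ _ _ P setT _
   (fun w => ((1 + enorm (f n (X (tgrid T N n) w) w)) `^ p)%:E)) //; last 5 first.
- by apply: menorm; exact: X_measurable.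
- by apply: menorm; apply: f_diag_measurable => //; apply: X_measurable; exact: ltnW.
- by move=> w _; rewrite lee_fin powR_ge0.
- by move=> w _; rewrite lee_fin powR_ge0.
- by apply: filterS Xf => w -> _.
have nN' := ltnW nN.
have [Z [I [_ _ _ _ aenet]]] := f_net nN.
have fnet : {ae P, forall w, exists phi : @relu_net R D D, forall x, f n x w = net_eval phi x}.
  by apply: filterS aenet => w [phi [_ _ h]]; exists phi.
have a0 : 0 <= mom_cst by exact: le_trans a1.
have := @moment_step _ Om R P D (F (tgrid T N n)) (X (tgrid T N n)) (f n)
  (fun t => (1 + t) `^ p) mom_cst (filtration_grid_measurable nN') (Xad (tgrid_itv nN')) find
  (fun x => f_measurable x nN) (fun Y => @f_diag_measurable n Y nN) fnet.
move=> H; apply: le_trans (H _ _ _ _ a0 (fun x => f_moment x nN)) _.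
- apply: (measurableT_comp (@measurable_powR R p)).
  by apply: measurable_funD; [exact: measurable_cst|exact: measurable_id].
- by move=> t; exact: powR_ge0.
- move=> s t s0 st; apply: ge0_ler_powR; rewrite ?nnegrE ?(ltW p0) //; lra.
- by move=> t t0; exact: powR_1D_continuous.
by rewrite (exprS mom_cst n.+1) (EFinM mom_cst); apply: lee_wpmul2l; [rewrite lee_fin|exact: IH].
Qed.

End OneDimension.

(** * The weight given by squared increments of W *)

Section WeightBound.
Context {R : realType} d (Om : measurableType d) (P : probability Om R).

Lemma integral_sum_le (I : finType) (h : I -> Om -> R) (c : R) :
  (forall i, measurable_fun setT (h i)) -> (forall i w, 0 <= h i w) ->
  (forall i, (\int[P]_w (h i w)%:E <= c%:E)%E) ->
  (\int[P]_w (\sum_i h i w)%:E <= (#|I|%:R * c)%:E)%E.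
Proof.
move=> mh h0 hc; under eq_integral => w _ do rewrite -sumEFin.
rewrite ge0_integral_sum //.
- apply: (@le_trans _ _ (\sum_(i : I) c%:E)%E); first exact: lee_sum.
  by rewrite sumEFin lee_fin sumr_const mulr_natl.
- by move=> i; apply/measurable_EFinP.
- by move=> i w _; rewrite lee_fin.
Qed.

(** Per coordinate, u^2 A^2 = dt (u^2 / dt) A^2, and [weighted_sq_le] with z = u^2 / dt separates u
    from A. The Gaussian moment of order 2 m scales like dt^m and cancels dt^(-m), so the bound is
    linear in dt. *)
Lemma increment_weight_le D K (U : 'I_K -> Om -> 'cV[R]_D) (A : Om -> R) (dt p a : R) m :
  0 < dt -> 2 < p -> p <= m%:R * (p - 2) ->
  (forall k i, measurable_fun setT (fun w => U k w i 0)) ->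
  (forall k (a b : 'cV[R]_D), P [set w | forall j, a j 0 < U k w j 0 <= b j 0] =
     (\prod_(j < D) normal_prob 0%R (Num.sqrt dt) `]a j ord0, b j ord0])%E) ->
  measurable_fun setT A -> (forall w, 1 <= A w) ->
  (\int[P]_w ((A w) `^ p)%:E <= a%:E)%E ->
  (\int[P]_w ((\sum_(k < K) enorm (U k w) ^+ 2) * (A w) ^+ 2)%:E <=
    ((K * D)%:R * (dt * (a + 1 + 4 * ((2 * m)`!)%:R * expR 3)))%:E)%E.
Proof.
move=> dt0 p2 pm mU HU mA A1 HA.
pose h (ki : 'I_K * 'I_D) w := U ki.1 w ki.2 0 ^+ 2 * A w ^+ 2.
have -> : (\int[P]_w ((\sum_(k < K) enorm (U k w) ^+ 2) * A w ^+ 2)%:E =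
           \int[P]_w (\sum_ki h ki w)%:E)%E.
  apply: eq_integral => w _; congr EFin; rewrite /h -(pair_big predT predT
    (fun k i => U k w i 0 ^+ 2 * A w ^+ 2)) /= big_distrl.
  by apply: eq_bigr => k _; rewrite enorm_sq big_distrl.
have -> : (K * D)%N = #|{: 'I_K * 'I_D}| by rewrite card_prod !card_ord.
apply: integral_sum_le => [[k i]|[k i] w|[k i]]; rewrite /h /=.
- by apply: measurable_funM; exact: measurable_funX.
- by rewrite mulr_ge0 ?sqr_ge0.
have mAp : measurable_fun setT (fun w => A w `^ p).
  exact: (measurableT_comp (@measurable_powR R p)).
have mU2 : measurable_fun setT (fun w => U k w i 0 ^+ (2 * m)) by exact: measurable_funX.
have U20 w : 0 <= U k w i 0 ^+ (2 * m) by rewrite exprM exprn_ge0 ?sqr_ge0.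
pose C := 4 * ((2 * m)`!)%:R * expR 3 : R.
have idt : 0 <= dt^-1 ^+ m by rewrite exprn_ge0 // invr_ge0 ltW.
apply: (@le_trans _ _ (\int[P]_w (dt * (A w `^ p + 1 +
    dt^-1 ^+ m * U k w i 0 ^+ (2 * m)))%:E)%E).
  apply: ge0_le_integral_fin => w; first by rewrite mulr_ge0 ?sqr_ge0.
  have -> : U k w i 0 ^+ 2 * A w ^+ 2 = dt * ((dt^-1 * U k w i 0 ^+ 2) * A w ^+ 2).
    by rewrite !mulrA divff ?gt_eqF // mul1r.
  apply: ler_wpM2l; first exact: ltW.
  rewrite exprM -exprMn; apply: weighted_sq_le => //.
  by rewrite mulr_ge0 ?sqr_ge0 // invr_ge0 ltW.
rewrite ge0_integralZ_fin; last 3 first.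
- exact: ltW.
- by move=> w; rewrite !addr_ge0 ?powR_ge0 ?mulr_ge0.
- apply: measurable_funD; first by apply: measurable_funD => //; exact: measurable_cst.
  by apply: measurable_funM => //; exact: measurable_cst.
rewrite (EFinM dt); apply: lee_wpmul2l; first by rewrite lee_fin ltW.
rewrite ge0_integralD_fin; last 4 first.
- by move=> w; rewrite addr_ge0 ?powR_ge0.
- by move=> w; rewrite mulr_ge0.
- by apply: measurable_funD => //; exact: measurable_cst.
- by apply: measurable_funM => //; exact: measurable_cst.
rewrite (EFinD (a + 1)); apply: leeD.
  rewrite ge0_integralD_fin //; last by move=> w; rewrite powR_ge0.
  rewrite integral_cst // [X in (_ * X)%E]probability_setT mule1 EFinD.
  exact: leeD2r.
rewrite ge0_integralZ_fin //.
have s0 : 0 < Num.sqrt dt by rewrite sqrtr_gt0.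
have G := gauss_moment m (mU k i) s0 (fun a b _ => box_marginal_le i a b (mU k) (HU k)).
apply: le_trans (lee_wpmul2l _ G) _; first by rewrite lee_fin.
rewrite -EFinM lee_fin exprM sqr_sqrtr ?(ltW dt0) // mulrCA -exprMn mulVf ?gt_eqF //.
by rewrite expr1n mulr1.
Qed.

(** Linearity in the step length makes the N0 increments of length T / (N N0) add up to T / N, so
    the bound is uniform in N0. *)
Lemma increments_second_moment (T : R) (N N0 n D m : nat) (F : R -> set (set Om))
    (W : R -> Om -> 'cV[R]_D) (Y : Om -> 'cV[R]_D) (p a : R) :
  0 < T -> (n < N)%N -> (0 < N0)%N -> 2 < p -> p <= m%:R * (p - 2) ->
  is_filtration T F -> is_F_BM P T F W -> vec_measurable Y ->
  (\int[P]_w ((1 + enorm (Y w)) `^ p)%:E <= a%:E)%E ->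
  let tk k := tgrid T N n + k%:R * (T / (N * N0)%:R) in
  (forall k i, (k <= N0)%N -> measurable_fun setT (fun w => W (tk k) w i 0)) /\
  (\int[P]_w ((\sum_(k < N0) enorm (W (tk k.+1) w - W (tk k) w) ^+ 2) *
       (1 + enorm (Y w)) ^+ 2)%:E <=
    (T / N%:R * D%:R * (a + 1 + 4 * ((2 * m)`!)%:R * expR 3))%:E)%E.
Proof.
move=> T0 nN N00 p2 pm [_ [Fmeas _]] [_ [_ [Wm [_ Wlaw]]]] mY HY tk.
have Np : 0 < N%:R :> R by rewrite ltr0n; exact: leq_ltn_trans nN.
have N0p : 0 < N0%:R :> R by rewrite ltr0n.
pose dt := T / (N * N0)%:R.
have dt0 : 0 < dt by rewrite divr_gt0 // natrM mulr_gt0.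
have tkS k : tk k.+1 - tk k = dt by rewrite /tk -natr1 -/dt; ring.
have tk0 k : 0 <= tk k.
  by rewrite addr_ge0 ?mulr_ge0 ?divr_ge0 ?mulr_ge0 // ltW.
have tkT k : (k <= N0)%N -> tk k <= T.
  move=> kN; have -> : tk k = T * ((n%:R + k%:R / N0%:R) / N%:R).
    by rewrite /tk /tgrid natrM; field; rewrite !gt_eqF.
  rewrite ler_piMr ?(ltW T0) // ler_pdivrMr // mul1r.
  apply: (@le_trans _ _ (n%:R + 1)); last by rewrite natr1 ler_nat.
  by rewrite lerD2l ler_pdivrMr // mul1r ler_nat.
have mW k : (k <= N0)%N -> vec_measurable (W (tk k)).
  move=> kN B bB; apply: (Fmeas (tk k)); first by rewrite tk0 tkT.
  by apply: Wm => //; rewrite tk0 tkT.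
have mWc k i : (k <= N0)%N -> measurable_fun setT (fun w => W (tk k) w i 0).
  by move=> kN; apply: vec_measurable_coord; exact: mW.
split => //.
have -> : T / N%:R * D%:R * (a + 1 + 4 * ((2 * m)`!)%:R * expR 3) =
    (N0 * D)%:R * (dt * (a + 1 + 4 * ((2 * m)`!)%:R * expR 3)).
  by rewrite /dt !natrM; field; rewrite !gt_eqF.
apply: (@increment_weight_le D N0 (fun k w => W (tk k.+1) w - W (tk k) w) _ dt p a m) => //.
- move=> k i; under [X in measurable_fun _ X]eq_fun => w do rewrite !mxE.
  by apply: measurable_funB; apply: mWc => //; exact: ltnW.
- move=> k u v.
  have := Wlaw (tk k) (tk k.+1) (tk0 k) _ (tkT k.+1 (ltn_ord k)) u v.
  rewrite tkS => <-; last by rewrite -subr_gt0 tkS.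
  congr (P _); apply/seteqP; split => w /= H j; move: (H j); rewrite !mxE //.
- apply: measurable_funD; first exact: measurable_cst.
  by apply: measurable_enorm => i; exact: vec_measurable_coord.
- by move=> w; have := enorm_ge0 (Y w); lra.
Qed.

End WeightBound.

Lemma clip_size_poly {R : realType} (C : nat) : exists C' : nat,
  forall (t : R) (L K D : nat),
  2 <= t -> D%:R <= t -> L%:R <= t ^+ C -> K%:R <= t ^+ C ->
  (100 * (100 * (3 * ((2 * 1 + 3) * K.+1 + L.+1 * D.+1 ^ 3).+1)))%:R <= t ^+ C'.
Proof.
eexists => t L K D t2 Dt HL HK.
have hD : D%:R <= t ^+ 1 by rewrite expr1.
have h1 : 1%:R <= t ^+ 0 by rewrite expr0.
have hS n a : n%:R <= t ^+ a -> n.+1%:R <= t ^+ (a + 0).+1.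
  by move=> h; rewrite -natr1; exact: le_powD.
have hA n m a b : n%:R <= t ^+ a -> m%:R <= t ^+ b -> (n + m)%:R <= t ^+ (a + b).+1.
  by move=> ? ?; rewrite natrD; exact: le_powD.
have hM n m a b : n%:R <= t ^+ a -> m%:R <= t ^+ b -> (n * m)%:R <= t ^+ (a + b).
  by move=> ? ?; rewrite natrM; exact: le_powM.
have hX n m a : n%:R <= t ^+ a -> (n ^ m)%:R <= t ^+ (a * m).
  by move=> ?; rewrite natrX exprM lerXn2r ?nnegrE // exprn_ge0 //; lra.
have hc n := le_pow_cst t2 n.
repeat first [eassumption | eapply hc | eapply hM | eapply hA | eapply hX | eapply hS].
Qed.

(* At accuracy [eps >= lam] the zero network is good enough; below, rescaling the
   weight by [lam ^- 2] reduces to [stage_net], followed by a clipping that turns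
   the growth of the value function into a growth bound for the network. *)
Lemma weighted_value_net {R : realType} (T : R) (N r k : nat) : (k <= N)%N ->
  exists C : nat, (0 < C)%N /\ forall dO (Om : measurableType dO) (P : probability Om R) D
    (g : R -> 'cV[R]_D -> R) (f : nat -> 'cV[R]_D -> Om -> 'cV[R]_D) (B : R),
  stage_data P T N g f B r ->
  forall (S : Om -> R) (Y : Om -> 'cV[R]_D) (b : R),
  measurable_fun setT S -> (forall x, 0 <= S x) -> vec_measurable Y -> 0 <= b ->
  (\int[P]_x (S x * (1 + enorm (Y x)) ^+ 2)%:E <= b%:E)%E ->
  forall eps : R, 0 < eps ->
  let theta := B * (Vbound B k * (1 + b)) / eps in
  exists Vh : @relu_net R D 1,
    [/\ (\int[P]_x (S x * (Vaux P T N g f k (Y x) - net_fun Vh (Y x)) ^+ 2)%:E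
          <= (eps ^+ 2)%:E)%E,
      (net_size Vh)%:R <= theta ^+ C &
      forall x, `|net_fun Vh x| <= theta ^+ C * (1 + enorm x)].
Proof.
move=> kN; have [C HC] := @stage_net R T N r k kN.
have [C' HC'] := @clip_size_poly R C.
(* [C'] serves the size and (2 k).+2 the growth, since the clipping bound is Vbound B k * B = B^(2 k
   + 2). *)
exists (C' + (2 * k).+2)%N; split=> [|dO Om P D g f B sd S Y b mS S0 mY b0 HS eps e0 theta]; first by rewrite addnS.
have B2 := sd_B sd; have DB := sd_D sd; have G1 := Vbound_ge1 sd k.
have bb : 0 <= Vbound B k * b by rewrite mulr_ge0 // (le_trans ler01).
(* lam^2 dominates [b], which normalises the weight, and [Vbound B k ^+ 2 * b], the error of the
   zero network; moreover B / (eps / lam) = theta. *)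
pose lam := Vbound B k * (1 + b).
have lam1 : 1 <= lam by rewrite /lam; nra.
have lamb : b <= lam ^+ 2 by rewrite /lam; have : b <= Vbound B k * (1 + b); nra.
have lam0 : 0 < lam by lra.
have x1 x : 0 <= 1 + @enorm R D x by rewrite addr_ge0 ?enorm_ge0.
have menY : measurable_fun setT (fun x => S x * (1 + enorm (Y x)) ^+ 2).
  apply: measurable_funM => //; apply: measurable_funX.
  apply: measurable_funD; first exact: measurable_cst.
  by apply: measurable_enorm => i; exact: vec_measurable_coord.
have S20 x : 0 <= S x * (1 + enorm (Y x)) ^+ 2 by rewrite mulr_ge0 ?sqr_ge0.
have mV : measurable_fun setT (fun w => Vaux P T N g f k (Y w)).
  exact: (Vaux_measurable sd).
have theta0 : 0 <= theta by rewrite /theta divr_ge0 ?mulr_ge0 ?(ltW lam0) ?(ltW e0) //; lra.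
have [le|lt] := lerP lam eps.
  have [phi [_ ps pe]] := @net_rep0 R D 0.
  exists phi; split => [||x].
  - apply: (@le_trans _ _ (\int[P]_x (Vbound B k ^+ 2 * (S x * (1 + enorm (Y x)) ^+ 2))%:E)%E).
      apply: ge0_le_integral_fin => x; first by rewrite mulr_ge0 ?sqr_ge0.
      rewrite pe subr0 [leRHS]mulrCA; apply: ler_wpM2l => //.
      rewrite -exprMn -(real_normK (num_real (Vaux _ _ _ _ _ _ _))).
      rewrite ler_pXn2r ?nnegrE ?(mulr_ge0 (le_trans ler01 G1) (x1 _)) //.
      exact: (Vaux_bound sd).
    rewrite ge0_integralZ_fin ?sqr_ge0 //.
    apply: le_trans (lee_wpmul2l _ HS) _; first by rewrite lee_fin sqr_ge0.
    rewrite -EFinM lee_fin; apply: (@le_trans _ _ (lam ^+ 2)).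
      by rewrite /lam exprMn; apply: ler_wpM2l; rewrite ?sqr_ge0 //; nra.
    by rewrite ler_pXn2r ?nnegrE // ltW.
  - by move: ps; rewrite leqn0 => /eqP ->; exact: exprn_ge0.
  - by rewrite pe normr0 mulr_ge0 ?exprn_ge0.
have il0 : 0 <= (lam ^+ 2)^-1 by rewrite invr_ge0 sqr_ge0.
have mS' : measurable_fun setT (fun x => (lam ^+ 2)^-1 * S x).
  by apply: measurable_funM => //; exact: measurable_cst.
have [|||L [K [h [hr hL hK hI]]]] := HC dO Om P D g f B sd dO Om P
    (fun x => (lam ^+ 2)^-1 * S x) Y mS' (fun x => mulr_ge0 il0 (S0 x)) mY _ (eps / lam).
- under eq_integral => x _ do rewrite -mulrA.
  rewrite ge0_integralZ_fin //; apply: le_trans (lee_wpmul2l _ HS) _; first by rewrite lee_fin.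
  by rewrite -EFinM lee_fin mulrC ler_pdivrMr ?mul1r // exprn_gt0.
- by rewrite divr_gt0.
- by rewrite ler_pdivrMr // mul1r ltW.
have thE : B / (eps / lam) = theta.
  by rewrite /theta -/lam; field; rewrite !gt_eqF.
have [h' [hr' h'b h'd]] := net_clip sd (le_trans ler01 G1) hr.
rewrite thE in hL hK.
have Bth : B <= theta.
  rewrite -thE ler_pdivlMr ?divr_gt0 // ler_piMr //; first by lra.
  by rewrite ler_pdivrMr // mul1r ltW.
have th2 : 2 <= theta by lra.
have [phi [_ ps pe]] := hr'.
exists phi; split => [||x].
- have mh : measurable_fun setT (fun x => h (Y x)) by exact: (net_rep_measurable hr mY).
  apply: (@le_trans _ _ (\int[P]_x (lam ^+ 2 *
      ((lam ^+ 2)^-1 * S x * (Vaux P T N g f k (Y x) - h (Y x)) ^+ 2))%:E)%E).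
    apply: ge0_le_integral_fin => x; first by rewrite mulr_ge0 ?sqr_ge0.
    rewrite -(mulrA (lam ^+ 2)^-1) mulVKf; last by rewrite expf_neq0 // gt_eqF.
    apply: ler_wpM2l => //; rewrite pe.
    rewrite -(real_normK (num_real (_ - h' _))) -(real_normK (num_real (_ - h _))).
    by rewrite ler_pXn2r ?nnegrE //; apply: h'd; exact: (Vaux_bound sd).
  rewrite ge0_integralZ_fin ?sqr_ge0 //; last 2 first.
  + by move=> x; apply: mulr_ge0; [exact: mulr_ge0|exact: sqr_ge0].
  + by apply: measurable_funM => //; apply: measurable_funX; exact: measurable_funB.
  apply: le_trans (lee_wpmul2l _ hI) _; first by rewrite lee_fin sqr_ge0.
  by rewrite -EFinM lee_fin -exprMn mulrC divfK // gt_eqF.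
- apply: (le_pow_mono th2 (leq_addr _ _)).
  apply: le_trans (HC' theta L K D th2 (le_trans DB Bth) hL hK).
  by rewrite ler_nat.
- rewrite pe; apply: le_trans (h'b x) _; apply: ler_wpM2r => //.
  apply: (le_pow_mono th2 (leq_addl _ _)).
  rewrite /Vbound -exprSr addn1; apply: lerXn2r; rewrite ?nnegrE //; lra.
Qed.

(** * Polynomial dependence on the dimension *)

Section PolynomialGrowth.
Context {R : realType}.
Implicit Types h : nat -> R.

(** Nonnegativity is included so that products and powers stay in the class; D >= 1 makes D^e grow
    with e, as sums require. *)
Definition poly_bounded h := exists k e : nat, forall D : nat, (0 < D)%N ->
  0 <= h D <= k%:R * D%:R ^+ e.

Lemma poly_bounded_cst (c : R) : 0 <= c -> poly_bounded (fun=> c).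
Proof.
move=> c0; have [M [_ cM _]] := exists_nat_approx c0.
by exists M, 0%N => D _; rewrite c0 expr0 mulr1.
Qed.

Lemma poly_bounded_id : poly_bounded (fun D => D%:R).
Proof. by exists 1%N, 1%N => D _; rewrite ler0n expr1 mul1r lexx. Qed.

Lemma poly_boundedM h1 h2 :
  poly_bounded h1 -> poly_bounded h2 -> poly_bounded (fun D => h1 D * h2 D).
Proof.
move=> [k1 [e1 H1]] [k2 [e2 H2]]; exists (k1 * k2)%N, (e1 + e2)%N => D D0.
have /andP[a1 b1] := H1 D D0; have /andP[a2 b2] := H2 D D0.
by rewrite mulr_ge0 // natrM exprD mulrACA ler_pM.
Qed.

Lemma poly_boundedD h1 h2 :
  poly_bounded h1 -> poly_bounded h2 -> poly_bounded (fun D => h1 D + h2 D).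
Proof.
move=> [k1 [e1 H1]] [k2 [e2 H2]]; exists (k1 + k2)%N, (e1 + e2)%N => D D0.
have /andP[a1 b1] := H1 D D0; have /andP[a2 b2] := H2 D D0.
have D1 : 1 <= D%:R :> R by rewrite ler1n.
rewrite addr_ge0 // natrD mulrDl; apply: lerD.
- by apply: le_trans b1 _; rewrite ler_wpM2l // ler_weXn2l // leq_addr.
- by apply: le_trans b2 _; rewrite ler_wpM2l // ler_weXn2l // leq_addl.
Qed.

Lemma poly_boundedX h n : poly_bounded h -> poly_bounded (fun D => h D ^+ n).
Proof.
move=> H; elim: n => [|n IH]; first exact: poly_bounded_cst.
have [k [e Hk]] := poly_boundedM H IH.
by exists k, e => D D0; rewrite exprS; exact: Hk.
Qed.

End PolynomialGrowth.

Theorem theorem6 (R : realType) (T : R) (N : nat)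
  (d : nat -> measure_display) (Omega : forall D : nat, measurableType (d D))
  (P : forall D : nat, probability (Omega D) R)
  (F : forall D : nat, R -> set (set (Omega D)))
  (W X : forall D : nat, R -> Omega D -> 'cV[R]_D)
  (x0 : forall D : nat, 'cV[R]_D)
  (g : forall D : nat, R -> 'cV[R]_D -> R)
  (f : forall D : nat, nat -> 'cV[R]_D -> Omega D -> 'cV[R]_D) :
  0 < T -> (0 < N)%N ->
  (* standing setting, for every dimension D *)
  (forall D : nat, (0 < D)%N ->
     is_filtration T (F D) /\ is_F_BM (P D) T (F D) (W D) /\
     (forall t, 0 <= t <= T -> vmeasurable_wrt (F D t) (X D t)) /\
     (forall w, X D 0 w = x0 D)) ->
  (* (C3)_p with p > 2 and constants c, q > 0 independent of D *)
  (exists p c q : R, 2 < p /\ 0 < c /\ 0 < q /\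
     forall D : nat, (0 < D)%N ->
       cond_C3 (P D) T N (F D) (X D) (x0 D) (f D) p c q) ->
  (* (C5) with constants c, q, r > 0 independent of D *)
  (exists c q r : R, 0 < c /\ 0 < q /\ 0 < r /\
     forall D : nat, (0 < D)%N -> cond_C5 T N (g D) c q r) ->
  forall n : nat, (n < N)%N ->
    exists c' q' tau : R, 1 <= c' /\ 1 <= q' /\ 1 <= tau /\
      forall D : nat, (0 < D)%N -> forall (eps : R), 0 < eps ->
      forall N0 : nat, (0 < N0)%N ->
        exists Vh : relu_net D 1,
          (rho_integral (P D) T N N0 n (W D) (X D)
             (fun z => ((Vfun (P D) T N (g D) (f D) n.+1 z - net_fun Vh z) ^+ 2)%R)
             <= (eps ^+ 2)%:E)%E /\
          (net_size Vh)%:R <= c' * D%:R `^ q' * eps `^ (- tau) /\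
          (forall x, `|net_fun Vh x| <= c' * D%:R `^ q' * eps `^ (- tau) * (1 + enorm x)).
Proof.
move=> T0 N0 setting [p [c [q [p2 [c0 [q0 HC3]]]]]] [c' [q' [r [c'0 [q'0 [r0 HC5]]]]]] n nN.
have nat_above (x : R) : 0 <= x -> exists m : nat, x <= m%:R.
  by move=> x_ge0; have [m [_ xm _]] := exists_nat_approx x_ge0; exists m.
(* With [Q] below, [b D] = cN D^Q is at least 1 and dominates the constants of both conditions. *)
have [cN cN_ge] := nat_above (1 + c + c') ltac:(lra).
have [Q Q_ge] := nat_above (q + q') ltac:(lra).
have [p1 p1_ge] := nat_above p ltac:(lra).
have [r1 r1_ge] := nat_above r ltac:(lra).
have p20 : 0 < p - 2 by lra.
(* The exponent required by [weighted_sq_le]. *)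
have [m m_ge] := nat_above (p / (p - 2)) ltac:(by rewrite divr_ge0 //; lra).
have pm : p <= m%:R * (p - 2) by rewrite -ler_pdivrMr.
(* [Vfun] at n + 1 is [Vaux] after this many backward steps. *)
pose k := (N - n.+1)%N; have kN : (k <= N)%N by exact: leq_subr.
pose b (D : nat) : R := cN%:R * D%:R ^+ Q.
pose B D := stage_cst D (b D) p1.
(* The bound of [increments_second_moment]; the power is [n.+2] because the state is taken at n +
   1. *)
pose brho D := T / N%:R * D%:R *
  (mom_cst (b D) p1 ^+ n.+2 + 1 + 4 * ((2 * m)`!)%:R * expR 3).
have TN0 : 0 <= T / N%:R by rewrite divr_ge0 // ltW.
have pb : poly_bounded b.
  by apply: poly_boundedM; [exact: poly_bounded_cst|exact: (poly_boundedX _ poly_bounded_id)].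
have pB : poly_bounded B.
  apply: poly_boundedM; last exact: poly_boundedX.
  by apply: poly_boundedM; [exact: poly_bounded_cst|exact: poly_bounded_id].
have pbrho : poly_bounded brho.
  apply: poly_boundedM; first by apply: poly_boundedM; [exact: poly_bounded_cst|exact: poly_bounded_id].
  apply: poly_boundedD; last by apply: poly_bounded_cst; rewrite mulr_ge0 ?expR_ge0.
  apply: poly_boundedD; last exact: poly_bounded_cst.
  apply: poly_boundedX; apply: poly_boundedM; first exact: poly_bounded_cst.
  by apply: poly_boundedX; apply: poly_boundedM => //; exact: poly_bounded_cst.
have [K [E HKE]] : poly_bounded (fun D => B D * (Vbound (B D) k * (1 + brho D))).
  apply: poly_boundedM => //; apply: poly_boundedM; first exact: poly_boundedX.
  by apply: poly_boundedD => //; exact: poly_bounded_cst.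
have [C [C0 HC]] := @weighted_value_net R T N r1.+1 k kN.
(* The networks are bounded by theta^C with theta <= K D^E / eps; the successors make the first two
   constants at least 1. *)
exists (K.+1%:R ^+ C), (E * C).+1%:R, C%:R.
split; first by rewrite exprn_ege1 // ler1n.
split; first by rewrite ler1n.
split; first by rewrite ler1n.
move=> D D0 eps e0 N00 N0_gt0.
have [Ffil [BM [Xad X0]]] := setting D D0.
have D1 : 1 <= D%:R :> R by rewrite ler1n.
have Dq x : x <= q + q' -> D%:R `^ x <= D%:R ^+ Q :> R.
  move=> xq; rewrite -powR_mulrn ?ler0n //; apply: ler_powR => //; exact: le_trans Q_ge.
have Dpow0 : 0 <= D%:R ^+ Q :> R by rewrite exprn_ge0.
have cb : c * D%:R `^ q <= b D.
  by apply: ler_pM; rewrite ?powR_ge0 ?(ltW c0) //; [lra|apply: Dq; lra].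
have cb' : c' * D%:R `^ q' <= b D.
  by apply: ler_pM; rewrite ?powR_ge0 ?(ltW c'0) //; [lra|apply: Dq; lra].
have b1 : 1 <= b D.
  have : 1 <= D%:R ^+ Q :> R by exact: exprn_ege1.
  by rewrite /b; have : 1 <= cN%:R :> R; [lra|nra].
have sd := stage_data_of_conditions T0 N0 D0 Ffil p2 (HC3 D D0) (HC5 D D0)
  b1 cb cb' c0 c'0 p1_ge r1_ge.
have mom := state_moment T0 N0 Ffil Xad X0 p2 (HC3 D D0) b1 cb c0 p1_ge nN.
have mX := X_measurable T0 N0 Ffil Xad nN.
have [mW Hw] := increments_second_moment T0 nN N0_gt0 p2 pm Ffil BM mX mom.
have /andP[brho0 _] : 0 <= brho D <= brho D.
  by have [K' [E' H]] := pbrho; have /andP[-> _] := H D D0; rewrite lexx.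
have mS : measurable_fun setT (fun w => \sum_(i < N00)
    enorm (W D (tgrid T N n + i.+1%:R * (T / (N * N00)%:R)) w -
           W D (tgrid T N n + i%:R * (T / (N * N00)%:R)) w) ^+ 2).
  apply: measurable_sum => i; apply: measurable_funX; apply: measurable_enorm => j.
  under [X in measurable_fun _ X]eq_fun => w do rewrite !mxE.
  by apply: measurable_funB; apply: mW => //; exact: ltnW.
have [Vh [Vi Vs Vg]] := HC _ _ _ _ _ _ _ sd _ _ (brho D) mS
  (fun w => sumr_ge0 _ (fun i _ => sqr_ge0 _)) mX brho0 Hw eps e0.
have theta_le : (B D * (Vbound (B D) k * (1 + brho D)) / eps) ^+ C <=
    K.+1%:R ^+ C * D%:R `^ (E * C).+1%:R * eps `^ (- C%:R).
  have /andP[l0 lb] := HKE D D0.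
  rewrite exprMn exprVn powRN !powR_mulrn ?(ltW e0) ?ler0n //.
  apply: ler_wpM2r; first by rewrite invr_ge0 exprn_ge0 // ltW.
  apply: (@le_trans _ _ (K.+1%:R ^+ C * D%:R ^+ (E * C))); last first.
    by apply: ler_wpM2l; [rewrite exprn_ge0|apply: ler_weXn2l].
  rewrite exprM -exprMn; apply: lerXn2r; rewrite ?nnegrE //.
  by apply: le_trans lb _; apply: ler_wpM2r; rewrite ?exprn_ge0 // ler_nat.
exists Vh; split; [exact: Vi|split => [|x]]; first exact: le_trans theta_le.
by apply: le_trans (Vg x) _; apply: ler_wpM2r; rewrite ?addr_ge0 ?enorm_ge0.
Qed.
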